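(* Let $\Gamma$ be a finitely generated torsion-free nilpotent group, let $\mathfrak{n}$ be its Malcev Lie algebra (a nilpotent Lie algebra over $\mathbb{Q}$) and set $\mathfrak{n}^{\mathbb{C}}=\mathbb{C}\otimes_{\mathbb{Q}}\mathfrak{n}$. The following assertions are equivalent: (i) $\Gamma$ is transitive self-similar; (ii) $\Gamma$ is densely self-similar; (iii) the Lie algebra $\mathfrak{n}^{\mathbb{C}}$ admits a special grading.
   Context: For a finite alphabet $A$, $A^\omega$ is the space of infinite words $a_1a_2\dots$ over $A$ with the profinite (product) topology. An action of a group $\Gamma$ on $A^\omega$ is self-similar if for every $\gamma\in\Gamma$ and $a\in A$ there exist $\gamma_a\in\Gamma$ and $b\in A$ with $\gamma(aw)=b\gamma_a(w)$ for all $w\in A^\omega$; this induces an action of $\Gamma$ on $A$ ($\gamma(a)=b$). A self-similar action is transitive if the induced action on $A$ is transitive. $\Gamma$ is transitive self-similar if it admits a faithful transitive self-similar action on some $A^\omega$ with $A$ finite, and densely self-similar if it admits a faithful self-similar action with dense orbits on some $A^\omega$ with $A$ finite. The Malcev Lie algebra of $\Gamma$ is the unique finite-dimensional nilpotent Lie algebra $\mathfrak{n}$ over $\mathbb{Q}$ containing $\Gamma$ as a multiplicative lattice, i.e. as a finitely generated subgroup of $\mathfrak{n}$ for the Campbell–Hausdorff product which generates $\mathfrak{n}$ as a Lie algebra. A grading of a Lie algebra $\mathfrak{m}$ is a decomposition $\mathfrak{m}=\oplus_{k\in\mathbb{Z}}\mathfrak{m}_k$ with $[\mathfrak{m}_k,\mathfrak{m}_l]\subset\mathfrak{m}_{k+l}$;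 it is special if $\mathfrak{m}_0\cap\mathfrak{z}=0$, where $\mathfrak{z}$ is the center of $\mathfrak{m}$. *)

(* Defs.v *)
From HB Require Import structures.
From mathcomp Require Import all_boot all_order all_algebra.
From mathcomp Require Import complex Rstruct.

Set Implicit Arguments.
Unset Strict Implicit.
Unset Printing Implicit Defensive.

Import GRing.Theory Num.Theory.

Definition Cplx : fieldType := complex Rdefinitions.R.

(* Finite-dimensional Lie algebras over a field F, given in a basis by their *)
(* structure constants: [e_i, e_j] = c i j.                                 *)
Section LieSC.
Local Open Scope ring_scope.
Variables (F : fieldType) (d : nat).
Implicit Types (c : 'I_d -> 'I_d -> 'rV[F]_d) (x y z : 'rV[F]_d).

Definition sc_bracket c x y : 'rV[F]_d :=
  \sum_(i < d) \sum_(j < d) (x 0 i * y 0 j) *: c i j.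

(* Lie algebra axioms (bilinearity is built in). *)
Definition is_lie_algebra c : Prop :=
  (forall x, sc_bracket c x x = 0) /\
  (forall x y z, sc_bracket c x (sc_bracket c y z)
               + sc_bracket c y (sc_bracket c z x)
               + sc_bracket c z (sc_bracket c x y) = 0).

Definition is_nilpotent_lie c : Prop :=
  exists N : nat, forall (x : 'rV[F]_d) (ys : seq 'rV[F]_d),
    size ys = N -> foldr (sc_bracket c) x ys = 0.

Fixpoint nested_bracket c (zs : seq 'rV[F]_d) : 'rV[F]_d :=
  match zs with
  | [::] => 0
  | [:: z] => z
  | z :: zs' => sc_bracket c z (nested_bracket c zs')
  end.

(* Campbell--Hausdorff product via Dynkin's formula, truncated at total
   degree N:
   X * Y = sum_{n>=1} (-1)^(n-1)/n  sum_{(r_i,s_i), r_i+s_i>0}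
     [X^{r_1} Y^{s_1} ... X^{r_n} Y^{s_n}] / ((sum_i (r_i+s_i)) prod_i r_i! s_i!). *)
Section Dynkin.
Variables (c : 'I_d -> 'I_d -> 'rV[F]_d) (N : nat).
Variables (X Y : 'rV[F]_d).
Variable (n : nat).
Implicit Type rs : {ffun 'I_n -> 'I_N.+1 * 'I_N.+1}.

Definition dynkin_word rs : seq 'rV[F]_d :=
  flatten [seq nseq (rs i).1 X ++ nseq (rs i).2 Y | i <- enum 'I_n].
Definition dynkin_degree rs : nat := (\sum_(i < n) ((rs i).1 + (rs i).2))%N.
Definition dynkin_fact rs : nat := (\prod_(i < n) ((rs i).1`! * (rs i).2`!))%N.
Definition dynkin_admissible rs : bool :=
  [forall i, (0 < (rs i).1 + (rs i).2)%N] && (dynkin_degree rs <= N)%N.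
End Dynkin.

(* Sum of all Dynkin terms of total degree <= N (n+1 = number of blocks). *)
Definition bch_trunc c (N : nat) x y : 'rV[F]_d :=
  \sum_(n < N)
   \sum_(rs : {ffun 'I_n.+1 -> 'I_N.+1 * 'I_N.+1} | dynkin_admissible rs)
     ((-1) ^+ n / ((n.+1)%:R * (dynkin_degree rs)%:R * (dynkin_fact rs)%:R))
       *: nested_bracket c (dynkin_word x y rs).

(* Campbell--Hausdorff product.  For a nilpotent Lie algebra of dimension d
   every bracket of d+1 elements vanishes, so truncating Dynkin's series at
   degree d gives the exact Campbell--Hausdorff product. *)
Definition ch_product c x y : 'rV[F]_d := bch_trunc c d x y.

Definition lie_generates c (S : 'rV[F]_d -> Prop) : Prop :=
  forall U : {vspace 'rV[F]_d},
    (forall x, S x -> x \in U) ->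
    (forall x y, x \in U -> y \in U -> sc_bracket c x y \in U) ->
    U = fullv.

Definition is_grading c (V : int -> {vspace 'rV[F]_d}) : Prop :=
  (exists s : seq int,
     [/\ uniq s, (forall k, k \notin s -> V k = 0%VS),
         directv (\sum_(k <- s) V k) & (\sum_(k <- s) V k)%VS = fullv])
  /\ (forall (k l : int) x y, x \in V k -> y \in V l ->
        sc_bracket c x y \in V (k + l)).

Definition in_center c x : Prop := forall y, sc_bracket c x y = 0.

Definition is_special_grading c (V : int -> {vspace 'rV[F]_d}) : Prop :=
  is_grading c V /\ (forall x, x \in V 0 -> in_center c x -> x = 0).

Definition has_special_grading c : Prop :=
  exists V : int -> {vspace 'rV[F]_d}, is_special_grading c V.

End LieSC.

Definition complexify (d : nat) (c : 'I_d -> 'I_d -> 'rV[rat]_d)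
  : 'I_d -> 'I_d -> 'rV[Cplx]_d :=
  fun i j => map_mx (@ratr Cplx) (c i j).

Section Groups.
Local Open Scope group_scope.
Variable G : groupType.

Definition finitely_generated : Prop :=
  exists s : seq G, forall P : G -> Prop,
    P 1 -> (forall x, x \in s -> P x) ->
    (forall x y, P x -> P y -> P (x * y^-1)) -> forall g, P g.

Definition torsion_free : Prop :=
  forall (g : G) (n : nat), (0 < n)%N -> g ^+ n = 1 -> g = 1.

(* nilpotent: all left-normed commutators [g_0, g_1, ..., g_c] of some fixed
   weight c+1 are trivial (i.e. gamma_{c+1}(G) = 1). *)
Definition nilpotent_group : Prop :=
  exists c : nat, forall (g0 : G) (gs : seq G),
    size gs = c -> foldl (@commg G) g0 gs = 1.

Definition is_malcev_lie_algebra (d : nat) (c : 'I_d -> 'I_d -> 'rV[rat]_d)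
    (iota : G -> 'rV[rat]_d) : Prop :=
  [/\ is_lie_algebra c, is_nilpotent_lie c, injective iota,
      (forall g h, iota (g * h) = ch_product c (iota g) (iota h))
    & lie_generates c (fun x => exists g, x = iota g)].

Definition cons_word (A : Type) (a : A) (w : nat -> A) : nat -> A :=
  fun k => if k is k'.+1 then w k' else a.

Definition is_action (A : Type) (act : G -> (nat -> A) -> (nat -> A)) :=
  (forall w, act 1 w =1 w) /\
  (forall g h w, act (g * h) w =1 act g (act h w)).

Definition is_self_similar A (act : G -> (nat -> A) -> (nat -> A)) :=
  forall (g : G) (a : A), exists (ga : G) (b : A),
    forall w, act g (cons_word a w) =1 cons_word b (act ga w).

Definition is_faithful A (act : G -> (nat -> A) -> (nat -> A)) :=
  forall g : G, (forall w, act g w =1 w) -> g = 1.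

Definition is_transitive A (act : G -> (nat -> A) -> (nat -> A)) :=
  forall a b : A, exists g : G, forall w, act g (cons_word a w) 0%N = b.

Definition has_dense_orbits A (act : G -> (nat -> A) -> (nat -> A)) :=
  forall (x y : nat -> A) (n : nat), exists g : G,
    forall i, (i < n)%N -> act g x i = y i.

Definition transitive_self_similar : Prop :=
  exists (A : finType) (act : G -> (nat -> A) -> (nat -> A)),
    [/\ is_action act, is_self_similar act, is_faithful act
      & is_transitive act].

Definition densely_self_similar : Prop :=
  exists (A : finType) (act : G -> (nat -> A) -> (nat -> A)),
    [/\ is_action act, is_self_similar act, is_faithful act
      & has_dense_orbits act].

End Groups.

(* Main.v *)
Require Import Defs.
From HB Require Import structures.
From mathcomp Require Import all_boot all_order all_algebra all_fingroup all_field.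
From mathcomp Require Import complex Rstruct.
From mathcomp Require Import boolp.
From mathcomp Require Import ring zify.
Import Defs.

Set Implicit Arguments.
Unset Strict Implicit.
Unset Printing Implicit Defensive.

(** A self-similar action restricts, on the stabiliser of a letter, to a virtual
    endomorphism of the group G: a homomorphism to G from a subgroup of finite
    index, with trivial core.  Conversely, such an endomorphism f gives a
    self-similar action on words in the cosets of its domain, whose orbits are
    dense as soon as every coset is met by the image of each iterate of f.

    (i) => (iii).  A subgroup closed under the Campbell-Hausdorff product contains
    a lattice of the Lie algebra it generates.  Applied to the graph of f, this
    shows that f extends to an endomorphism F of n.  Trivial core means that no
    nonzero central vector has an F-orbit with bounded denominators, so F is
    injective and has no central eigenvector for a root of unity.  A homomorphism
    from the group of eigenvalues to Z which is nonzero off the roots of unity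
    turns generalized eigenspaces into a special grading.

    (iii) => (ii).  A special grading is a derivation injective on the center, and
    by specialization there is a rational such derivation D.  Over a Galois field
    L containing its eigenvalues, let y : L -> Q be linear, integral on the
    spectrum and nonzero on nonzero eigenvalues.  For alpha and beta in L close to
    1 with coprime norms P and Q, put t(l) = prod_s s(alpha / beta)^y(s^-1 l).
    The matrix acting on the generalized eigenspace of l by t(l) is rational and
    is an automorphism F of n, congruent to 1 modulo the lattice away from PQ.
    At P, eigenvalues with y < 0 have unbounded powers of alpha in the denominator,
    at Q those with y > 0, whence the trivial core.  The generator theta of L is an
    integer modulo every power of alpha, so the projection onto the negative part
    is approximated by rational matrices; they split any element of the group into
    a part that F^-k keeps integral and a part that F keeps integral, which is the
    density condition. *)

(** * Self-similar actions and virtual endomorphisms *)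

Local Open Scope group_scope.

(** Two obstacles shape the proof. First, the Campbell-Hausdorff product is a group law only on the
    image of [iota]. Elsewhere group theory is replaced by one fact: the product differs from
    addition by brackets, a correction that contracts the lower central filtration. Equations are
    therefore solved by iteration, and factors cancelled one step of the series at a time. Second, a
    lattice sees the eigenvalues of D only through valuations, and no prime ideals are used. An
    element alpha = 1 + x theta of norm plus or minus P, with P prime to x and to finitely many bad
    denominators, takes the place of a prime of degree one, although P need not be prime. Indeed
    s(alpha) - alpha = x (s(theta) - theta) is a unit at P for s different from 1, so P / alpha is
    invertible modulo alpha. Hence a rational number divisible by alpha^k is divisible by P^k, and
    theta is congruent to an integer modulo alpha^k. This is how a projection defined only over L
    acts, to any required precision, as a rational matrix. *)

Lemma cons_word_eta (A : Type) (w : nat -> A) : cons_word (w 0%N) (fun k => w k.+1) = w.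
Proof. by apply/funext => -[|k]. Qed.

Lemma dense_transitive (G : groupType) :
  densely_self_similar G -> transitive_self_similar G.
Proof.
case=> A [act [Ha Hs Hf Hd]]; exists A, act; split=> // a b.
have [g Hg] := Hd (fun _ => a) (fun _ => b) 1%N; exists g => w.
have [ga [b' H]] := Hs g a.
have <- : b' = b.
  have <- : act g (fun _ => a) 0%N = b by exact: Hg.
  by rewrite -[fun _ => a]cons_word_eta H.
by rewrite H.
Qed.

(** A relation, since the endomorphism is only defined on a subgroup. Finite index enters only
    through a common exponent [m] that brings every element into the domain, and [vendo_core] is the
    triviality of the core. *)
Record virtual_endo (G : groupType) (R : G -> G -> Prop) : Prop := VirtualEndo {
  vendo_fun : forall g h h', R g h -> R g h' -> h = h';
  vendoM : forall g h g' h', R g h -> R g' h' -> R (g * g') (h * h');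
  vendo1 : R 1 1;
  vendoV : forall g h, R g h -> R g^-1 h^-1;
  vendo_index : exists2 m, (0 < m)%N & forall g, exists h, R (g ^+ m) h;
  vendo_core : forall N : G -> Prop,
    (forall g h, N g -> N (h^-1 * g * h)) ->
    (forall g, N g -> exists2 h, R g h & N h) -> forall g, N g -> g = 1 }.

(** * The stabilizer of a letter *)

Section TransitiveAction.
Variables (G : groupType) (A : finType) (act : G -> (nat -> A) -> (nat -> A)).
Hypotheses (Ha : is_action act) (Hs : is_self_similar act) (Hf : is_faithful act).
Hypothesis Ht : is_transitive act.
Variable a : A.

Let act1 w : act 1 w = w. Proof. by apply/funext => i; apply: Ha.1. Qed.
Let actM g h w : act (g * h) w = act g (act h w).
Proof. by apply/funext => i; apply: Ha.2. Qed.

Let Hs' g b : exists ga b', forall w, act g (cons_word b w) = cons_word b' (act ga w).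
Proof. by have [ga [b' H]] := Hs g b; exists ga, b' => w; apply/funext => i; apply: H. Qed.

Definition stab_rel (g h : G) := forall w, act g (cons_word a w) = cons_word a (act h w).

Lemma cons_word_inj (b b' : A) w w' : cons_word b w = cons_word b' w' -> b = b' /\ w = w'.
Proof.
move=> E; split; first by have := congr1 (fun w => w 0%N) E.
by apply/funext => i; have := congr1 (fun w => w i.+1) E.
Qed.

Let Hinj g h : (forall w, act g w = act h w) -> g = h.
Proof.
move=> E; apply/eqP; rewrite -[g]mulg1 -[X in g * X](mulVg h) mulgA.
have -> : g * h^-1 = 1; last by rewrite mul1g.
by apply: Hf => w i; rewrite actM E -actM mulgV act1.
Qed.

Let letter g b := act g (cons_word b (fun _ => a)) 0%N.
Let letterE g b w : act g (cons_word b w) 0%N = letter g b.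
Proof. by rewrite /letter; have [ga [b' H]] := Hs' g b; rewrite !H. Qed.

Let stabP g : letter g a = a -> exists h, stab_rel g h.
Proof.
have [h [b H]] := Hs' g a; rewrite /letter H /= => Eb; exists h => w.
by rewrite H Eb.
Qed.

Let act_prefix n : forall g w w', (forall i, (i < n)%N -> w i = w' i) ->
  forall i, (i < n)%N -> act g w i = act g w' i.
Proof.
elim: n => // n IH g w w' H i Hi.
rewrite -(cons_word_eta w) -(cons_word_eta w') -H //.
have [ga [b Hg]] := Hs' g (w 0%N); rewrite !Hg; case: i Hi => //= i Hi.
by apply: IH => // j Hj; apply: H.
Qed.

Lemma stab_virtual_endo : virtual_endo stab_rel.
Proof.
split.
- move=> g h h' H H'; apply: Hinj => w.
  by have := H w; rewrite H' => /cons_word_inj[].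
- by move=> g h g' h' H H' w; rewrite !actM H' H.
- by move=> w; rewrite !act1.
- move=> g h H w; have := H (act h^-1 w); rewrite -(actM h) mulgV act1.
  by move=> /(congr1 (act g^-1)) <-; rewrite -actM mulVg act1.
(* The orbit of [a] under a single [g] has at most #|A| letters, so its length divides the
   factorial. *)
- exists #|A|`!; first exact: fact_gt0.
  move=> g; apply: stabP.
  have lM h h' b : letter (h * h') b = letter h (letter h' b).
    rewrite {1}/letter actM; have [k [b' E]] := Hs' h' b.
    by rewrite E letterE; congr letter; rewrite /letter E.
  have l1 b : letter 1 b = b by rewrite /letter act1.
  have linj : injective (letter g).
    by move=> b b' /(congr1 (letter g^-1)); rewrite -!lM mulVg !l1.
  have lX k : letter (g ^+ k) a = iter k (letter g) a.
    by elim: k => [|k IH]; rewrite ?expg0 ?l1 // expgS lM IH.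
  rewrite lX; set o := fingraph.order (letter g) a.
  have [q ->] : exists q, #|A|`! = (q * o)%N.
    apply/dvdnP; apply: dvdn_fact.
    by rewrite fingraph.order_gt0 max_card.
  elim: q => // q IH; rewrite mulSn iterD IH.
  exact: fingraph.iter_order.
- move=> N Nconj Nstab g Ng; apply: Hf => w i.
  (* Induction on the length of the prefix fixed by all of [N]: transitivity moves the first letter
     to [a], conjugation stays in [N], and the section at [a] is in [N] again. *)
  suff K n : forall g, N g -> forall w i, (i < n)%N -> act g w i = w i by apply: (K i.+1).
  elim: n => // n IH {w i Ng}g Ng w i Hi.
  have [h Hh] := Ht a (w 0%N).
  have [k Hk Nk] := Nstab _ (Nconj g h Ng).
  have Ew : w = act h (act h^-1 w) by rewrite -actM mulgV act1.
  have Ea : act h^-1 w 0%N = a.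
    have [h' [b Hb]] := Hs' h^-1 (w 0%N).
    have := Hh (fun _ => a) => E.
    rewrite -(cons_word_eta w) letterE -[X in letter _ X]E -(letterE _ _ (fun k => act h (cons_word a (fun _ => a)) k.+1)).
    by rewrite cons_word_eta -actM mulVg act1.
  have Eg : act g w = act h (act (h^-1 * g * h) (act h^-1 w)).
    by rewrite -!actM -!mulgA mulVKg mulgV mulg1.
  rewrite Eg [in RHS]Ew; apply: (@act_prefix n.+1) => // {i Hi} i Hi.
  rewrite -(cons_word_eta (act h^-1 w)) Ea Hk; case: i Hi => //= i Hi.
  by apply: IH.
Qed.

End TransitiveAction.

Lemma transitive_virtual_endo (G : groupType) : transitive_self_similar G ->
  (forall g : G, g = 1) \/ exists R : G -> G -> Prop, virtual_endo R.
Proof.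
case=> A [act [Ha Hs Hf Ht]].
have [a _|A0] := pickP (fun _ : A => true).
  by right; exists (stab_rel act a); apply: stab_virtual_endo.
by left=> g; apply: Hf => w; have := A0 (w 0%N).
Qed.

(** * The action on words in cosets *)

Section DenseAction.
Variables (G : groupType) (A : finType) (idx : G -> A) (rep : A -> G) (f : G -> G).
Hypothesis repK : forall a, idx (rep a) = a.
Hypothesis rep1 : rep (idx 1) = 1.
Hypothesis idxP : forall g h, idx g = idx h <-> idx (g^-1 * h) = idx 1.
Hypothesis fM : forall g h, idx g = idx 1 -> idx h = idx 1 -> f (g * h) = f g * f h.
Hypothesis f_core : forall N : G -> Prop, (forall g h, N g -> N (h^-1 * g * h)) ->
  (forall g, N g -> idx g = idx 1 /\ N (f g)) -> forall g, N g -> g = 1.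
Hypothesis f_good : forall k g, exists2 s,
  (forall i, (i < k)%N -> idx (iter i f s) = idx 1) & idx (iter k f s) = idx g.

Let idx_mul g h h' : idx h = idx h' -> idx (g * h) = idx (g * h').
Proof. by move=> /idxP E; apply/idxP; rewrite invgM -mulgA mulKg. Qed.

Let f1 : f 1 = 1.
Proof.
have := fM (erefl (idx 1)) erefl; rewrite mul1g => /(congr1 (fun x => (f 1)^-1 * x)).
by rewrite mulVg mulKg.
Qed.

(** Coset representatives on both sides move [g] into the domain of [f], which is the stabilizer of
    the trivial coset. *)
Definition section_at g a := f ((rep (idx (g * rep a)))^-1 * g * rep a).

Fixpoint coset_act_rec n g (w : nat -> A) : A :=
  if n is n'.+1 then coset_act_rec n' (section_at g (w 0%N)) (fun k => w k.+1)
  else idx (g * rep (w 0%N)).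
Definition coset_act g w n := coset_act_rec n g w.

Let sec_stab g a : idx ((rep (idx (g * rep a)))^-1 * g * rep a) = idx 1.
Proof. by rewrite -mulgA; apply: (proj1 (idxP _ _)); rewrite repK. Qed.

Lemma coset_act1 w n : coset_act 1 w n = w n.
Proof.
elim: n w => [|n IH] w; rewrite /coset_act /=; first by rewrite mul1g repK.
have -> : section_at 1 (w 0%N) = 1 by rewrite /section_at mul1g repK mulg1 mulVg f1.
exact: IH (fun k => w k.+1).
Qed.

Let letterM g h a : idx (g * h * rep a) = idx (g * rep (idx (h * rep a))).
Proof. by rewrite -mulgA; apply: idx_mul; rewrite repK. Qed.

Lemma section_atM g h a :
  section_at (g * h) a = section_at g (idx (h * rep a)) * section_at h a.
Proof.
rewrite /section_at -fM ?sec_stab // letterM; congr f.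
by rewrite !mulgA mulgK.
Qed.

Lemma coset_actM g h w n : coset_act (g * h) w n = coset_act g (coset_act h w) n.
Proof.
elim: n g h w => [|n IH] g h w; rewrite /coset_act /=; first by rewrite letterM.
by rewrite section_atM; apply: IH.
Qed.

Lemma coset_act_prefix n g w w' : (forall i, (i <= n)%N -> w i = w' i) ->
  coset_act g w n = coset_act g w' n.
Proof.
elim: n g w w' => [|n IH] g w w' H; rewrite /coset_act /= H //.
by apply: IH => i Hi; apply: H.
Qed.

Let coset_actK g w : coset_act g^-1 (coset_act g w) = w.
Proof. by apply/funext => n; rewrite -coset_actM mulVg coset_act1. Qed.
Let coset_actVK g w : coset_act g (coset_act g^-1 w) = w.
Proof. by apply/funext => n; rewrite -coset_actM mulgV coset_act1. Qed.

(** Along the word whose letters are all the trivial coset, sections are plain values of [f],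
    because that coset is represented by 1. *)
Lemma coset_act_stab n s w : (forall i, w i = idx 1) ->
  (forall i, (i < n)%N -> idx (iter i f s) = idx 1) ->
  (forall i, (i < n)%N -> coset_act s w i = idx 1) /\ coset_act s w n = idx (iter n f s).
Proof.
elim: n s w => [|n IH] s w Hw Hi.
  by split=> //; rewrite /coset_act /= Hw rep1 mulg1.
have Hs0 : idx s = idx 1 by apply: (Hi 0%N).
have E : section_at s (w 0%N) = f s.
  by rewrite /section_at Hw rep1 !mulg1 Hs0 rep1 invg1 mul1g.
have [|i|H1 H2] := IH (f s) (fun k => w k.+1); first by move=> i; apply: Hw.
  by move=> Hin; rewrite -iterSr; apply: (Hi i.+1).
split; last by rewrite iterSr -H2 /coset_act /= E.
case=> [_|i Hin]; first by rewrite /coset_act /= Hw rep1 mulg1.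
by rewrite /coset_act /= E; apply: H1.
Qed.

Lemma virtual_endo_dense : densely_self_similar G.
Proof.
exists A, coset_act; split.
- by split=> [w n|g h w n]; [apply: coset_act1 | apply: coset_actM].
- move=> g a; exists (section_at g a), (idx (g * rep a)) => w -[|n] //.
- move=> g Hg; pose N h := forall w, coset_act h w =1 w.
  apply: (f_core (N := N)) => // {Hg}g.
    move=> h Hg w n; rewrite coset_actM coset_actM.
    have -> : coset_act g (coset_act h w) = coset_act h w by apply/funext => k; apply: Hg.
    by rewrite coset_actK.
  move=> Hg; have Hg1 : idx g = idx 1.
    by have := Hg (fun _ => idx 1) 0%N; rewrite /coset_act /= rep1 mulg1.
  split=> // w n; have := Hg (cons_word (idx 1) w) n.+1; rewrite /coset_act /=.
  by rewrite /section_at rep1 !mulg1 Hg1 rep1 invg1 mul1g.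
pose w0 := fun _ : nat => idx 1.
(* One letter at a time: once [g] gives the first [n] letters, [f_good] supplies an [s] that keeps
   the first [n] letters of [w0] and puts the missing one in position [n]. *)
have reach n y : exists g, forall i, (i < n)%N -> coset_act g w0 i = y i.
  elim: n => [|n [g Hg]]; first by exists 1.
  pose v := coset_act g^-1 y.
  have Hv i : (i < n)%N -> v i = idx 1.
    move=> Hi; rewrite -[idx 1]/(w0 i) -(coset_actK g w0); apply: coset_act_prefix => j Hj.
    by rewrite Hg //; apply: leq_ltn_trans Hi.
  have [s Hs1 Hs2] := f_good n (rep (v n)).
  have [Hs3 Hs4] := coset_act_stab (w := w0) (fun _ => erefl) Hs1.
  exists (g * s) => i Hi; rewrite coset_actM -[y](coset_actVK g) -/v.
  apply: coset_act_prefix => j Hj; have : (j <= n)%N by apply: leq_trans Hj _.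
  rewrite leq_eqVlt => /orP[/eqP->|Hjn]; first by rewrite Hs4 Hs2 repK.
  by rewrite Hs3 // Hv.
move=> x y n; have [gx Hx] := reach n x; have [gy Hy] := reach n y.
exists (gy * gx^-1) => i Hi; rewrite coset_actM -Hy //; apply: coset_act_prefix => j Hj.
rewrite -(coset_actK gx w0); apply: coset_act_prefix => k Hk; rewrite Hx //.
exact: leq_ltn_trans Hk (leq_ltn_trans Hj Hi).
Qed.

End DenseAction.

Local Close Scope group_scope.
Import Order.TTheory GRing.Theory Num.Theory.
Local Open Scope ring_scope.

(** * The Campbell-Hausdorff polynomial *)

Fixpoint nestb (V : nmodType) (br : V -> V -> V) (zs : seq V) : V :=
  match zs with
  | [::] => 0
  | [:: z] => z
  | z :: zs' => br z (nestb br zs')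
  end.

Definition sel (V : Type) (x y : V) (b : bool) := if b then y else x.

(* Dynkin's polynomial in an arbitrary bracket, with [T] listing the terms of
   degree at least 3: only this shape is used, never the associativity of the
   Campbell-Hausdorff product outside the group. *)
Definition bch_poly (V : lmodType rat) (T : seq (rat * seq bool))
    (br : V -> V -> V) (x y : V) : V :=
  x + y + 2%:R^-1 *: br x y
  + \sum_(t <- T) t.1 *: nestb br (map (sel x y) t.2).

Lemma nestb_cons (V : nmodType) (br : V -> V -> V) z zs :
  zs != [::] -> nestb br (z :: zs) = br z (nestb br zs).
Proof. by case: zs. Qed.

Lemma nested_bracketE (d : nat) (c : 'I_d -> 'I_d -> 'rV[rat]_d) zs :
  nested_bracket c zs = nestb (sc_bracket c) zs.
Proof.
elim: zs => // z [|z' zs] // IH.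
by change (sc_bracket c z (nested_bracket c (z' :: zs)) =
  sc_bracket c z (nestb (sc_bracket c) (z' :: zs))); rewrite IH.
Qed.

Definition blocks n N (rs : {ffun 'I_n -> 'I_N.+1 * 'I_N.+1}) : seq (nat * nat) :=
  [seq ((rs i).1 : nat, (rs i).2 : nat) | i <- enum 'I_n].

Definition bword (bl : seq (nat * nat)) : seq bool :=
  flatten [seq nseq a.1 false ++ nseq a.2 true | a <- bl].

Definition bcoef n (bl : seq (nat * nat)) : rat :=
  (-1) ^+ n / ((n.+1)%:R * (\sum_(a <- bl) (a.1 + a.2))%N%:R
    * (\prod_(a <- bl) (a.1`! * a.2`!))%N%:R).

Lemma blocks_degree n N (rs : {ffun 'I_n -> 'I_N.+1 * 'I_N.+1}) :
  dynkin_degree rs = (\sum_(a <- blocks rs) (a.1 + a.2))%N.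
Proof. by rewrite /blocks big_map big_enum. Qed.

Lemma size_bword bl : size (bword bl) = (\sum_(a <- bl) (a.1 + a.2))%N.
Proof.
elim: bl => [|a bl IH]; first by rewrite big_nil.
by rewrite /bword /= size_cat -/(bword bl) IH size_cat !size_nseq big_cons.
Qed.

Lemma dynkin_wordE d n N (rs : {ffun 'I_n -> 'I_N.+1 * 'I_N.+1}) (x y : 'rV[rat]_d) :
  dynkin_word x y rs = map (sel x y) (bword (blocks rs)).
Proof.
rewrite /dynkin_word /bword /blocks map_flatten -!map_comp; congr flatten.
by apply: eq_map => i /=; rewrite map_cat !map_nseq.
Qed.

Lemma bcoefE n N (rs : {ffun 'I_n.+1 -> 'I_N.+1 * 'I_N.+1}) :
  (-1) ^+ n / ((n.+1)%:R * (dynkin_degree rs)%:R * (dynkin_fact rs)%:R)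
  = bcoef n (blocks rs).
Proof.
rewrite /bcoef blocks_degree; congr (_ / (_ * _ * _%:R)).
by rewrite /blocks big_map big_enum.
Qed.

Lemma sum_ffun1 (J : finType) (V : nmodType) (P : pred {ffun 'I_1 -> J})
    (G : {ffun 'I_1 -> J} -> V) :
  \sum_(f | P f) G f = \sum_(a | P [ffun _ => a]) G [ffun _ => a].
Proof.
rewrite (reindex (fun a : J => [ffun _ : 'I_1 => a])) //=.
exists (fun f => f ord0) => [a _|f _]; first by rewrite ffunE.
by apply/ffunP => i; rewrite ffunE (ord1 i).
Qed.

Definition ffun2 (J : Type) (p : J * J) : {ffun 'I_2 -> J} :=
  [ffun i : 'I_2 => if i == ord0 then p.1 else p.2].

Lemma sum_ffun2 (J : finType) (V : nmodType) (P : pred {ffun 'I_2 -> J})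
    (G : {ffun 'I_2 -> J} -> V) :
  \sum_(f | P f) G f = \sum_(p | P (ffun2 p)) G (ffun2 p).
Proof.
rewrite (reindex (@ffun2 J)) //=.
exists (fun f => (f ord0, f (lift ord0 ord0))) => [[a b] _|f _].
  by rewrite /ffun2 !ffunE.
apply/ffunP => i; rewrite ffunE; case: eqP => [->//|/eqP Hi]; congr (f _).
by apply/val_inj; case: i Hi => [[|[|?]]].
Qed.

Lemma sum_small1 (V : nmodType) M (G : nat -> nat -> V) :
  \sum_(p : 'I_M.+2 * 'I_M.+2 | (p.1 + p.2 == 1)%N) G p.1 p.2 = G 1%N 0%N + G 0%N 1%N.
Proof.
pose a : 'I_M.+2 * 'I_M.+2 := (lift ord0 ord0, ord0).
pose b : 'I_M.+2 * 'I_M.+2 := (ord0, lift ord0 ord0).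
rewrite (bigD1 a) //= (bigD1 b) //= big1 ?addr0 // => -[i j] /=.
rewrite /a /b !xpair_eqE -!val_eqE /= /bump /=; lia.
Qed.

Lemma sum_small2 (V : nmodType) M (G : nat -> nat -> V) :
  \sum_(p : 'I_M.+3 * 'I_M.+3 | (p.1 + p.2 == 2)%N) G p.1 p.2
  = G 2%N 0%N + G 1%N 1%N + G 0%N 2%N.
Proof.
pose a : 'I_M.+3 * 'I_M.+3 := (lift ord0 (lift ord0 ord0), ord0).
pose b : 'I_M.+3 * 'I_M.+3 := (lift ord0 ord0, lift ord0 ord0).
pose c : 'I_M.+3 * 'I_M.+3 := (ord0, lift ord0 (lift ord0 ord0)).
rewrite (bigD1 a) //= (bigD1 b) //= (bigD1 c) //= big1 ?addr0 ?addrA // => -[i j] /=.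
rewrite /a /b !xpair_eqE -!val_eqE /= /bump /=; lia.
Qed.

(** Only the terms of degree one and two are computed; the others are collected in [T]. The
    dimension is at least two so that the truncation reaches degree two. *)
Lemma bch_truncE d : exists T : seq (rat * seq bool),
  (forall t, t \in T -> (3 <= size t.2)%N) /\
  forall c : 'I_d.+2 -> 'I_d.+2 -> 'rV[rat]_d.+2,
    (forall x, sc_bracket c x x = 0) ->
    forall x y, bch_trunc c d.+2 x y = bch_poly T (sc_bracket c) x y.
Proof.
pose PP n (rs : {ffun 'I_n.+1 -> 'I_d.+3 * 'I_d.+3}) :=
  dynkin_admissible rs && (2 < dynkin_degree rs)%N.
exists (flatten [seq [seq (bcoef n (blocks rs), bword (blocks rs))
          | rs <- enum (@PP n)] | n <- iota 0 d.+2]); split.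
  move=> t /flattenP[s /seq.mapP[n _ ->] /seq.mapP[rs]]; rewrite mem_enum => /andP[_ H] -> /=.
  by rewrite size_bword -blocks_degree.
move=> c cxx x y; set br := sc_bracket c; rewrite /bch_trunc /bch_poly.
pose tm n bl := bcoef n bl *: nestb br (map (sel x y) (bword bl)).
transitivity (\sum_(n < d.+2) \sum_(rs : {ffun 'I_n.+1 -> 'I_d.+3 * 'I_d.+3} |
    dynkin_admissible rs) tm n (blocks rs)).
  apply: eq_bigr => n _; apply: eq_bigr => rs _.
  by rewrite bcoefE dynkin_wordE nested_bracketE.
transitivity (\sum_(n < d.+2) (\sum_(rs : {ffun 'I_n.+1 -> 'I_d.+3 * 'I_d.+3} |
    dynkin_admissible rs && ~~ (2 < dynkin_degree rs)%N) tm n (blocks rs)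
  + \sum_(rs | PP n rs) tm n (blocks rs))).
  by apply: eq_bigr => n _; rewrite (bigID (fun rs => 2 < dynkin_degree rs)%N) /= addrC.
rewrite big_split; congr (_ + _); last first.
  rewrite big_flatten big_map -(big_mkord xpredT (fun n => \sum_(rs | PP n rs) tm n (blocks rs))).
  rewrite /index_iota subn0; apply: eq_bigr => n _.
  by rewrite big_map big_enum.
(* Three or more nonempty blocks have degree at least three, so only one or two blocks remain
   here. *)
rewrite !big_ord_recl /= [X in _ + (_ + X)]big1 ?addr0; last first.
  move=> n _; rewrite big_pred0 // => rs; apply/negbTE; rewrite negb_and negbK.
  rewrite -implybE; apply/implyP => /andP[/forallP H _].
  have: (\sum_(i < (bump 0 (bump 0 n)).+1) 1 <= dynkin_degree rs)%N by apply: leq_sum.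
  by rewrite sum1_card card_ord /bump /=; lia.
rewrite sum_ffun1 sum_ffun2.
have adm1 (p : 'I_d.+3 * 'I_d.+3) : dynkin_admissible [ffun _ : 'I_1 => p] &&
   ~~ (2 < dynkin_degree [ffun _ : 'I_1 => p])%N
   = (p.1 + p.2 == 1)%N || (p.1 + p.2 == 2)%N.
  rewrite /dynkin_admissible /dynkin_degree big_ord1 !ffunE.
  have -> : [forall i, (0 < ([ffun=> p] (i : 'I_1)).1 + ([ffun=> p] i).2)%N] = (0 < p.1 + p.2)%N.
    by apply/forallP/idP => [/(_ ord0)|H i]; rewrite ffunE.
  lia.
have bl1 (p : 'I_d.+3 * 'I_d.+3) :
    blocks [ffun _ : 'I_1 => p] = [:: (p.1 : nat, p.2 : nat)].
  by rewrite /blocks enum_ordSl (size0nil (size_enum_ord 0)) /= ffunE.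
have bl2 (p : ('I_d.+3 * 'I_d.+3) * ('I_d.+3 * 'I_d.+3)) :
    blocks (ffun2 p) = [:: (p.1.1 : nat, p.1.2 : nat); (p.2.1 : nat, p.2.2 : nat)].
  by rewrite /blocks !enum_ordSl (size0nil (size_enum_ord 0)) /= !ffunE.
have adm2 (p : ('I_d.+3 * 'I_d.+3) * ('I_d.+3 * 'I_d.+3)) :
   dynkin_admissible (ffun2 p) && ~~ (2 < dynkin_degree (ffun2 p))%N
   = (p.1.1 + p.1.2 == 1)%N && (p.2.1 + p.2.2 == 1)%N.
  rewrite /dynkin_admissible /dynkin_degree !big_ord_recl big_ord0 !ffunE /=.
  have -> : [forall i, (0 < (ffun2 p (i : 'I_2)).1 + (ffun2 p i).2)%N]
     = (0 < p.1.1 + p.1.2)%N && (0 < p.2.1 + p.2.2)%N.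
    apply/forallP/andP => [H|[H1 H2] i].
      by have := H ord0; have := H (lift ord0 ord0); rewrite !ffunE.
    by rewrite ffunE; case: ifP.
  lia.
rewrite (eq_bigl _ _ adm1) (eq_bigl _ _ adm2).
rewrite (eq_bigr _ (fun p _ => congr1 (tm 0%N) (bl1 p))).
rewrite (eq_bigr _ (fun p _ => congr1 (tm 1%N) (bl2 p))).
rewrite (bigID (fun p : 'I_d.+3 * 'I_d.+3 => (p.1 + p.2 == 1)%N)) /=.
rewrite (eq_bigl (fun p : 'I_d.+3 * 'I_d.+3 => (p.1 + p.2 == 1)%N)); last first.
  by move=> p /=; lia.
rewrite [X in _ + X + _](eq_bigl (fun p : 'I_d.+3 * 'I_d.+3 => (p.1 + p.2 == 2)%N)); last first.
  by move=> p /=; lia.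
rewrite (sum_small1 _ (fun i j : nat => tm 0%N [:: (i, j)])).
rewrite (sum_small2 _ (fun i j : nat => tm 0%N [:: (i, j)])).
rewrite -(pair_big (fun a : 'I_d.+3 * 'I_d.+3 => (a.1 + a.2 == 1)%N)
  (fun a : 'I_d.+3 * 'I_d.+3 => (a.1 + a.2 == 1)%N)
  (fun a b => tm 1%N [:: (a.1 : nat, a.2 : nat); (b.1 : nat, b.2 : nat)])) /=.
under eq_bigr => a _ do
  rewrite (sum_small1 _ (fun i j : nat => tm 1%N [:: (a.1 : nat, a.2 : nat); (i, j)])).
rewrite (sum_small1 _ (fun i j : nat => tm 1%N [:: (i, j); (1%N, 0%N)] + tm 1%N [:: (i, j); (0%N, 1%N)])).
have bxx z : br z z = 0 by exact: cxx.
rewrite /tm /bword /bcoef !big_cons !big_nil /sel /= !bxx !scaler0 !add0r !addr0.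
have cyx : br y x = - br x y.
  have brD u v w : br (u + v) w = br u w + br v w.
    rewrite /br /sc_bracket -big_split /=; apply: eq_bigr => i _.
    by rewrite -big_split /=; apply: eq_bigr => j _; rewrite mxE mulrDl scalerDl.
  have brD' u v w : br w (u + v) = br w u + br w v.
    rewrite /br /sc_bracket -big_split /=; apply: eq_bigr => i _.
    by rewrite -big_split /=; apply: eq_bigr => j _; rewrite mxE mulrDr scalerDl.
  have := bxx (x + y); rewrite brD !brD' !bxx add0r addr0 => /eqP.
  by rewrite addrC addr_eq0 => /eqP.
rewrite cyx.
rewrite scalerN -scaleNr -scalerDl -(addrA _ _ (_ *: br x y)) -scalerDl.
(* The coefficient [e] is 1/2 from the single block, -1/4 from the two blocks x, y and +1/4 from the
   two blocks y, x. *)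
have -> (a b e : rat) : a = 1 -> b = 1 -> e = 2%:R^-1 ->
  a *: x + b *: y + e *: br x y = x + y + 2%:R^-1 *: br x y.
    by move=> -> -> ->; rewrite !scale1r.
- by [].
- by apply/eqP.
- by apply/eqP.
- by apply/eqP.
Qed.

(** * Lie algebras and lower central series *)

(** Kept apart from structure constants so that it also covers the product of two copies of the Lie
    algebra, in which the graph of an endomorphism lives. *)
Record is_lie (F : fieldType) (V : lmodType F) (br : V -> V -> V) : Prop := IsLie {
  brDl : forall x y z, br (x + y) z = br x z + br y z;
  brDr : forall x y z, br z (x + y) = br z x + br z y;
  brZl : forall a x z, br (a *: x) z = a *: br x z;
  brxx : forall x, br x x = 0;
  br_jacobi : forall x y z, br x (br y z) + br y (br z x) + br z (br x y) = 0 }.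

Section LieBasics.
Variables (F : fieldType) (V : lmodType F) (br : V -> V -> V).
Hypothesis Lbr : is_lie br.

Lemma br_anti x y : br y x = - br x y.
Proof.
have := brxx Lbr (x + y); rewrite (brDl Lbr) !(brDr Lbr) !(brxx Lbr) add0r addr0.
by move/eqP; rewrite addrC addr_eq0 => /eqP.
Qed.

Lemma br0l z : br 0 z = 0.
Proof. by have := brZl Lbr 0 0 z; rewrite !scale0r. Qed.

Lemma br0r z : br z 0 = 0.
Proof. by rewrite br_anti br0l oppr0. Qed.

Lemma brZr a x z : br z (a *: x) = a *: br z x.
Proof. by rewrite br_anti (brZl Lbr) -scalerN -br_anti. Qed.

Lemma brNl x z : br (- x) z = - br x z.
Proof. by rewrite -scaleN1r (brZl Lbr) scaleN1r. Qed.

Lemma brNr x z : br z (- x) = - br z x.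
Proof. by rewrite br_anti brNl opprK br_anti. Qed.

Lemma brBl x y z : br (x - y) z = br x z - br y z.
Proof. by rewrite (brDl Lbr) brNl. Qed.

Lemma brBr x y z : br z (x - y) = br z x - br z y.
Proof. by rewrite (brDr Lbr) brNr. Qed.

Lemma br_suml I (s : seq I) (P : pred I) G z :
  br (\sum_(i <- s | P i) G i) z = \sum_(i <- s | P i) br (G i) z.
Proof.
apply: (big_morph (fun x => br x z)) => [x y|]; [exact: brDl | exact: br0l].
Qed.

Lemma br_sumr I (s : seq I) (P : pred I) G z :
  br z (\sum_(i <- s | P i) G i) = \sum_(i <- s | P i) br z (G i).
Proof.
apply: (big_morph (fun x => br z x)) => [x y|]; [exact: brDr | exact: br0r].
Qed.

Lemma br_jacobi2 x y z : br (br x y) z = br x (br y z) - br y (br x z).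
Proof.
have := br_jacobi Lbr x y z.
rewrite (br_anti (br x y) z) (br_anti x z) brNr => /eqP.
by rewrite subr_eq0 => /eqP.
Qed.

Lemma nestb_line (s : V) (zs : seq V) : (1 < size zs)%N ->
  (forall z, z \in zs -> exists a, z = a *: s) -> nestb br zs = 0.
Proof.
elim: zs => // z [//|z' zs] IH _ H.
rewrite nestb_cons //; case: zs => [|z'' zs] in IH H *; last first.
  by rewrite IH ?br0r // => u Hu; apply: H; rewrite inE Hu orbT.
have [a ->] := H z (mem_head _ _); have [|b ->] := H z'; first by rewrite !inE eqxx orbT.
by rewrite /= (brZl Lbr) brZr (brxx Lbr) !scaler0.
Qed.

Lemma nestb_sub z z' zs zs' : size zs = size zs' -> zs != [::] ->
  nestb br (z :: zs) - nestb br (z' :: zs') =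
  br (z - z') (nestb br zs) + br z' (nestb br zs - nestb br zs').
Proof.
move=> Hs Hz; have Hz' : zs' != [::] by rewrite -size_eq0 -Hs size_eq0.
by rewrite !nestb_cons // brBl brBr addrA subrK.
Qed.

End LieBasics.

Lemma sc_bracket_lie (F : fieldType) d (c : 'I_d -> 'I_d -> 'rV[F]_d) :
  is_lie_algebra c -> is_lie (sc_bracket c).
Proof.
case=> Hxx Hj; split => //.
- move=> x y z; rewrite /sc_bracket -big_split /=; apply: eq_bigr => i _.
  by rewrite -big_split /=; apply: eq_bigr => j _; rewrite mxE mulrDl scalerDl.
- move=> x y z; rewrite /sc_bracket -big_split /=; apply: eq_bigr => i _.
  by rewrite -big_split /=; apply: eq_bigr => j _; rewrite mxE mulrDr scalerDl.
- move=> a x z; rewrite /sc_bracket scaler_sumr; apply: eq_bigr => i _.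
  by rewrite scaler_sumr; apply: eq_bigr => j _; rewrite mxE scalerA mulrA.
Qed.

Section Lcs.
Variables (F : fieldType) (V : vectType F) (br : V -> V -> V).
Hypothesis Lbr : is_lie br.

Definition commv (U W : {vspace V}) : {vspace V} :=
  <<[seq br x y | x <- vbasis U, y <- vbasis W]>>%VS.

Lemma mem_commv (U W : {vspace V}) x y : x \in U -> y \in W -> br x y \in commv U W.
Proof.
move=> Hx Hy; rewrite (coord_vbasis Hx) (coord_vbasis Hy) (br_suml Lbr).
apply: memv_suml => i _; rewrite (brZl Lbr) (br_sumr Lbr); apply: memvZ.
apply: memv_suml => j _; rewrite (brZr Lbr); apply/memvZ/memv_span.
by apply: allpairs_f; rewrite mem_nth // size_tuple.
Qed.

Lemma commv_le (U W A : {vspace V}) :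
  (forall x y, x \in U -> y \in W -> br x y \in A) -> (commv U W <= A)%VS.
Proof.
move=> H; apply/span_subvP => _ /allpairsP[[x y] [/= Hx Hy ->]].
by apply: H; apply: vbasis_mem.
Qed.

(** The index is shifted: [lcs U 0] is [U] itself, so brackets of levels [i] and [j] fall in level
    [i + j + 1]. *)
Fixpoint lcs (U : {vspace V}) j := if j is j'.+1 then commv U (lcs U j') else U.

Variable U : {vspace V}.
Hypothesis Ubr : forall x y, x \in U -> y \in U -> br x y \in U.

Lemma br_lcsS j x y : x \in U -> y \in lcs U j -> br x y \in lcs U j.+1.
Proof. exact: mem_commv. Qed.

Lemma br_lcsSr j x y : x \in lcs U j -> y \in U -> br x y \in lcs U j.+1.
Proof. by move=> Hx Hy; rewrite (br_anti Lbr) memvN br_lcsS. Qed.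

Lemma lcsS_sub j : (lcs U j.+1 <= lcs U j)%VS.
Proof.
elim: j => [|j IH]; apply: commv_le => x y Hx Hy; first exact: Ubr.
by apply: br_lcsS => //; apply: (subvP IH).
Qed.

Lemma lcs_anti i j : (i <= j)%N -> (lcs U j <= lcs U i)%VS.
Proof.
elim: j => [|j IH]; first by rewrite leqn0 => /eqP->; rewrite subvv.
rewrite leq_eqVlt => /orP[/eqP<-|]; first by rewrite subvv.
by move/IH; apply: subv_trans; apply: lcsS_sub.
Qed.

Lemma lcs_subU j x : x \in lcs U j -> x \in U.
Proof. exact: (subvP (@lcs_anti 0 j (leq0n j))). Qed.

Lemma lcs_add j (P : V -> Prop) :
  (forall x y, x \in U -> y \in lcs U j -> P (br x y)) ->
  (forall a x y, P x -> P y -> P (a *: x + y)) -> P 0 ->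
  forall v, v \in lcs U j.+1 -> P v.
Proof.
move=> H1 H2 H0 v; rewrite /= /commv; set s := [seq _ | _ <- _, _ <- _] => Hv.
rewrite (@coord_span _ _ _ (in_tuple s) v Hv).
apply: (big_ind P) => // [x y Hx Hy|i _]; first by rewrite -[x]scale1r; apply: H2.
rewrite -[_ *: _]addr0; apply: H2 => //.
have : (in_tuple s)`_i \in s by apply: mem_nth.
case/allpairsP=> -[x y] [/= Hx Hy ->].
by apply: H1; apply: vbasis_mem.
Qed.

Lemma br_lcs i j x y : x \in lcs U i -> y \in lcs U j -> br x y \in lcs U (i + j).+1.
Proof.
elim: i j x y => [|i IH] j x y; first exact: br_lcsS.
move=> + Hy; apply: (@lcs_add i (fun x => br x y \in lcs U (i.+1 + j).+1)).
- move=> u v Hu Hv; rewrite (br_jacobi2 Lbr) rpredB //.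
    by rewrite addSn; apply: br_lcsS => //; apply: IH.
  rewrite (br_anti Lbr) addSn -addnS rpredN (br_anti Lbr) rpredN.
  by apply: IH => //; apply: br_lcsS.
- by move=> a u v Hu Hv; rewrite (brDl Lbr) (brZl Lbr) rpredD // rpredZ.
- by rewrite (br0l Lbr) mem0v.
Qed.

Lemma nestb_lcs_U zs : zs != [::] -> all (mem U) zs ->
  nestb br zs \in lcs U (size zs).-1.
Proof.
elim: zs => // z [|z' zs] IH _ /andP[Hz Hzs]; first exact: Hz.
by rewrite nestb_cons //; apply: br_lcsS => //; apply: IH.
Qed.

Lemma nestb_lcs i z zs : all (mem U) zs -> z \in lcs U i -> z \in zs ->
  nestb br zs \in lcs U (i + size zs).-1.
Proof.
elim: zs => // z' [|z'' zs] IH /andP[Hz' Hzs] Hz; rewrite inE.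
  by move=> /eqP <- /=; rewrite addn1.
rewrite nestb_cons //; case/orP => [/eqP E|Hin].
  rewrite -E; have := br_lcs Hz (nestb_lcs_U (isT : z'' :: zs != [::]) Hzs).
  by rewrite /= !addnS.
have := IH Hzs Hz Hin; rewrite /= !addnS /= => H.
exact: br_lcsS.
Qed.

(** The arguments are changed one at a time. As soon as there is a bracket, each difference is
    bracketed with an element of [U] and gains a level. *)
Lemma nestb_cong i zs zs' : size zs = size zs' -> all (mem U) zs -> all (mem U) zs' ->
  (forall k, (k < size zs)%N -> zs`_k - zs'`_k \in lcs U i) ->
  nestb br zs - nestb br zs' \in lcs U (i + (1 < size zs)%N).
Proof.
elim: zs zs' => [|z zs IH] [|z' zs'] //; first by rewrite subrr mem0v.
case=> Hs /andP[Hz Hzs] /andP[Hz' Hzs'] H.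
have H0 := H 0%N isT; rewrite /= in H0.
case: zs zs' => [|y zs] [|y' zs'] // in IH Hs Hzs Hzs' H *; first by rewrite addn0.
rewrite [(1 < _)%N]/= addn1 (nestb_sub Lbr) //.
have HU : nestb br (y :: zs) \in U by apply: lcs_subU; apply: nestb_lcs_U.
apply: rpredD; first exact: br_lcsSr.
apply: br_lcsS => //; have {}IH := IH (y' :: zs') Hs Hzs Hzs' (fun k Hk => H k.+1 Hk).
by apply: (subvP (lcs_anti _) _ IH); rewrite leq_addr.
Qed.

End Lcs.

(** An element of [lcs U j] already carries [j] brackets, so [N - j] further ones kill it. *)
Lemma lcs_nilp (F : fieldType) (V : vectType F) (br : V -> V -> V) (N : nat) :
  is_lie br ->
  (forall (x : V) ys, size ys = N -> foldr br x ys = 0) ->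
  forall U : {vspace V}, lcs br U N = 0%VS.
Proof.
move=> Lbr H U.
have K j v : (j <= N)%N -> v \in lcs br U j ->
   forall ys, size ys = (N - j)%N -> foldr br v ys = 0.
  elim: j v => [|j IH] v Hj; first by rewrite subn0 => _ ys /H.
  apply: (lcs_add (br := br) (U := U) (j := j) (P := fun v => forall ys, size ys = (N - j.+1)%N -> foldr br v ys = 0)).
  - move=> x y _ Hy ys Hys; have := IH y (ltnW Hj) Hy (rcons ys x).
    by rewrite foldr_rcons; apply; rewrite size_rcons Hys subnSK.
  - have lin a x y ys : foldr br (a *: x + y) ys = a *: foldr br x ys + foldr br y ys.
      by elim: ys => //= z ys ->; rewrite (brDr Lbr) (brZr Lbr).
    by move=> a x y Hx Hy ys Hys; rewrite lin Hx // Hy // scaler0 addr0.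
  - by move=> ys _; elim: ys => //= z ys ->; rewrite (br0r Lbr).
apply/eqP; rewrite -subv0; apply/subvP => v Hv; rewrite memv0; apply/eqP.
by have := K N v (leqnn N) Hv [::]; apply; rewrite subnn.
Qed.

(** * The Campbell-Hausdorff product and the lower central filtration *)

Section BchLcs.
Variables (V : vectType rat) (br : V -> V -> V) (T : seq (rat * seq bool)).
Hypothesis Lbr : is_lie br.
Hypothesis T3 : forall t, t \in T -> (3 <= size t.2)%N.
Variable U : {vspace V}.
Hypothesis Ubr : forall x y, x \in U -> y \in U -> br x y \in U.
Notation C := (lcs br U).
Notation bch := (bch_poly T br).

Lemma bch_line a b s : bch (a *: s) (b *: s) = (a + b) *: s.
Proof.
rewrite /bch_poly (brZl Lbr) (brZr Lbr) (brxx Lbr) !scaler0 addr0 scalerDl.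
rewrite big_seq big1 ?addr0 // => t /T3 Ht.
rewrite (@nestb_line _ _ br Lbr s) ?scaler0 ?size_map //; first exact: leq_trans Ht.
by move=> z /seq.mapP[[] _ ->] /=; [exists b | exists a].
Qed.

Lemma bch0r x : bch x 0 = x.
Proof. by have := bch_line 1 0 x; rewrite scale0r addr0 scale1r. Qed.

Lemma bch0l x : bch 0 x = x.
Proof. by have := bch_line 0 1 x; rewrite scale0r add0r scale1r. Qed.

Lemma bchN x : bch (- x) x = 0.
Proof. by have := bch_line (-1) 1 x; rewrite scaleN1r scale1r addNr scale0r. Qed.

Lemma all_sel (x y : V) w : x \in U -> y \in U -> all (mem U) (map (sel x y) w).
Proof. by move=> Hx Hy; apply/allP => z /seq.mapP[[] _ ->]. Qed.

Lemma bch_lcs2 i x y : x \in U -> y \in U -> (x \in C i \/ y \in C i) ->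
  bch x y - (x + y + 2%:R^-1 *: br x y) \in C i.+2.
Proof.
move=> Hx Hy Hi; rewrite /bch_poly [_ + \sum_(t <- T) _]addrC addrK.
rewrite big_seq; apply: rpred_sum => t Ht; apply: rpredZ.
set zs := map _ _; have Hzs : (2 < size zs)%N by rewrite size_map T3.
have Hall : all (mem U) zs by exact: all_sel.
(* A word of degree at least three either repeats one letter, and vanishes, or contains the letter
   lying in [C i] inside at least two brackets. *)
have one (b : bool) : all (pred1 b) t.2 -> nestb br zs = 0.
  move=> /allP H; apply: (nestb_line Lbr (s := if b then y else x)).
    exact: leq_trans Hzs.
  by move=> z /seq.mapP[b' /H /eqP -> ->]; exists 1; rewrite scale1r.
have mem (b : bool) : ~~ all (pred1 (~~ b)) t.2 -> (if b then y else x) \in zs.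
  move/allPn=> [b' Hb' /= Hn]; apply/seq.mapP; exists b' => //.
  by case: b b' Hn Hb' => -[].
have fin z : z \in C i -> z \in zs -> nestb br zs \in C i.+2.
  move=> Hz Hin; have := nestb_lcs Lbr Hall Hz Hin.
  apply: (subvP (lcs_anti Lbr Ubr _)).
  by case: (size zs) Hzs => [|[|[|k]]] // _; rewrite !addnS /= !ltnS leq_addr.
case: Hi => Hi.
  have [/one->|/(mem false) Hm] := boolP (all (pred1 true) t.2); first exact: mem0v.
  exact: (fin x).
have [/one->|/(mem true) Hm] := boolP (all (pred1 false) t.2); first exact: mem0v.
exact: (fin y).
Qed.

(** The weaker form of [bch_lcs2]: modulo one step of the series the product is a sum. *)
Lemma bch_lcs1 i x y : x \in U -> y \in U -> (x \in C i \/ y \in C i) ->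
  bch x y - (x + y) \in C i.+1.
Proof.
move=> Hx Hy Hi; have := bch_lcs2 Hx Hy Hi.
move=> /(subvP (lcsS_sub Lbr Ubr _)) H.
have : 2%:R^-1 *: br x y \in C i.+1.
  by apply: rpredZ; case: Hi => Hi; [apply: br_lcsSr | apply: br_lcsS].
move=> /(rpredD H); rewrite opprD addrA addrNK //.
Qed.

Lemma bch_lcs i x y : x \in C i -> y \in C i -> bch x y \in C i.
Proof.
move=> Hx Hy; rewrite -[bch x y](subrK (x + y)); apply: rpredD; last exact: rpredD.
apply: (subvP (lcsS_sub Lbr Ubr _)).
by apply: bch_lcs1; [exact: (lcs_subU Lbr Ubr Hx) | exact: (lcs_subU Lbr Ubr Hy) | left].
Qed.

(** The product minus the sum consists of brackets, so it contracts the filtration by one step.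
    Solving equations and cancelling factors both rest on this. *)
Lemma bch_cong i x x' y y' : x \in U -> x' \in U -> y \in U -> y' \in U ->
  x - x' \in C i -> y - y' \in C i ->
  (bch x y - (x + y)) - (bch x' y' - (x' + y')) \in C i.+1.
Proof.
move=> Hx Hx' Hy Hy' Dx Dy.
have E u v : bch u v - (u + v) = 2%:R^-1 *: br u v +
   \sum_(t <- T) t.1 *: nestb br (map (sel u v) t.2).
  by rewrite /bch_poly -(addrA _ _ (\sum_(t <- T) _)) [_ + _ + (_ + \sum_(t <- T) _)]addrC addrK.
rewrite !E opprD addrACA -scalerBr -sumrB; apply: rpredD.
  apply: rpredZ; have -> : br x y - br x' y' = br (x - x') y + br x' (y - y').
    by rewrite (brBl Lbr) (brBr Lbr) addrA subrK.
  by apply: rpredD; [apply: br_lcsSr | apply: br_lcsS].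
rewrite big_seq; apply: rpred_sum => t /T3 Ht; rewrite -scalerBr; apply: rpredZ.
have := @nestb_cong _ _ br Lbr U Ubr i (map (sel x y) t.2) (map (sel x' y') t.2).
rewrite !size_map => /(_ erefl (all_sel _ Hx Hy) (all_sel _ Hx' Hy')) H.
rewrite -addn1; have <- : (1 < size t.2)%N = 1%N :> nat by case: (size t.2) Ht => [|[]].
apply: H => k Hk; rewrite !(nth_map true) //.
by case: (nth _ _ _).
Qed.

Lemma bch_near_inverse i s a b : s \in U -> a \in C i -> b \in C i ->
  bch (- s + a) (s + b) - (a + b) \in C i.+1.
Proof.
move=> Hs Ha Hb; have HaU := lcs_subU Lbr Ubr Ha; have HbU := lcs_subU Lbr Ubr Hb.
have -> : bch (- s + a) (s + b) - (a + b) =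
    (bch (- s + a) (s + b) - (- s + a + (s + b))) - (bch (- s) s - (- s + s)).
  by rewrite bchN addNr subr0 subr0 addrACA addNr add0r.
apply: bch_cong => //; first by apply: rpredD; rewrite ?rpredN.
- by rewrite rpredN.
- exact: rpredD.
- by rewrite opprK addrAC addNr add0r.
- by rewrite addrC addKr.
Qed.

(** Modulo [C i.+2] the two factors are -(h + k) and h + k, each corrected by half the bracket of
    [h] and [k]. The sums cancel and the halves add up, which links group commutators to
    brackets. *)
Lemma bch_comm i h k : h \in U -> k \in C i ->
  bch (bch (- h) (- k)) (bch h k) - br h k \in C i.+2.
Proof.
move=> Hh Hk; have HkU := lcs_subU Lbr Ubr Hk.
pose a := bch (- h) (- k) + (h + k); pose b := bch h k - (h + k).
have Hb2 : b - 2%:R^-1 *: br h k \in C i.+2.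
  by have := bch_lcs2 Hh HkU (or_intror Hk); rewrite opprD addrA.
have Ha2 : a - 2%:R^-1 *: br h k \in C i.+2.
  have -> : a - 2%:R^-1 *: br h k =
      bch (- h) (- k) - (- h + - k + 2%:R^-1 *: br (- h) (- k)).
    by rewrite (brNl Lbr) (brNr Lbr) opprK opprD (opprD (- h)) !opprK addrA.
  by apply: bch_lcs2; rewrite ?rpredN //; right.
have Hbr : 2%:R^-1 *: br h k \in C i.+1 by apply: rpredZ; apply: br_lcsS.
have Ha : a \in C i.+1.
  by rewrite -[a](subrK (2%:R^-1 *: br h k)) rpredD // (subvP (lcsS_sub Lbr Ubr _)).
have Hb : b \in C i.+1.
  by rewrite -[b](subrK (2%:R^-1 *: br h k)) rpredD // (subvP (lcsS_sub Lbr Ubr _)).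
have := bch_near_inverse (rpredD Hh HkU) Ha Hb.
have -> : - (h + k) + a = bch (- h) (- k) by rewrite addrC addrK.
have -> : h + k + b = bch h k by rewrite addrC subrK.
move=> H; have := rpredD H (rpredD Ha2 Hb2).
rewrite [X in _ + X]addrACA -opprD -scalerDl [2%:R^-1 + _](_ : _ = 1); last exact/eqP.
by rewrite scale1r addrA subrK.
Qed.

(* [h] times what equals [h + c]: a fixed point of a map that contracts the
   lower central filtration, so no associativity is needed. *)
Fixpoint bch_solve k (h c : V) : V :=
  if k is k'.+1 then
    let c' := bch_solve k' h c in c - (bch h c' - (h + c'))
  else 0.

Lemma bch_solve_lcs k h c i : h \in U -> c \in C i -> bch_solve k h c \in C i.
Proof.
move=> Hh Hc; elim: k => [|k IH] /=; first exact: mem0v.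
rewrite rpredB //; apply: (subvP (lcsS_sub Lbr Ubr _)).
by apply: bch_lcs1 => //; [exact: (lcs_subU Lbr Ubr IH) | right].
Qed.

(** Consecutive approximations agree modulo ever deeper terms of the series, hence are stationary
    after [N] steps. *)
Lemma bch_solveP N h c : C N = 0%VS -> h \in U -> c \in U ->
  bch h (bch_solve N h c) = h + c.
Proof.
move=> HN Hh Hc; have HU k : bch_solve k h c \in U by apply: (@bch_solve_lcs k h c 0).
have Hk k : bch_solve k.+1 h c - bch_solve k h c \in C k.
  elim: k => [|k IH]; first by rewrite rpredB.
  rewrite [bch_solve k.+2 h c]/= [bch_solve k.+1 h c in X in _ - X]/=.
  have gen (a b : V) : c - a - (c - b) = - (a - b).
    by rewrite (opprB c b) (opprB a b) addrC addrA subrK.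
  by rewrite gen rpredN; apply: bch_cong => //; [exact: (HU k.+1) | rewrite subrr mem0v].
have := Hk N; rewrite HN memv0 subr_eq0 /= => /eqP H.
set w := bch_solve N h c in H *; rewrite -[LHS](subrK (h + w)).
have -> : bch h w - (h + w) = c - w.
  by apply/eqP; rewrite eq_sym subr_eq addrC -subr_eq H.
by rewrite addrC -addrA [w + _]addrC subrK.
Qed.

End BchLcs.

Lemma free_span_subset (F : fieldType) (V : vectType F) (S : V -> Prop) :
  exists hs : seq V, [/\ (forall h, h \in hs -> S h), free hs
    & forall v, S v -> v \in <<hs>>%VS].
Proof.
apply: contrapT => Hno.
have step hs : (forall h, h \in hs -> S h) -> free hs -> exists2 v, S v & v \notin <<hs>>%VS.
  move=> Hs Hf; apply: contrapT => H; apply: Hno; exists hs; split=> // v Sv.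
  by apply: contrapT => /negP Hv; apply: H; exists v.
have {}step n : exists hs : seq V, [/\ (forall h, h \in hs -> S h), free hs & size hs = n].
  elim: n => [|n [hs [Hs Hf <-]]]; first by exists [::]; split=> //; apply: nil_free.
  have [v Sv Hv] := step hs Hs Hf; exists (v :: hs); split=> //.
    by move=> h; rewrite inE => /orP[/eqP->|/Hs].
  by rewrite free_cons Hv.
have [hs [_ Hf Hsz]] := step (\dim {:V}).+1.
by have := dimvS (subvf <<hs>>); rewrite (eqP Hf) Hsz ltnn.
Qed.

(** Turns any linear condition, even one quantifying over the whole algebra, into a subspace, so
    that inductions over generators become inclusions of subspaces. *)
Lemma vspace_of_prop (F : fieldType) (V : vectType F) (P : V -> Prop) : P 0 ->
  (forall a u v, P u -> P v -> P (a *: u + v)) ->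
  exists W : {vspace V}, forall v, v \in W <-> P v.
Proof.
move=> P0 Plin; have [hs [Hs _ Hsp]] := free_span_subset P.
exists <<hs>>%VS => v; split; last exact: Hsp.
move=> Hv; rewrite (@coord_span _ _ _ (in_tuple hs) v Hv).
apply: (big_ind P) => // [x y Hx Hy|i _]; first by rewrite -[x]scale1r; apply: Plin.
rewrite -[_ *: _]addr0; apply: Plin => //; apply: Hs; exact: mem_nth.
Qed.

(** * Lattices and common denominators *)

Lemma common_denom (I : finType) (f : I -> rat) :
  exists2 B : nat, (0 < B)%N & forall i, B%:R * f i \in Num.int.
Proof.
exists (\prod_i `|denq (f i)|)%N; first by apply: prodn_gt0 => i; rewrite absz_gt0 denq_neq0.
move=> i; rewrite (bigD1 i) //= natrM.
have -> : (`|denq (f i)|%N)%:R = (denq (f i))%:~R :> rat.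
  by rewrite -[denq (f i) in RHS]gez0_abs ?denq_ge0.
rewrite mulrAC; apply: rpredM; last exact: natr_int.
by rewrite mulrC -numqE intr_int.
Qed.

(* [latt m K v] : [v] lies in the lattice (m / K) Z^n. *)
Definition latt n (m K : nat) (v : 'rV[rat]_n) :=
  forall i, K%:R / m%:R * v 0 i \in Num.int.

Section Latt.
Variable n : nat.
Implicit Types (v x y : 'rV[rat]_n) (m K : nat).

Lemma latt0 m K : latt m K (0 : 'rV[rat]_n).
Proof. by move=> i; rewrite mxE mulr0 rpred0. Qed.

Lemma lattD m K x y : latt m K x -> latt m K y -> latt m K (x + y).
Proof. by move=> Hx Hy i; rewrite mxE mulrDr rpredD. Qed.

Lemma lattN m K x : latt m K x -> latt m K (- x).
Proof. by move=> Hx i; rewrite mxE mulrN rpredN. Qed.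

Lemma lattB m K x y : latt m K x -> latt m K y -> latt m K (x - y).
Proof. by move=> Hx Hy; apply: lattD => //; apply: lattN. Qed.

Lemma lattMr m K L x : latt m K x -> latt m (K * L) x.
Proof.
move=> Hx i; have -> : (K * L)%:R / m%:R * x 0 i = L%:R * (K%:R / m%:R * x 0 i).
  by rewrite natrM; ring.
by rewrite rpredM // natr_int.
Qed.

Lemma lattMl m K L x : latt m K x -> latt m (L * K) x.
Proof. by rewrite mulnC; apply: lattMr. Qed.

Lemma latt_weak m K x : (0 < m)%N -> latt m K x -> latt 1 K x.
Proof.
move=> Hm Hx i; rewrite divr1.
have -> : K%:R * x 0 i = m%:R * (K%:R / m%:R * x 0 i).
  by rewrite mulrA mulrCA mulfV ?mulr1 // pnatr_eq0 -lt0n.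
by rewrite rpredM // natr_int.
Qed.

Lemma latt_scale m K q x : latt m K x -> latt m (K * `|denq q|) (q *: x).
Proof.
move=> Hx i; rewrite mxE natrM.
have -> : K%:R * `|denq q|%:R / m%:R * (q * x 0 i) =
  (q * `|denq q|%:R) * (K%:R / m%:R * x 0 i) by ring.
rewrite rpredM //.
have -> : (`|denq q|%N)%:R = (denq q)%:~R :> rat.
  by rewrite -[denq q in RHS]gez0_abs ?denq_ge0.
by rewrite -numqE intr_int.
Qed.

Lemma latt_int m K (z : int) x : latt m K x -> latt m K (z%:~R *: x).
Proof. by move=> Hx i; rewrite mxE mulrCA rpredM // intr_int. Qed.

Lemma latt_nat m K x : (0 < m)%N -> latt 1 K x <-> latt m K (m%:R *: x).
Proof.
move=> Hm; have E i : K%:R / m%:R * (m%:R *: x) 0 i = K%:R / 1 * x 0 i.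
  by rewrite mxE divr1 mulrA divfK // pnatr_eq0 -lt0n.
by split=> H i; have := H i; rewrite E.
Qed.

Lemma latt_exists (x : 'rV[rat]_n) : exists2 K, (0 < K)%N & latt 1 K x.
Proof.
by have [K HK H] := common_denom (fun i => x 0 i); exists K => // i; rewrite divr1.
Qed.

Lemma linear_denom (phi : 'rV[rat]_n -> rat) :
  (forall x y, phi (x + y) = phi x + phi y) ->
  (forall a x, phi (a *: x) = a * phi x) ->
  exists2 K, (0 < K)%N & forall v, latt 1 1 v -> K%:R * phi v \in Num.int.
Proof.
move=> HD HZ; have [K HK H] := common_denom (fun i : 'I_n => phi (delta_mx 0 i)).
exists K => // v Hv; rewrite [v]row_sum_delta.
have phi0 : phi 0 = 0 by rewrite -(scale0r 0) HZ mul0r.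
rewrite (big_morph phi HD phi0) mulr_sumr; apply: rpred_sum => i _.
rewrite HZ mulrCA rpredM //; have := Hv i; by rewrite divr1 mul1r.
Qed.

Section BrLatt.
Variable br : 'rV[rat]_n -> 'rV[rat]_n -> 'rV[rat]_n.
Hypothesis Lbr : is_lie br.

Lemma br_latt : exists2 B, (0 < B)%N & forall m K K' x y, latt m K x -> latt 1 K' y ->
  latt m (K * K' * B) (br x y).
Proof.
have [B HB H] := common_denom (fun p : 'I_n * 'I_n * 'I_n =>
  br (delta_mx 0 p.1.1) (delta_mx 0 p.1.2) 0 p.2).
exists B => // m K K' x y Hx Hy k.
rewrite [x]row_sum_delta [y]row_sum_delta (br_suml Lbr) summxE mulr_sumr.
apply: rpred_sum => i _; rewrite (br_sumr Lbr) summxE mulr_sumr.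
apply: rpred_sum => j _; rewrite (brZl Lbr) (brZr Lbr) !mxE !natrM.
set b := br _ _ _ _; have -> : K%:R * K'%:R * B%:R / m%:R * (x 0 i * (y 0 j * b)) =
   (K%:R / m%:R * x 0 i) * (K'%:R / 1 * y 0 j) * (B%:R * b) by rewrite divr1; ring.
apply: rpredM; last exact: (H (i, j, k)).
apply: rpredM; [exact: Hx | exact: Hy].
Qed.

Lemma nestb_latt_cong s K : (0 < K)%N -> exists2 K', (0 < K')%N &
  forall m zs zs', (0 < m)%N -> size zs = s -> size zs' = s ->
  (forall z, z \in zs -> latt 1 K z) -> (forall z, z \in zs' -> latt 1 K z) ->
  (forall k, latt m K (zs`_k - zs'`_k)) ->
  latt 1 K' (nestb br zs) /\ latt m K' (nestb br zs - nestb br zs').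
Proof.
move=> HK; have [B HB HBr] := br_latt.
elim: s => [|s [K1 HK1 IH]].
  by exists 1%N => // m [|//] [|//] *; rewrite subrr; split; apply: latt0.
case: s IH => [|s] IH.
  exists K => // m [|z []] // [|z' []] // Hm _ _ Hz _ Hd; split.
    by apply: Hz; rewrite mem_head.
  exact: (Hd 0%N).
exists (K * K1 * B)%N; first by rewrite !muln_gt0 HK HK1.
move=> m [|z zs] // [|z' zs'] // Hm [Hs] [Hs'] Hz Hz' Hd.
have HA u : u \in zs -> latt 1 K u by move=> Hu; apply: Hz; rewrite inE Hu orbT.
have HC u : u \in zs' -> latt 1 K u by move=> Hu; apply: Hz'; rewrite inE Hu orbT.
have [H1 H2] := IH m zs zs' Hm Hs Hs' HA HC (fun k => Hd k.+1).
split.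
  rewrite nestb_cons; last by rewrite -size_eq0 Hs.
  by apply: HBr => //; apply: Hz; rewrite mem_head.
rewrite (nestb_sub Lbr) ?Hs ?Hs' // -?size_eq0 ?Hs //; apply: lattD.
  by apply: HBr => //; apply: (Hd 0%N).
rewrite (br_anti Lbr); apply: lattN; rewrite [(K * K1)%N]mulnC; apply: HBr => //.
by apply: Hz'; rewrite mem_head.
Qed.

Variable T : seq (rat * seq bool).

(** The bound [K'] is found before [m]: on vectors of bounded denominator the product is uniformly
    continuous for all moduli at once. *)
Lemma bch_latt_cong K : (0 < K)%N -> exists2 K', (0 < K')%N &
  forall m x x' y y', (0 < m)%N -> latt 1 K x -> latt 1 K x' -> latt 1 K y -> latt 1 K y' ->
  latt m K (x - x') -> latt m K (y - y') ->
  latt m K' (bch_poly T br x y - bch_poly T br x' y').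
Proof.
move=> HK.
pose good (G : 'rV[rat]_n -> 'rV[rat]_n -> 'rV[rat]_n) := exists2 K', (0 < K')%N &
  forall m x x' y y', (0 < m)%N -> latt 1 K x -> latt 1 K x' -> latt 1 K y -> latt 1 K y' ->
  latt m K (x - x') -> latt m K (y - y') -> latt m K' (G x y - G x' y').
have goodD G G' : good G -> good G' -> good (fun x y => G x y + G' x y).
  move=> [K1 HK1 H1] [K2 HK2 H2]; exists (K1 * K2)%N; first by rewrite muln_gt0 HK1.
  move=> m x x' y y' Hm *; rewrite opprD addrACA; apply: lattD.
    by apply: lattMr; apply: H1.
  by apply: lattMl; apply: H2.
have goodZ a G : good G -> good (fun x y => a *: G x y).
  move=> [K1 HK1 H1]; exists (K1 * `|denq a|)%N.
    by rewrite muln_gt0 HK1 absz_gt0 denq_neq0.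
  by move=> m x x' y y' Hm *; rewrite -scalerBr; apply: latt_scale; apply: H1.
have good_nest w : good (fun x y => nestb br (map (sel x y) w)).
  have [K1 HK1 H1] := nestb_latt_cong (size w) HK; exists K1 => // m x x' y y' Hm Hx Hx' Hy Hy' Dx Dy.
  case: (H1 m (map (sel x y) w) (map (sel x' y') w)) => //; rewrite ?size_map //.
  - by move=> z /seq.mapP[[] _ ->].
  - by move=> z /seq.mapP[[] _ ->].
  - move=> k; have [Hk|Hk] := ltnP k (size w); last first.
      by rewrite !nth_default ?size_map // subrr; apply: latt0.
    by rewrite !(nth_map true) //; case: nth.
have good_sum T' : good (fun x y => \sum_(t <- T') t.1 *: nestb br (map (sel x y) t.2)).
  elim: T' => [|t T' IH].
    by exists 1%N => // *; rewrite !big_nil subrr; apply: latt0.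
  have [K' HK' H] := goodD _ _ (goodZ t.1 _ (good_nest t.2)) IH; exists K' => // *.
  by rewrite !big_cons; apply: H.
apply: (goodD (fun x y => x + y + 2%:R^-1 *: br x y) _ _ (good_sum T)).
apply: (goodD (fun x y => x + y)); last exact/goodZ/(good_nest [:: false; true]).
by apply: (goodD (fun x _ => x) (fun _ y => y)); exists K.
Qed.

Hypothesis T3 : forall t, t \in T -> (3 <= size t.2)%N.

Lemma bch_latt K : (0 < K)%N -> exists2 K', (0 < K')%N &
  forall m x y, (0 < m)%N -> latt m K x -> latt m K y -> latt m K' (bch_poly T br x y).
Proof.
move=> HK; have [K' HK' H] := bch_latt_cong HK; exists K' => // m x y Hm Hx Hy.
have := H m x 0 y 0 Hm; rewrite !subr0 (bch0l Lbr T3) subr0; apply=> //;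
  try exact: latt0; exact: latt_weak Hm _.
Qed.

Lemma bch_solve_latt k K : (0 < K)%N -> exists2 K', (0 < K')%N &
  forall m h c, (0 < m)%N -> latt 1 K h -> latt m K c -> latt m K' (bch_solve br T k h c).
Proof.
move=> HK; elim: k => [|k [K1 HK1 IH]]; first by exists 1%N => // *; apply: latt0.
have HKK : (0 < K * K1)%N by rewrite muln_gt0 HK.
have [K2 HK2 H2] := bch_latt_cong HKK.
exists (K * K1 * K2)%N; first by rewrite muln_gt0 HKK.
move=> m h c Hm Hh Hc /=; set c' := bch_solve _ _ _ _ _.
have Hc' : latt m K1 c' by apply: IH.
have -> : bch_poly T br h c' - (h + c') = bch_poly T br h c' - bch_poly T br h 0 - c'.
  by rewrite (bch0r Lbr T3) opprD addrA.
have HKw x : latt m K x -> latt m (K * K1) x by apply: lattMr.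
have HK1w x : latt m K1 x -> latt m (K * K1) x by apply: lattMl.
apply: lattB; first by apply: lattMr; apply: HKw.
apply: lattB; last by apply: lattMr; apply: HK1w.
apply: lattMl; apply: H2 => //.
- by apply: lattMr.
- by apply: lattMr.
- exact: latt_weak (HK1w _ Hc').
- exact: latt0.
- by rewrite subrr; apply: latt0.
- by rewrite subr0; apply: HK1w.
Qed.

End BrLatt.
End Latt.

(** * Groups closed under the Campbell-Hausdorff product *)

Section Hull.
Variables (n : nat) (br : 'rV[rat]_n -> 'rV[rat]_n -> 'rV[rat]_n).
Variable T : seq (rat * seq bool).
Hypothesis Lbr : is_lie br.
Hypothesis T3 : forall t, t \in T -> (3 <= size t.2)%N.
Variables (H : 'rV[rat]_n -> Prop) (U : {vspace 'rV[rat]_n}) (N : nat).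
Hypothesis Ubr : forall x y, x \in U -> y \in U -> br x y \in U.
Hypothesis UN : lcs br U N = 0%VS.
Hypothesis HU : forall h, H h -> h \in U.
Hypothesis Ugen : forall W : {vspace 'rV[rat]_n}, (forall h, H h -> h \in W) ->
  (forall x y, x \in W -> y \in W -> br x y \in W) -> (U <= W)%VS.
Hypothesis H0 : H 0.
Hypothesis HM : forall x y, H x -> H y -> H (bch_poly T br x y).
Hypothesis HN : forall x, H x -> H (- x).
Notation C := (lcs br U).
Notation bch := (bch_poly T br).

Lemma hull_nat h k : H h -> H (k%:R *: h).
Proof.
move=> Hh; elim: k => [|k IH]; first by rewrite scale0r.
have := HM IH Hh; have := bch_line Lbr T3 k%:R 1 h.
by rewrite scale1r => ->; rewrite -natr1.
Qed.

Lemma hull_int h (z : int) : H h -> H (z%:~R *: h).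
Proof.
move=> Hh; case: z => k; first exact: hull_nat.
by rewrite NegzE mulrNz scaleNr; apply/HN/hull_nat.
Qed.

(** In other words, [C j] is spanned modulo [C j.+1] by its elements in [H]. For two elements of [H]
    the bracket is a commutator up to a deeper term, by [bch_comm]; linearity then extends this to
    one argument after the other. *)
Lemma lcs_hull j (W : {vspace 'rV[rat]_n}) :
  (forall h, H h -> h \in C j -> h \in W) -> (C j.+1 <= W)%VS -> (C j <= W)%VS.
Proof.
elim: j W => [|j IH] W HW HC.
  have /subv_trans : (U <= W :&: U)%VS; last by apply; apply: capvSl.
  apply: Ugen => [h Hh|x y]; first by rewrite memv_cap HW ?HU.
  rewrite !memv_cap => /andP[_ Hx] /andP[_ Hy]; rewrite Ubr // andbT.
  by apply: (subvP HC); apply: br_lcsS.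
have step1 h k : H h -> H k -> k \in C j -> br h k \in W.
  move=> Hh Hk Hkj; have Hc := bch_comm Lbr T3 Ubr (HU Hh) Hkj.
  set c := bch _ _ in Hc; have Hcj : c \in C j.+1.
    rewrite -[c](subrK (br h k)) rpredD //; last by apply: br_lcsS => //; apply: HU.
    by apply: (subvP (lcsS_sub Lbr Ubr _)).
  have HcW : c \in W by apply: HW => //; apply: HM; apply: HM => //; apply: HN.
  rewrite -[br h k](subKr c) rpredB //.
  exact: (subvP HC).
have step2 h y : H h -> y \in C j -> br h y \in W.
  move=> Hh; have [W' HW'] : exists W' : {vspace _}, forall v, v \in W' <-> br h v \in W.
    apply: vspace_of_prop; first by rewrite (br0r Lbr) mem0v.
    by move=> a u v Hu Hv; rewrite (brDr Lbr) (brZr Lbr) rpredD // rpredZ.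
  move=> Hy; apply/HW'; apply: (subvP (IH W' _ _)) Hy.
    by move=> k Hk Hkj; apply/HW'; apply: step1.
  by apply/subvP => k Hk; apply/HW'; apply: (subvP HC); apply: br_lcsS => //; apply: HU.
(* The elements satisfying the claim form a subalgebra, because the bracket of a bracket with [C j]
   already falls in [C j.+2]. *)
have step3 x : x \in U -> forall y, y \in C j -> br x y \in W.
  have [W' HW'] : exists W' : {vspace _}, forall v, v \in W' <->
      (v \in U /\ forall y, y \in C j -> br v y \in W).
    apply: vspace_of_prop; first by split; rewrite ?mem0v // => y _; rewrite (br0l Lbr) mem0v.
    move=> a u v [Hu Hu'] [Hv Hv']; split; first by rewrite rpredD // rpredZ.
    by move=> y Hy; rewrite (brDl Lbr) (brZl Lbr) rpredD ?Hv' // rpredZ // Hu'.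
  suff /subvP HUW : (U <= W')%VS by move=> /HUW /HW'[].
  apply: Ugen => [h Hh|u v /HW'[Hu _] /HW'[Hv _]].
    by apply/HW'; split=> [|y]; [apply: HU | apply: step2].
  apply/HW'; split=> [|y Hy]; first exact: Ubr.
  apply: (subvP HC); apply: (subvP (lcs_anti Lbr Ubr _)) (br_lcs Lbr (mem_commv Lbr Hu Hv : _ \in C 1) Hy).
  by rewrite add1n.
by apply: commv_le => x y Hx Hy; apply: step3.
Qed.

(** Induction from the deep end of the series: a suitable multiple of an integral vector of [C i] is
    a product of powers of basis vectors taken from [H], times a remainder in [C i.+1] which the
    induction hypothesis puts in [H]. *)
Lemma hull_lattice : exists2 n1, (0 < n1)%N &
  forall v, v \in U -> latt 1 1 v -> H (n1%:R *: v).
Proof.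
suff H1 j : exists2 n1, (0 < n1)%N & forall v, v \in C (N - j) -> latt 1 1 v -> H (n1%:R *: v).
  by have := H1 N; rewrite subnn.
elim: j => [|j [n1 Hn1 IH]].
  by rewrite subn0 UN; exists 1%N => // v; rewrite memv0 => /eqP-> _; rewrite scaler0.
have [Hj|Hj] := leqP N j; first by exists n1 => // v; rewrite (_ : N - j.+1 = N - j)%N; [apply: IH | lia].
move: IH; have -> : (N - j = (N - j.+1).+1)%N by lia.
set i := (N - j.+1)%N => IH.
have [hs [Hhs hs_free Hsp]] := free_span_subset (fun h => H h /\ h \in C i).
pose A := <<hs>>%VS; pose B := C i.+1.
have HAB : (C i <= A + B)%VS.
  apply: lcs_hull; last exact: addvSr.
  by move=> h Hh Hi; apply: (subvP (addvSl _ _)); apply: Hsp.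
pose rho (l : 'I_(size hs)) v := coord (in_tuple hs) l (addv_pi1 A B v).
have [K0 HK0 HK0r] : exists2 K, (0 < K)%N &
    forall l v, latt 1 1 v -> K%:R * rho l v \in Num.int.
  have Hl l : exists2 K, (0 < K)%N & forall v, latt 1 1 v -> K%:R * rho l v \in Num.int.
    apply: linear_denom => [x y|a x]; first by rewrite /rho !linearD.
    by rewrite /rho !linearZ.
  pose K l := sval (cid2 (Hl l)).
  have HK l : (0 < K l)%N by rewrite /K; case: cid2.
  exists (\prod_l K l)%N; first by apply: prodn_gt0.
  move=> l v Hv; rewrite (bigD1 l) //= natrM mulrAC rpredM ?natr_int //.
  by rewrite /K; case: cid2 => k _ /=; apply.
have [Kh HKh Hlh] : exists2 K, (0 < K)%N & forall l : 'I_(size hs), latt 1 K hs`_l.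
  pose K (l : 'I_(size hs)) := sval (cid2 (latt_exists hs`_l)).
  exists (\prod_l K l)%N; first by apply: prodn_gt0 => l; rewrite /K; case: cid2.
  by move=> l; rewrite (bigD1 l) //=; apply: lattMr; rewrite /K; case: cid2.
have [K2 HK2 Hprod] : exists2 K2, (0 < K2)%N & forall m (xs : seq 'rV[rat]_n), (0 < m)%N ->
    size xs = size hs -> (forall x, x \in xs -> latt m Kh x) -> latt m K2 (foldr bch 0 xs).
  elim: (size hs) => [|s [K1 HK1 IHs]].
    by exists 1%N => // m [] // *; apply: latt0.
  have HKK : (0 < Kh * K1)%N by rewrite muln_gt0 HKh.
  have [K2 HK2 HB] := bch_latt Lbr T3 HKK; exists K2 => // m [//|x xs] Hm [Hs] Hx /=.
  apply: HB => //; first by apply/lattMr/Hx/mem_head.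
  by apply/lattMl/IHs => // y Hy; apply: Hx; rewrite inE Hy orbT.
have [K4 HK4 Hsolve] := bch_solve_latt Lbr T3 N HK2.
have HK4n : (0 < K4 * n1)%N by rewrite muln_gt0 HK4.
(* [K0] makes the coordinates [rho] integral, [n1] comes from the induction hypothesis, and [K4]
   bounds the denominators created by solving for the remainder. *)
exists (K0 * (K4 * n1))%N; first by rewrite muln_gt0 HK0.
move=> v Hv Iv; set m := (K4 * n1)%N.
pose b l := (K0 * m)%:R * rho l v.
pose xs := [seq b l *: hs`_l | l <- enum 'I_(size hs)].
have Hb l : exists z : int, b l = m%:R * z%:~R.
  have /intrP[z Hz] := HK0r l v Iv; exists z; rewrite -Hz /b natrM; ring.
have Hxs x : x \in xs -> [/\ H x, x \in C i & latt m Kh x].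
  case/seq.mapP=> l _ ->; have [Hl Hl'] : H hs`_l /\ hs`_l \in C i by apply/Hhs/mem_nth.
  have [z ->] := Hb l; split; last 1 first.
  - by rewrite -scalerA; apply/(latt_nat _ _ HK4n)/latt_int/Hlh.
  - by rewrite -[m%:R]/(m%:Z%:~R) -intrM; apply: hull_int.
  - exact: rpredZ.
pose h := foldr bch 0 xs.
have Hh : H h.
  rewrite /h; elim: (xs) Hxs => //= x xs' IHx Hx; apply: HM.
    by case: (Hx x (mem_head _ _)).
  by apply: IHx => y Hy; apply: Hx; rewrite inE Hy orbT.
have Hhsum : h \in C i /\ \sum_(x <- xs) x - h \in C i.+1.
  rewrite /h; elim: (xs) Hxs => [_|x xs' IHx Hx]; first by rewrite big_nil subrr !mem0v.
  have [_ Hxi _] := Hx x (mem_head _ _).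
  have [|Hi1 Hi2] := IHx; first by move=> y Hy; apply: Hx; rewrite inE Hy orbT.
  rewrite big_cons /=; split; first exact: (bch_lcs Lbr T3 Ubr).
  set h' := foldr _ _ _ in Hi1 Hi2 *.
  have -> : x + \sum_(y <- xs') y - bch x h' =
     (\sum_(y <- xs') y - h') - (bch x h' - (x + h')).
    by rewrite opprB [x + h']addrC !addrA subrK [x + _]addrC.
  apply: rpredB => //; apply: (bch_lcs1 Lbr T3 Ubr); last by left.
    exact: (lcs_subU Lbr Ubr Hxi).
  exact: (lcs_subU Lbr Ubr Hi1).
(* What is missing additively after [h]; [bch_solve] turns it into the missing factor [c4]. *)
pose c3 := (K0 * m)%:R *: v - h.
have HUh : h \in U by apply: HU.
have Hsumx : \sum_(x <- xs) x = (K0 * m)%:R *: addv_pi1 A B v.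
  rewrite big_map big_enum /=; under eq_bigr => l _ do rewrite /b -scalerA.
  rewrite -scaler_sumr; congr (_ *: _).
  by rewrite -(@coord_span _ _ _ (in_tuple hs) (addv_pi1 A B v)) // memv_pi1.
have Hc3 : c3 \in C i.+1.
  have -> : c3 = (K0 * m)%:R *: addv_pi2 A B v + (\sum_(x <- xs) x - h).
    rewrite Hsumx addrA -scalerDr [_ + addv_pi1 _ _ _]addrC addv_pi1_pi2 //.
    exact: (subvP HAB).
  by apply: rpredD; [apply/rpredZ/memv_pi2 | case: Hhsum].
have Lh : latt m K2 h by apply: Hprod => //; [rewrite size_map size_enum_ord | by move=> x /Hxs[]].
have Lc3 : latt m K2 c3.
  apply: lattB => //; rewrite natrM mulrC -scalerA -[K2]mul1n; apply/lattMr/latt_nat => //.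
  by rewrite -[K0%:R]/(K0%:Z%:~R); apply: latt_int.
pose c4 := bch_solve br T N h c3.
have Hc4 : c4 \in C i.+1 by apply: bch_solve_lcs.
have Lc4 : latt m K4 c4 by apply: Hsolve => //; apply: latt_weak Lh.
have -> : (K0 * m)%:R *: v = bch h c4.
  rewrite (bch_solveP Lbr T3 Ubr UN HUh (lcs_subU Lbr Ubr Hc3)).
  by rewrite /c3 addrC subrK.
apply: HM => //.
have n1F : n1%:R != 0 :> rat by rewrite pnatr_eq0 -lt0n.
have -> : c4 = n1%:R *: (n1%:R^-1 *: c4) by rewrite scalerA mulfV // scale1r.
apply: IH; first exact: rpredZ.
move=> k; have := Lc4 k; rewrite mxE divr1 mul1r /m natrM invfM mulrA mulfV ?mul1r //.
by rewrite pnatr_eq0 -lt0n.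
Qed.

(* The bracket [br x h] is pushed down the lower central series. *)
Lemma hull_center x : x \in U -> (forall h, H h -> bch x h = bch h x) ->
  forall y, y \in U -> br x y = 0.
Proof.
move=> Hx Hcomm.
suff K i : forall y, y \in U -> br x y \in C i.
  by move=> y Hy; apply/eqP; rewrite -memv0 -UN; apply: K.
elim: i => [|i IH] y Hy; first exact: Ubr.
have step h : H h -> br x h \in C i.+1.
  move=> Hh; have HhU := HU Hh.
  (* Such a word ends in a bracket of two letters among [x] and [h], which lies in [C i] by
     induction, and at least one more bracket surrounds it. *)
  have W zs : (2 < size zs)%N -> (forall z, z \in zs -> z = x \/ z = h) ->
      nestb br zs \in C i.+1.
    elim: zs => // z zs IHz Hs Hz; rewrite nestb_cons; last by case: zs Hs {IHz Hz}.
    have HzU : z \in U by case: (Hz z (mem_head _ _)) => ->.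
    apply: br_lcsS => //; have Hz' u : u \in zs -> u = x \/ u = h.
      by move=> Hu; apply: Hz; rewrite inE Hu orbT.
    case: (ltnP 2 (size zs)) => Hzs.
      by apply: (subvP (lcsS_sub Lbr Ubr _)); apply: IHz.
    case: zs Hs Hzs Hz' {IHz Hz} => [|u [|w [|]]] //= _ _ Hz'.
    case: (Hz' u) => [|->|->]; rewrite ?mem_head //;
    case: (Hz' w) => [|->|->]; rewrite ?inE ?eqxx ?orbT //;
      rewrite ?(brxx Lbr) ?mem0v ?IH //.
    by rewrite (br_anti Lbr) rpredN IH.
  have E u v : u = x \/ u = h -> v = x \/ v = h ->
     bch u v - (u + v + 2%:R^-1 *: br u v) \in C i.+1.
    move=> Hu Hv; rewrite /bch_poly addrC addKr big_seq; apply: rpred_sum => t /T3 Ht.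
    apply/rpredZ/W; first by rewrite size_map.
    by move=> z /seq.mapP[[] _ ->].
  have := rpredB (E h x (or_intror erefl) (or_introl erefl))
                 (E x h (or_introl erefl) (or_intror erefl)).
  have gen (B P Q : 'rV[rat]_n) : B - P - (B - Q) = Q - P.
    by rewrite (opprB B Q) addrC addrA subrK.
  rewrite -(Hcomm h Hh) gen [h + x]addrC opprD addrACA subrr add0r.
  rewrite (br_anti Lbr x h) scalerN opprK -scalerDl (_ : _ + _ = 1) ?scale1r //.
have [W' HW'] : exists W' : {vspace _}, forall v, v \in W' <-> v \in U /\ br x v \in C i.+1.
  apply: vspace_of_prop; first by rewrite (br0r Lbr) !mem0v.
  by move=> a u v [??] [??]; rewrite (brDr Lbr) (brZr Lbr) !rpredD // rpredZ.
suff /subvP HUW : (U <= W')%VS by have /HW'[] := HUW y Hy.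
apply: Ugen => [h Hh|u v /HW'[Hu Hxu] /HW'[Hv Hxv]].
  by apply/HW'; split; [apply: HU | apply: step].
apply/HW'; split; first exact: Ubr.
have -> : br x (br u v) = br (br x u) v + br u (br x v).
  by rewrite (br_jacobi2 Lbr x u v) subrK.
by rewrite rpredD //; apply: (subvP (lcsS_sub Lbr Ubr _)); [apply: br_lcsSr | apply: br_lcsS].
Qed.

End Hull.

(** * Bounded sets closed under the Campbell-Hausdorff product *)

Section BchLattice.
Variables (n : nat) (br : 'rV[rat]_n -> 'rV[rat]_n -> 'rV[rat]_n).
Variable T : seq (rat * seq bool).
Hypothesis Lbr : is_lie br.
Hypothesis T3 : forall t, t \in T -> (3 <= size t.2)%N.
Variable N : nat.
Hypothesis UN : lcs br fullv N = 0%VS.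
Variable K0 : nat.
Hypothesis K0_gt0 : (0 < K0)%N.

(** The depth is recorded because each depth has bounded denominators and all depths from [N] on
    vanish, so finitely many bounds are enough. *)
Inductive zbr : nat -> 'rV[rat]_n -> Prop :=
| ZbrBase v : latt 1 K0 v -> zbr 0 v
| ZbrBr j x y : zbr 0 x -> zbr j y -> zbr j.+1 (br x y)
| ZbrSub j x y : zbr j x -> zbr j y -> zbr j (x - y)
| Zbr0 j : zbr j 0.

Lemma zbr_br i j x y : zbr i x -> zbr j y -> zbr (i + j).+1 (br x y).
Proof.
move=> Hx; elim: Hx j y => {i x}.
- by move=> v Hv j y Hy; rewrite add0n; apply: ZbrBr => //; apply: ZbrBase.
- move=> i x1 x2 H1 _ H2 IH2 j y Hy; rewrite (br_jacobi2 Lbr); apply: ZbrSub.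
    by rewrite addSn; apply: ZbrBr => //; apply: IH2.
  by rewrite addSn -addnS; apply: IH2; apply: ZbrBr.
- by move=> i x1 x2 _ IH1 _ IH2 j y Hy; rewrite (brBl Lbr); apply: ZbrSub; [apply: IH1|apply: IH2].
- by move=> i j y _; rewrite (br0l Lbr); apply: Zbr0.
Qed.

Lemma zbr_lcs j x : zbr j x -> x \in lcs br fullv j.
Proof.
elim=> {j x} [v _|j x y _ _ _ Hy|j x y _ Hx _ Hy|j]; rewrite ?memvf ?mem0v //.
  by apply: br_lcsS => //; apply: memvf.
exact: rpredB.
Qed.

Lemma zbr_latt j : exists2 K, (0 < K)%N & forall x, zbr j x -> latt 1 K x.
Proof.
have [B HB HBr] := br_latt Lbr.
have H0 x : zbr 0 x -> latt 1 K0 x.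
  move E: 0%N => i Hx; elim: Hx E => {i x} [v|||] //; last by move=> *; apply: latt0.
  by move=> ? x y _ Hx _ Hy /[dup] /Hx ? /Hy ?; apply: lattB.
elim: j => [|j [K HK IH]]; first by exists K0.
exists (K0 * K * B)%N; first by rewrite !muln_gt0 K0_gt0 HK.
move=> x; move E: j.+1 => i Hx; elim: Hx E => {i x} //.
- by move=> i x y Hx _ Hy _ [E]; apply: HBr; [exact: H0 | apply: IH; rewrite E].
- by move=> i x y _ Hx _ Hy /[dup] /Hx ? /Hy ?; apply: lattB.
- by move=> *; apply: latt0.
Qed.

Variable D : nat.
Hypothesis D_gt0 : (0 < D)%N.
Hypothesis D2 : D%:R * 2%:R^-1 \in (Num.int : {pred rat}).
Hypothesis DT : forall t, t \in T -> D%:R * t.1 \in (Num.int : {pred rat}).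

Let D_neq0 : D%:R != 0 :> rat. Proof. by rewrite pnatr_eq0 -lt0n. Qed.

(* The weight [2 j + 1] makes brackets gain a factor [D], which absorbs all
   denominators of the Campbell-Hausdorff polynomial. *)
Inductive bchlat : 'rV[rat]_n -> Prop :=
| BchlatGen j w : zbr j w -> bchlat (D%:R ^- (2 * j).+1 *: w)
| BchlatSub x y : bchlat x -> bchlat y -> bchlat (x - y)
| Bchlat0 : bchlat 0.

Lemma bchlatN x : bchlat x -> bchlat (- x).
Proof. by move=> Hx; rewrite -sub0r; apply: BchlatSub => //; apply: Bchlat0. Qed.

Lemma bchlatD x y : bchlat x -> bchlat y -> bchlat (x + y).
Proof. by move=> Hx Hy; rewrite -[y]opprK; apply/BchlatSub/bchlatN. Qed.

Lemma bchlat_int (q : rat) x : q \in Num.int -> bchlat x -> bchlat (q *: x).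
Proof.
case/intrP=> z -> Hx; have K k : bchlat (k%:R *: x).
  elim: k => [|k IH]; first by rewrite scale0r; apply: Bchlat0.
  by rewrite -natr1 scalerDl scale1r; apply: bchlatD.
by case: z => k; rewrite ?NegzE ?mulrNz ?scaleNr; [|apply: bchlatN]; apply: K.
Qed.

Lemma bchlat_base v : latt 1 K0 v -> bchlat v.
Proof.
move=> Hv; have -> : v = D%:R ^- (2 * 0).+1 *: (D%:R *: v).
  by rewrite scalerA expr1 mulVf // scale1r.
apply/BchlatGen/ZbrBase; rewrite -[D%:R]/(D%:Z%:~R); exact: latt_int.
Qed.

Lemma bchlat_br x y : bchlat x -> bchlat y -> bchlat (D%:R^-1 *: br x y).
Proof.
elim=> {x} [i w Hw|x x' _ IH _ IH'|] Hy; last by rewrite (br0l Lbr) scaler0; apply: Bchlat0.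
  elim: Hy => {y} [j w' Hw'|y y' _ IH _ IH'|]; last by rewrite (br0r Lbr) scaler0; apply: Bchlat0.
    rewrite (brZl Lbr) (brZr Lbr) !scalerA -!exprVn -exprD -exprS.
    have -> : ((2 * i).+1 + (2 * j).+1).+1 = (2 * (i + j).+1).+1 by lia.
    by rewrite exprVn; apply/BchlatGen/zbr_br.
  by rewrite (brBr Lbr) scalerBr; apply: BchlatSub.
by rewrite (brBl Lbr) scalerBr; apply: BchlatSub; [apply: IH | apply: IH'].
Qed.

Lemma bchlat_nestb zs : (1 < size zs)%N -> (forall z, z \in zs -> bchlat z) ->
  bchlat (D%:R^-1 *: nestb br zs).
Proof.
elim: zs => // z [//|z' zs] IH _ Hz; rewrite nestb_cons //; apply: bchlat_br.
  by apply: Hz; rewrite mem_head.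
have Hz' u : u \in z' :: zs -> bchlat u by move=> Hu; apply: Hz; rewrite inE Hu orbT.
case: zs => [|z'' zs] in IH Hz' {Hz} *; first by apply: Hz'; rewrite mem_head.
rewrite -[nestb _ _]scale1r -(mulfV D_neq0) -scalerA; apply: bchlat_int; first exact: natr_int.
exact: IH.
Qed.

Lemma bchlatM x y : bchlat x -> bchlat y -> bchlat (bch_poly T br x y).
Proof.
have E (q : rat) v : q *: v = (D%:R * q) *: (D%:R^-1 *: v) :> 'rV[rat]_n.
  by rewrite scalerA mulrAC mulfV // mul1r.
move=> Hx Hy; apply: bchlatD; last first.
  rewrite big_seq; apply: big_ind => [|u v|t Ht]; [exact: Bchlat0 | exact: bchlatD |].
  rewrite E; apply: bchlat_int; first exact: DT.
  apply: bchlat_nestb; first by rewrite size_map; apply: leq_trans (T3 Ht).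
  by move=> z /seq.mapP[[] _ ->].
apply: bchlatD; first exact: bchlatD.
by rewrite E; apply: bchlat_int => //; apply: bchlat_br.
Qed.

Lemma bchlat_latt : exists2 M, (0 < M)%N & forall x, bchlat x -> latt 1 M x.
Proof.
pose K j := sval (cid2 (zbr_latt j)).
have HK j : (0 < K j)%N by rewrite /K; case: cid2.
have HKl j x : zbr j x -> latt 1 (K j) x by rewrite /K; case: cid2 => k _ /= H; apply: H.
exists (\prod_(j < N) (K j * D ^ (2 * j).+1))%N.
  by apply: prodn_gt0 => j; rewrite muln_gt0 HK expn_gt0 D_gt0.
move=> x; elim=> {x} [j w Hw|x y _ Hx _ Hy|]; [|exact: lattB|exact: latt0].
case: (ltnP j N) => Hj; last first.
  suff -> : w = 0 by rewrite scaler0; apply: latt0.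
  have := zbr_lcs Hw => /(subvP (lcs_anti Lbr (fun _ _ _ _ => memvf _) Hj)).
  by rewrite UN memv0 => /eqP.
rewrite (bigD1 (Ordinal Hj)) //=; apply: lattMr.
move=> i; have := HKl _ _ Hw i; rewrite mxE natrM natrX !divr1 => Hi.
by rewrite -mulrA mulVKf // expf_neq0.
Qed.

End BchLattice.

(** Every multiplication divides by new integers; this set shows that the denominators in a finitely
    generated group stay bounded nevertheless. *)
Lemma bch_bounded n (br : 'rV[rat]_n -> 'rV[rat]_n -> 'rV[rat]_n) T N K0 :
  is_lie br -> (forall t, t \in T -> (3 <= size t.2)%N) -> lcs br fullv N = 0%VS ->
  (0 < K0)%N ->
  exists M (L : 'rV[rat]_n -> Prop), [/\ (0 < M)%N, forall x, L x -> latt 1 M x,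
    forall x, latt 1 K0 x -> L x, forall x, L x -> L (- x) &
    forall x y, L x -> L y -> L (bch_poly T br x y)].
Proof.
move=> Lbr T3 UN HK0.
(* A common denominator of all the coefficients of the polynomial; the factor 2 is for the term of
   degree two. *)
pose D := (2 * \prod_(t <- T) `|denq t.1|)%N.
have HD : (0 < D)%N.
  rewrite muln_gt0 /= big_seq; apply: prodn_cond_gt0 => t _.
  by rewrite absz_gt0 denq_neq0.
have D2 : D%:R * 2%:R^-1 \in (Num.int : {pred rat}).
  by rewrite natrM mulrAC mulfV // mul1r natr_int.
have DT t : t \in T -> D%:R * t.1 \in (Num.int : {pred rat}).
  move=> Ht; rewrite /D (big_rem t Ht) /= mulnCA natrM mulrAC rpredM ?natr_int //.
  have -> : (`|denq t.1|%N)%:R = (denq t.1)%:~R :> rat.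
    by rewrite -[denq t.1 in RHS]gez0_abs ?denq_ge0.
  by rewrite mulrC -numqE intr_int.
have [M HM HL] := bchlat_latt Lbr UN HK0 HD.
exists M, (bchlat br K0 D); split=> //.
- exact: bchlat_base.
- exact: bchlatN.
- by move=> x y; apply: bchlatM.
Qed.

(** * The Malcev Lie algebra *)

Lemma ch_product_poly d : exists T : seq (rat * seq bool),
  (forall t, t \in T -> (3 <= size t.2)%N) /\
  forall c : 'I_d -> 'I_d -> 'rV[rat]_d, is_lie_algebra c ->
    forall x y, ch_product c x y = bch_poly T (sc_bracket c) x y.
Proof.
(* In dimension at most one the truncation has no term of degree two, but there the bracket vanishes
   and the product is addition. *)
case: d => [|[|d]].
- by exists [::]; split=> // c _ x y; rewrite [LHS]thinmx0 [RHS]thinmx0.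
- exists [::]; split=> // c Hc x y.
  have Lbr := sc_bracket_lie Hc.
  rewrite /bch_poly big_nil addr0.
  have e1 (u : 'rV[rat]_1) : u = u 0 0 *: delta_mx 0 0.
    by apply/rowP => i; rewrite !mxE ord1 !eqxx mulr1.
  rewrite (e1 x) (e1 y) (brZl Lbr) (brZr Lbr) (brxx Lbr) !scaler0 addr0 -!e1.
  rewrite /ch_product /bch_trunc big_ord1 sum_ffun1.
  pose tm bl := bcoef 0 bl *: nestb (sc_bracket c) (map (sel x y) (bword bl)).
  have bl1 (p : 'I_2 * 'I_2) : blocks [ffun _ : 'I_1 => p] = [:: (p.1 : nat, p.2 : nat)].
    by rewrite /blocks enum_ordSl (size0nil (size_enum_ord 0)) /= ffunE.
  transitivity (\sum_(p : 'I_2 * 'I_2 | (p.1 + p.2 == 1)%N) tm [:: (p.1 : nat, p.2 : nat)]).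
    apply: eq_big => [p|p _]; last by rewrite bcoefE dynkin_wordE nested_bracketE bl1.
    rewrite /dynkin_admissible /dynkin_degree big_ord1 !ffunE.
    have -> : [forall i, (0 < ([ffun=> p] (i : 'I_1)).1 + ([ffun=> p] i).2)%N] = (0 < p.1 + p.2)%N.
      by apply/forallP/idP => [/(_ ord0)|H i]; rewrite ffunE.
    by case: (_ + _)%N => [|[|]].
  rewrite (sum_small1 _ (fun i j => tm [:: (i, j)])) /tm /bword /bcoef !big_cons !big_nil /sel /=.
  have -> (a b : rat) : a = 1 -> b = 1 -> a *: x + b *: y = x + y.
    by move=> -> ->; rewrite !scale1r.
  - by [].
  - by apply/eqP.
  - by apply/eqP.
- have [T [T3 HT]] := bch_truncE d; exists T; split=> // c [Hc _] x y.
  exact: HT.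
Qed.

Lemma bch_poly_morph (V W : lmodType rat) T brV brW (phi : V -> W) :
  (forall x y, phi (x + y) = phi x + phi y) -> (forall a x, phi (a *: x) = a *: phi x) ->
  (forall x y, phi (brV x y) = brW (phi x) (phi y)) ->
  forall x y, phi (bch_poly T brV x y) = bch_poly T brW (phi x) (phi y).
Proof.
move=> HD HZ Hb x y; have phi0 : phi 0 = 0 by rewrite -(scale0r 0) HZ scale0r.
rewrite /bch_poly !HD HZ Hb (big_morph phi HD phi0); congr (_ + _).
apply: eq_bigr => t _; rewrite HZ; congr (_ *: _).
elim: t.2 => //= b [|b' w] IH; first by case: b.
rewrite Hb; congr (brW _ _); [by case: b | exact: IH].
Qed.

Lemma bch_central (V : lmodType rat) (br : V -> V -> V) T x y :
  is_lie br -> (forall t, t \in T -> (3 <= size t.2)%N) -> (forall y, br x y = 0) ->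
  bch_poly T br x y = x + y /\ bch_poly T br y x = x + y.
Proof.
move=> Lbr T3 Hx; have Hx' u : br u x = 0 by rewrite (br_anti Lbr) Hx oppr0.
have K zs : (1 < size zs)%N -> (forall z, z \in zs -> z = x \/ z = y) -> nestb br zs = 0.
  elim: zs => // z [//|z' zs] IH _ Hz; rewrite nestb_cons //.
  have Hz' u : u \in z' :: zs -> u = x \/ u = y by move=> Hu; apply: Hz; rewrite inE Hu orbT.
  case: zs => [|z'' zs] in IH Hz Hz' *; last by rewrite IH ?(br0r Lbr).
  case: (Hz z (mem_head _ _)) => ->; case: (Hz' z' (mem_head _ _)) => -> /=;
    by rewrite ?Hx ?Hx' ?(brxx Lbr).
split; rewrite /bch_poly ?Hx ?Hx' scaler0 addr0 big_seq big1 ?addr0 //; try by rewrite addrC.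
- move=> t /T3 Ht; rewrite K ?scaler0 ?size_map //; first exact: leq_trans Ht.
  by move=> z /seq.mapP[[] _ ->]; [right|left].
- move=> t /T3 Ht; rewrite K ?scaler0 ?size_map //; first exact: leq_trans Ht.
  by move=> z /seq.mapP[[] _ ->]; [left|right].
Qed.

(** Cancellation without inverses: by [bch_cong], solutions that agree modulo one term of the series
    agree modulo the next. *)
Lemma bch_injr (V : vectType rat) (br : V -> V -> V) T N x y y' :
  is_lie br -> (forall t, t \in T -> (3 <= size t.2)%N) -> lcs br fullv N = 0%VS ->
  bch_poly T br x y = bch_poly T br x y' -> y = y'.
Proof.
move=> Lbr T3 UN E; apply/eqP; rewrite -subr_eq0 -memv0 -UN.
elim: N {UN} => [|i IH]; first exact: memvf.
have := bch_cong Lbr T3 (fun _ _ _ _ => memvf _) (memvf x) (memvf x) (memvf y) (memvf y') _ IH.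
rewrite subrr mem0v => /(_ isT); rewrite E opprB addrC addrA subrK.
by rewrite opprD addrACA subrr add0r -opprB rpredN.
Qed.

Lemma lie_hull (F : fieldType) (V : vectType F) (br : V -> V -> V) (H : V -> Prop) :
  exists U : {vspace V}, [/\ forall x y, x \in U -> y \in U -> br x y \in U,
    forall h, H h -> h \in U & forall W : {vspace V}, (forall h, H h -> h \in W) ->
      (forall x y, x \in W -> y \in W -> br x y \in W) -> (U <= W)%VS].
Proof.
have [U HU] : exists U : {vspace V}, forall v, v \in U <-> forall W : {vspace V},
   (forall h, H h -> h \in W) -> (forall x y, x \in W -> y \in W -> br x y \in W) -> v \in W.
  apply: vspace_of_prop => [W _ _|a u v Hu Hv W H1 H2]; first exact: mem0v.
  by rewrite rpredD ?rpredZ ?Hu ?Hv.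
exists U; split.
- move=> x y /HU Hx /HU Hy; apply/HU => W H1 H2.
  by apply: (H2 _ _ (Hx _ H1 H2) (Hy _ H1 H2)).
- by move=> h Hh; apply/HU => W H1 _; apply: H1.
- by move=> W H1 H2; apply/subvP => v /HU; apply.
Qed.

Section Malcev.
Variables (G : groupType) (d : nat) (c : 'I_d -> 'I_d -> 'rV[rat]_d)
    (iota : G -> 'rV[rat]_d).
Hypothesis Hm : is_malcev_lie_algebra c iota.
Notation br := (sc_bracket c).

Lemma malcev_lie : is_lie br.
Proof. by case: Hm => H *; apply: sc_bracket_lie. Qed.
Let Lbr := malcev_lie.

Lemma malcev_bch : exists T : seq (rat * seq bool),
  (forall t, t \in T -> (3 <= size t.2)%N) /\
  forall g h, iota (g * h)%g = bch_poly T br (iota g) (iota h).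
Proof.
have [T [T3 HT]] := ch_product_poly d; exists T; split=> // g h.
by case: Hm => Hc _ _ -> _; rewrite HT.
Qed.

Lemma malcev_lcs : exists N, forall U, lcs br U N = 0%VS.
Proof. by case: Hm => _ [N HN] *; exists N => U; apply: lcs_nilp. Qed.

Lemma malcev_gen (W : {vspace 'rV[rat]_d}) : (forall g, iota g \in W) ->
  (forall x y, x \in W -> y \in W -> br x y \in W) -> W = fullv.
Proof. by case: Hm => _ _ _ _ Hg HW; apply: Hg => x [g ->]. Qed.

Lemma malcev_inj : injective iota. Proof. by case: Hm. Qed.

Variable T : seq (rat * seq bool).
Hypothesis T3 : forall t, t \in T -> (3 <= size t.2)%N.
Hypothesis iotaM : forall g h, iota (g * h)%g = bch_poly T br (iota g) (iota h).

Lemma iota1 : iota 1%g = 0.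
Proof.
have := iotaM 1%g 1%g; have := bch_line Lbr T3 1 1 (iota 1%g).
rewrite scale1r mul1g => -> /eqP; rewrite scalerDl scale1r.
by rewrite -subr_eq subrr eq_sym => /eqP.
Qed.

Lemma iotaV g : iota g^-1%g = - iota g.
Proof.
have [N HN] := malcev_lcs; apply: (bch_injr (x := iota g) Lbr T3 (HN fullv)).
rewrite -iotaM mulgV iota1; have := bch_line Lbr T3 1 (-1) (iota g).
by rewrite scale1r scaleN1r subrr scale0r.
Qed.

Lemma iotaX g n : iota (g ^+ n)%g = n%:R *: iota g.
Proof.
elim: n => [|n IH]; first by rewrite expg0 iota1 scale0r.
rewrite expgSr iotaM IH; have := bch_line Lbr T3 n%:R 1 (iota g).
by rewrite scale1r => ->; rewrite natr1.
Qed.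

Let in_gamma (x : 'rV[rat]_d) := exists g, x = iota g.

Lemma malcev_lattice : exists2 n1, (0 < n1)%N &
  forall v, latt 1 1 v -> exists g, n1%:R *: v = iota g.
Proof.
have [N HN] := malcev_lcs.
have [|||||n1 Hn1 H] := @hull_lattice d br T Lbr T3 in_gamma fullv N (fun _ _ _ _ => memvf _) (HN _).
- by move=> *; apply: memvf.
- by move=> W HW Wbr; rewrite (malcev_gen _ Wbr) // => g; apply: HW; exists g.
- by exists 1%g; rewrite iota1.
- by move=> _ _ [g ->] [h ->]; exists (g * h)%g; rewrite iotaM.
- by move=> _ [g ->]; exists g^-1%g; rewrite iotaV.
by exists n1 => // v; apply: H; apply: memvf.
Qed.

Lemma malcev_bounded : finitely_generated G ->
  exists2 M, (0 < M)%N & forall g, latt 1 M (iota g).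
Proof.
case=> s Hs; have [N HN] := malcev_lcs.
have [K HK HKs] : exists2 K, (0 < K)%N & forall g, g \in s -> latt 1 K (iota g).
  elim: s {Hs} => [|g s [K HK IH]]; first by exists 1%N.
  have [K' HK' H'] := latt_exists (iota g); exists (K * K')%N; first by rewrite muln_gt0 HK.
  by move=> h; rewrite inE => /orP[/eqP->|/IH]; [apply: lattMl | apply: lattMr].
have [M [L [HM HL HL0 HLN HLM]]] := bch_bounded Lbr T3 (HN fullv) HK.
exists M => // g; apply: HL; move: g; apply: Hs.
- by rewrite iota1; apply/HL0/latt0.
- by move=> g Hg; apply/HL0/HKs.
- by move=> g h Hg Hh; rewrite iotaM iotaV; apply: HLM => //; apply: HLN.
Qed.

Lemma malcev_central x : (forall g, bch_poly T br x (iota g) = bch_poly T br (iota g) x) ->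
  forall y, br x y = 0.
Proof.
move=> Hx y; have [N HN] := malcev_lcs.
apply: (@hull_center d br T Lbr T3 in_gamma fullv N (fun _ _ _ _ => memvf _) (HN _)).
- by move=> h _; apply: memvf.
- by move=> W HW Wbr; rewrite (malcev_gen _ Wbr) // => g; apply: HW; exists g.
- exact: memvf.
- by move=> _ [g ->].
- exact: memvf.
Qed.

Lemma central_commute g h : (forall y, br (iota g) y = 0) -> (g * h = h * g)%g.
Proof.
move=> Hc; apply: malcev_inj; rewrite !iotaM.
by have [-> ->] := bch_central (iota h) Lbr T3 Hc.
Qed.

Section VirtualEndo.
Variable R : G -> G -> Prop.
Hypothesis HR : virtual_endo R.

Lemma virtual_endo_lattice : exists2 n1, (0 < n1)%N &
  forall v, latt 1 1 v -> exists g h, R g h /\ n1%:R *: v = iota g.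
Proof.
have [n1 Hn1 H] := malcev_lattice; have [m Hm0 HRm] := vendo_index HR.
exists (m * n1)%N; first by rewrite muln_gt0 Hm0.
move=> v /H[g Hg]; have [h Hh] := HRm g; exists (g ^+ m)%g, h; split=> //.
by rewrite iotaX -Hg scalerA natrM.
Qed.

Let pbr (x y : 'rV[rat]_(d + d)) :=
  row_mx (br (lsubmx x) (lsubmx y)) (br (rsubmx x) (rsubmx y)).

Let pbr_lie : is_lie pbr.
Proof.
split=> [x y z|x y z|a x z|x|x y z]; rewrite /pbr.
- by rewrite !linearD /= !(brDl Lbr) add_row_mx.
- by rewrite !linearD /= !(brDr Lbr) add_row_mx.
- by rewrite !linearZ /= !(brZl Lbr) scale_row_mx.
- by rewrite !(brxx Lbr) row_mx0.
- by rewrite !row_mxKl !row_mxKr !add_row_mx !(br_jacobi Lbr) row_mx0.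
Qed.

(* The Lie algebra generated by the graph of the virtual endomorphism is
   again a graph, because the graph contains a lattice of it. *)
Lemma virtual_endo_extends : exists F : 'M[rat]_d,
  (forall x y, br x y *m F = br (x *m F) (y *m F)) /\
  (forall g h, R g h -> iota h = iota g *m F).
Proof.
pose H v := exists g h, R g h /\ v = row_mx (iota g) (iota h).
have [U [Ubr HU Ugen]] := lie_hull pbr H.
have bchE x y : bch_poly T pbr x y =
    row_mx (bch_poly T br (lsubmx x) (lsubmx y)) (bch_poly T br (rsubmx x) (rsubmx y)).
  rewrite -[LHS]hsubmxK; congr row_mx.
    by apply: bch_poly_morph => [u v|a u|u v]; rewrite ?linearD ?linearZ // row_mxKl.
  by apply: bch_poly_morph => [u v|a u|u v]; rewrite ?linearD ?linearZ // row_mxKr.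
have [N HN] : exists N, forall W, lcs pbr W N = 0%VS.
  case: Hm => _ [N HN] *; exists N => W; apply: (lcs_nilp pbr_lie) => x ys Hys.
  have E zs : foldr pbr x zs = row_mx (foldr br (lsubmx x) (map lsubmx zs))
      (foldr br (rsubmx x) (map rsubmx zs)).
    by elim: zs => [|z zs IH] /=; rewrite ?hsubmxK // IH /pbr row_mxKl row_mxKr.
  by rewrite E !HN ?size_map // row_mx0.
have [|||n1 Hn1 HL] := @hull_lattice (d + d) pbr T pbr_lie T3 H U N Ubr (HN _) HU Ugen.
- by exists 1%g, 1%g; split; [exact: vendo1 | rewrite iota1 row_mx0].
- move=> _ _ [g [h [Hgh ->]]] [g' [h' [Hgh' ->]]]; exists (g * g')%g, (h * h')%g.
  by split; [apply: vendoM | rewrite bchE !row_mxKl !row_mxKr !iotaM].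
- move=> _ [g [h [Hgh ->]]]; exists g^-1%g, h^-1%g.
  by split; [apply: vendoV | rewrite opp_row_mx !iotaV].
have HUH v : v \in U -> exists2 n, (0 < n)%N & H (n%:R *: v).
  move=> Hv; have [K HK HKv] := latt_exists v; exists (n1 * K)%N; first by rewrite muln_gt0 Hn1.
  rewrite natrM -scalerA; apply: HL; first exact: rpredZ.
  move=> i; have := HKv i; by rewrite !divr1 mxE mul1r.
(* A multiple of such a vector belongs to the graph itself, above the identity, where [R] takes only
   the value 1. *)
have Uinj y : row_mx 0 y \in U -> y = 0.
  case/HUH=> n Hn [g [h [Hgh]]]; rewrite scale_row_mx scaler0 => /eq_row_mx[E1 E2].
  have Eg : g = 1%g by apply: malcev_inj; rewrite iota1.
  rewrite Eg in Hgh; rewrite (vendo_fun HR Hgh (vendo1 HR)) iota1 in E2.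
  by move/eqP: E2; rewrite scaler_eq0 pnatr_eq0 eqn0Ngt Hn => /eqP.
(* The projection of [U] is a subalgebra containing a power of every group element, hence a multiple
   of every [iota g]. *)
have Usurj x : exists y, row_mx x y \in U.
  have [W HW] : exists W : {vspace 'rV[rat]_d}, forall x, x \in W <-> exists y, row_mx x y \in U.
    apply: vspace_of_prop; first by exists 0; rewrite row_mx0 mem0v.
    move=> a u v [y Hy] [z Hz]; exists (a *: y + z).
    by rewrite -add_row_mx -scale_row_mx rpredD // rpredZ.
  apply/HW; rewrite (malcev_gen (W := W)) ?memvf //.
    move=> g; have [m Hm0 HRm] := vendo_index HR; have [h Hh] := HRm g.
    have : iota (g ^+ m)%g \in W by apply/HW; exists (iota h); apply: HU; exists (g ^+ m)%g, h.
    by rewrite iotaX rpredZeq pnatr_eq0 eqn0Ngt Hm0.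
  move=> u v /HW[y Hy] /HW[z Hz]; apply/HW; exists (br y z).
  by have := Ubr _ _ Hy Hz; rewrite /pbr !row_mxKl !row_mxKr.
pose F := \matrix_(i < d) sval (cid (Usurj (delta_mx 0 i))).
have HF x : row_mx x (x *m F) \in U.
  have [W HW] : exists W : {vspace 'rV[rat]_d}, forall x, x \in W <-> row_mx x (x *m F) \in U.
    apply: vspace_of_prop; first by rewrite mul0mx row_mx0 mem0v.
    move=> a u v Hu Hv; rewrite mulmxDl -scalemxAl.
    by rewrite -add_row_mx -scale_row_mx rpredD // rpredZ.
  apply/HW; rewrite [x]row_sum_delta; apply: memv_suml => i _; apply: memvZ; apply/HW.
  by rewrite -rowE rowK; case: cid.
have Funiq x y : row_mx x y \in U -> y = x *m F.
  move=> Hy; apply/eqP; rewrite -subr_eq0; apply/eqP/Uinj.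
  by have := rpredB Hy (HF x); rewrite opp_row_mx add_row_mx subrr.
exists F; split=> [x y|g h Hgh].
  apply/esym/Funiq; have := Ubr _ _ (HF x) (HF y).
  by rewrite /pbr !row_mxKl !row_mxKr.
by apply: Funiq; apply: HU; exists g, h.
Qed.

(** A bounded central orbit, suitably scaled, stays in a lattice inside the domain of [R]. Group
    elements with such orbits form a normal set that [R] maps to itself, so the trivial core kills
    them. Injectivity of [F] follows from this in [bounded_inj]. *)
Lemma virtual_endo_automorphism : exists F : 'M[rat]_d,
  (forall x y, br x y *m F = br (x *m F) (y *m F)) /\
  (forall v K, (0 < K)%N ->
     (forall i, (forall y, br (iter i (mulmxr F) v) y = 0) /\ latt 1 K (iter i (mulmxr F) v)) ->
     v = 0).
Proof.
have [F [Fbr HF]] := virtual_endo_extends; exists F; split=> // v K HK Hv.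
have [n1 Hn1 Hlat] := virtual_endo_lattice.
pose P w := forall i, (forall y, br (iter i (mulmxr F) w) y = 0) /\
  latt n1 1 (iter i (mulmxr F) w).
have N1 g : P (iota g) -> g = 1%g.
  move: g; apply: (vendo_core HR (N := fun g => P (iota g))).
    move=> g h Hg; have Hc : forall y, br (iota g) y = 0 by case: (Hg 0%N).
    by rewrite -mulgA (central_commute h Hc) mulKg.
  move=> g Hg; have [g' [h [Hgh Eg]]] := Hlat (n1%:R^-1 *: iota g) (fun i => ltac:(
    have [_ /(_ i)] := Hg 0%N; rewrite /= divr1 !mul1r mxE; exact)).
  have Eg' : g = g'.
    by apply: malcev_inj; rewrite -Eg scalerA mulfV ?scale1r // pnatr_eq0 -lt0n.
  exists h; first by rewrite Eg'.
  by move=> i; rewrite (HF _ _ Hgh) -Eg'; have := Hg i.+1; rewrite iterSr.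
have iterZ a w i : iter i (mulmxr F) (a *: w) = a *: iter i (mulmxr F) w.
  by elim: i => //= i ->; rewrite -scalemxAl.
pose w := n1%:R *: (K%:R *: v).
have Pw : P w.
  move=> i; have [Hc Hl] := Hv i; split=> [y|].
    by rewrite !iterZ !(brZl Lbr) Hc !scaler0.
  by rewrite !iterZ; apply/latt_nat => // k; have := Hl k; rewrite !divr1 mul1r mxE.
have [g [_ [_ Eg]]] : exists g h, R g h /\ w = iota g.
  apply: Hlat => k; have [_ /(_ k)] := Hv 0%N; by rewrite /= !divr1 mul1r mxE.
have : w = 0 by rewrite Eg (N1 g) ?iota1 // -Eg.
by move/eqP; rewrite !scaler_eq0 !pnatr_eq0 !eqn0Ngt Hn1 HK /= => /eqP.
Qed.

End VirtualEndo.
End Malcev.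

(** * Linear algebra over subfields *)

Section Descent.
Variables (K : fieldType) (f : {rmorphism rat -> K}).

Definition rat_free r (b : 'I_r -> K) :=
  forall q : 'I_r -> rat, \sum_k f (q k) * b k = 0 -> forall k, q k = 0.

Definition in_rat_span r (b : 'I_r -> K) (a : K) :=
  exists q : 'I_r -> rat, a = \sum_k f (q k) * b k.

Lemma rat_basis_exists (s : seq K) :
  exists r (b : 'I_r -> K), rat_free b /\ forall a, a \in s -> in_rat_span b a.
Proof.
elim: s => [|a s [r [b [Hfree Hspan]]]].
  by exists 0%N, (fun _ => 0); split=> // q _ [].
have [Ha|Ha] := pselect (in_rat_span b a).
  by exists r, b; split=> // a'; rewrite inE => /orP[/eqP->|/Hspan].
pose b' (k : 'I_r.+1) := oapp b a (unlift ord0 k).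
have sumE (q : 'I_r.+1 -> rat) : \sum_k f (q k) * b' k =
    f (q ord0) * a + \sum_k f (q (lift ord0 k)) * b k.
  rewrite big_ord_recl /b' unlift_none /=; congr (_ + _).
  by apply: eq_bigr => k _; rewrite liftK.
exists r.+1, b'; split.
  move=> q; rewrite sumE => E.
  have q0 : q ord0 = 0.
    apply: contrapT => /eqP q0; apply: Ha; exists (fun k => - (q (lift ord0 k) / q ord0)).
    have fq0 : f (q ord0) != 0 by rewrite fmorph_eq0.
    apply: (mulfI fq0); rewrite mulr_sumr.
    move/eqP: E; rewrite addr_eq0 => /eqP->; rewrite -sumrN; apply: eq_bigr => k _.
    by rewrite rmorphN fmorph_div mulNr mulrN mulrA mulrCA mulfV // mulr1.
  rewrite q0 rmorph0 mul0r add0r in E => k.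
  have [j ->|->] := unliftP ord0 k; last by [].
  exact: (Hfree (fun k => q (lift ord0 k))).
move=> a'; rewrite inE => /orP[/eqP->|/Hspan[q ->]].
  exists (fun k => oapp (fun _ => 0) 1 (unlift ord0 k)).
  rewrite sumE unlift_none /= rmorph1 mul1r big1 ?addr0 // => k _.
  by rewrite liftK /= rmorph0 mul0r.
exists (fun k => oapp q 0 (unlift ord0 k)).
rewrite sumE unlift_none /= rmorph0 mul0r add0r; apply: eq_bigr => k _.
by rewrite liftK.
Qed.

(** The means of descent: a linear condition with rational coefficients on [X] is equivalent to the
    same condition on every [Y k]. *)
Lemma matrix_rat_basis m n (X : 'M[K]_(m, n)) : exists r (b : 'I_r -> K) (Y : 'I_r -> 'M[rat]_(m, n)),
  rat_free b /\ X = \sum_k b k *: map_mx f (Y k).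
Proof.
have [r [b [Hb Hs]]] := rat_basis_exists [seq X p.1 p.2 | p <- enum {: 'I_m * 'I_n}].
have H i j : in_rat_span b (X i j).
  by apply: Hs; apply/seq.mapP; exists (i, j); rewrite ?mem_enum.
exists r, b, (fun k => \matrix_(i, j) sval (cid (H i j)) k); split=> //.
apply/matrixP => i j; rewrite summxE [LHS](svalP (cid (H i j))).
by apply: eq_bigr => k _; rewrite !mxE mulrC.
Qed.

Lemma rat_free_mx r (b : 'I_r -> K) m n (Y : 'I_r -> 'M[rat]_(m, n)) : rat_free b ->
  \sum_k b k *: map_mx f (Y k) = 0 -> forall k, Y k = 0.
Proof.
move=> Hb E k; apply/matrixP => i j; rewrite mxE.
apply: (Hb (fun k => Y k i j)); have /matrixP/(_ i j) := E.
rewrite summxE [X in _ = X]mxE => E2; rewrite -[RHS]E2.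
by apply: eq_bigr => l _; rewrite !mxE mulrC.
Qed.

Lemma rat_free_mulmx r (b : 'I_r -> K) m n p (Y : 'I_r -> 'M[rat]_(m, n)) (M : 'M[rat]_(n, p)) :
  rat_free b -> (\sum_k b k *: map_mx f (Y k)) *m map_mx f M = 0 -> forall k, Y k *m M = 0.
Proof.
move=> Hb E; apply: (rat_free_mx Hb); rewrite -[RHS]E mulmx_suml.
by apply: eq_bigr => k _; rewrite map_mxM -scalemxAl.
Qed.

End Descent.

(** If [psi] is nonzero on the new vector and [phi] on the old ones, then phi + t psi is nonzero on
    all of them once [t] exceeds finitely many ratios. *)
Lemma functional_avoid (V : vectType rat) (W : {vspace V}) (vs : seq V) :
  (forall v, v \in vs -> v \notin W) ->
  exists phi : V -> rat, [/\ forall a u v, phi (a *: u + v) = a * phi u + phi v,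
    forall v, v \in W -> phi v = 0 & forall v, v \in vs -> phi v != 0].
Proof.
elim: vs => [|v vs IH] Hvs.
  by exists (fun _ => 0); split=> // a u v; rewrite mulr0 addr0.
have [|phi [phiL phiW phiV]] := IH; first by move=> u Hu; apply: Hvs; rewrite inE Hu orbT.
have [psi [psiL psiW psiv]] : exists psi : V -> rat, [/\ forall a u v, psi (a *: u + v) = a * psi u + psi v,
    forall v, v \in W -> psi v = 0 & psi v != 0].
  pose p := projv W.
  have pv : v - p v != 0.
    apply: contra (Hvs v (mem_head _ _)); rewrite subr_eq0 => /eqP->.
    by rewrite memv_proj.
  have [i Hi] : exists i, coord (vbasis {:V}) i (v - p v) != 0.
    apply: contrapT => H; move/eqP: pv; apply.
    rewrite (coord_vbasis (memvf (v - p v))) big1 // => i _.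
    suff -> : coord (vbasis {:V}) i (v - p v) = 0 by rewrite scale0r.
    by apply: contrapT => /eqP Hi; apply: H; exists i.
  exists (fun u => coord (vbasis {:V}) i (u - p u)); split=> //.
  - move=> a u w; rewrite linearP opprD addrACA -scalerBr linearP //.
  - by move=> u Hu; rewrite /p projv_id // subrr linear0.
pose t := 1 + \sum_(u <- v :: vs) `|phi u / psi u|.
have Ht u : u \in v :: vs -> `|phi u / psi u| < t.
  move=> Hu; rewrite /t (big_rem u Hu) /= addrA addrC; apply: ltr_wpDl; last by rewrite ltrDr.
  exact: sumr_ge0.
exists (fun u => phi u + t * psi u); split.
- by move=> a u w; rewrite phiL psiL; ring.
- by move=> u Hu; rewrite phiW // psiW // mulr0 addr0.
- move=> u Hu; have [E|E] := eqVneq (psi u) 0.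
    rewrite E mulr0 addr0; move: Hu; rewrite inE => /orP[/eqP Eu|]; last exact: phiV.
    by rewrite -Eu E eqxx in psiv.
  apply/eqP => H; have := Ht u Hu.
  have -> : phi u / psi u = - t.
    by apply: (mulIf E); rewrite divfK // mulNr; apply/eqP; rewrite -addr_eq0 H.
  rewrite normrN ger0_norm ?ltxx //.
  by rewrite /t addr_ge0 ?sumr_ge0.
Qed.

Lemma functional_avoid_family (V : vectType rat) (W : {vspace V}) (I : finType)
    (P : I -> Prop) (v : I -> V) :
  (forall i, P i -> v i \notin W) ->
  exists phi : V -> rat, [/\ forall a u w, phi (a *: u + w) = a * phi u + phi w,
    forall w, w \in W -> phi w = 0 & forall i, P i -> phi (v i) != 0].
Proof.
move=> Hv; have [|phi [H1 H2 H3]] := @functional_avoid V W [seq v i | i <- enum I & `[< P i >]].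
  by apply/allP; rewrite all_map; apply/allP => i; rewrite mem_filter => /andP[/asboolP Hi _]; apply: Hv.
exists phi; split=> // i Hi; apply: H3; apply: map_f.
by rewrite mem_filter mem_enum andbT; apply/asboolP.
Qed.

(** Projections onto generalized eigenspaces, acting on row vectors from the right.
    [spectral_stable] is the form in which it is used that they are polynomials in [A]. Iterated
    multiplication stands for powers, so that size zero is included. *)
Record spectral (K : fieldType) n (A : 'M[K]_n) (s : seq K) (prj : K -> 'M[K]_n) : Prop :=
 Spectral {
  spectral_uniq : uniq s;
  spectral_sum : \sum_(l <- s) prj l = 1%:M;
  spectral_id : forall l, l \in s -> prj l *m prj l = prj l;
  spectral_orth : forall l l', l \in s -> l' \in s -> l != l' -> prj l *m prj l' = 0;
  spectral_nil : forall l, l \in s -> prj l *m iter n (mulmxr (A - l%:M)) 1%:M = 0;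
  spectral_comm : forall l, prj l *m A = A *m prj l;
  spectral_fix : forall l (v : 'rV[K]_n) m, l \in s ->
    iter m (mulmxr (A - l%:M)) v = 0 -> v *m prj l = v;
  spectral_out : forall l (v : 'rV[K]_n) m, l \notin s ->
    iter m (mulmxr (A - l%:M)) v = 0 -> v = 0;
  spectral_stable : forall (P : 'rV[K]_n -> Prop), P 0 ->
    (forall a u v, P u -> P v -> P (a *: u + v)) -> (forall v, P v -> P (v *m A)) ->
    forall l v, P v -> P (v *m prj l);
  spectral_root : forall l, l \in s -> root (char_poly A) l }.

Lemma iter_mulmxr (K : fieldType) n p k (v : 'M[K]_(p, n.+1)) (B : 'M[K]_n.+1) :
  iter k (mulmxr B) v = v *m B ^+ k.
Proof.
elim: k => [|k IH] /=; first by rewrite expr0 mulmx1.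
by rewrite IH exprSr mulmxA.
Qed.

(** Chinese remainder theorem: the projections are the values at [A] of the Bezout idempotents for
    the pairwise coprime polynomials [p l]. *)
Lemma spectral_exists (K : fieldType) n (A : 'M[K]_n) (r : seq K) :
  char_poly A = \prod_(z <- r) ('X - z%:P) -> exists prj, spectral A (undup r) prj.
Proof.
case: n A => [|n] A Hr.
  have r0 : r = [::].
    have := size_char_poly A; rewrite Hr size_prod_XsubC => -[/eqP].
    by rewrite size_eq0 => /eqP.
  exists (fun _ => 0); rewrite r0; split=> //=.
  - by apply/matrixP => -[].
  - by move=> l; apply/matrixP => -[].
  - by move=> l v m _ _; apply: thinmx0.
  - by move=> *; rewrite mulmx0.
set s := undup r; have us : uniq s := undup_uniq r.
(* The exponent is the size of the matrix, which bounds every multiplicity in the characteristic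
   polynomial. *)
pose p l : {poly K} := ('X - l%:P) ^+ n.+1.
pose P : {poly K} := \prod_(l <- s) p l.
have cop l l' : l != l' -> coprimep (p l) (p l').
  by move=> Hl; rewrite coprimep_expl // coprimep_expr // coprimep_XsubC root_XsubC eq_sym.
have horner_p l : horner_mx A (p l) = (A - l%:M) ^+ n.+1.
  by rewrite rmorphXn rmorphB /= horner_mx_X horner_mx_C.
have P0 : horner_mx A P = 0.
  have : char_poly A %| P.
    rewrite Hr; have -> : \prod_(z <- r) ('X - z%:P) =
        \prod_(l <- s) ('X - l%:P) ^+ (count_mem l r).
      by rewrite big_undup_iterop_count.
    rewrite /P; elim: (s) => [|l s' IH]; first by rewrite !big_nil dvd1p.
    rewrite !big_cons dvdp_mul // dvdp_exp2l //.
    have := size_char_poly A; rewrite Hr size_prod_XsubC => -[<-]; exact: count_size.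
  by case/dvdpP=> q ->; rewrite rmorphM /= Cayley_Hamilton mulr0.
pose q l : {poly K} := \prod_(l' <- s | l' != l) p l'.
have Pq l : l \in s -> P = p l * q l.
  by move=> Hl; rewrite /P (bigD1_seq l).
have copq l : coprimep (p l) (q l).
  rewrite coprimep_sym /q; apply: (big_ind (fun g => coprimep g (p l))).
  - exact: coprime1p.
  - by move=> g h Hg Hh; rewrite coprimepMl Hg.
  - by move=> l' Hl'; apply: cop.
have bez l : exists u v, u * q l + v * p l = 1.
  have := copq l; rewrite coprimep_sym => /Bezout_eq1_coprimepP[[u v] /= E].
  by exists u, v.
pose u l := sval (cid (bez l)); pose v l := sval (cid (svalP (cid (bez l)))).
have uv l : u l * q l + v l * p l = 1 := svalP (cid (svalP (cid (bez l)))).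
pose e l := u l * q l.
have dvd_q l l' : l' \in s -> l' != l -> p l' %| q l.
  by move=> Hs Hl; rewrite /q (big_rem l' Hs) /= Hl dvdp_mulr.
have hornerP g : P %| g -> horner_mx A g = 0.
  by case/dvdpP=> h ->; rewrite rmorphM /= P0 mulr0.
have allP g : (forall l, l \in s -> p l %| g) -> P %| g.
  rewrite /P; elim: (s) us => [|l s' IH] /=; first by rewrite big_nil dvd1p.
  move=> /andP[Hl Hs'] Hg; rewrite big_cons Gauss_dvdp ?Hg ?mem_head ?IH //.
    by move=> l' Hl'; apply: Hg; rewrite inE Hl' orbT.
  rewrite big_seq; apply: (big_ind (fun g => coprimep (p l) g)).
  - exact: coprimep1.
  - by move=> g1 h Hg1 Hh; rewrite coprimepMr Hg1.
  - by move=> l' Hl'; apply: cop; apply: contraNneq Hl => ->.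
have e1 l : e l - 1 = - (v l * p l) by rewrite -(uv l) /e opprD addrA subrr add0r.
have prjsum : \sum_(l <- s) horner_mx A (e l) = 1%:M.
  rewrite -rmorph_sum /=; apply/eqP; rewrite -[1%:M](rmorph1 (horner_mx A)) -subr_eq0 -rmorphB.
  apply/eqP/hornerP/allP => l Hl; rewrite (bigD1_seq l) //= addrAC e1.
  apply: dvdp_add; first by rewrite dvdpNr dvdp_mull.
  apply: (big_ind (fun g => p l %| g)); rewrite ?dvdp0 //; first by move=> *; apply: dvdp_add.
  by move=> l' Hl'; rewrite dvdp_mull // dvd_q // eq_sym.
have orth l l' : l \in s -> l' \in s -> l != l' -> horner_mx A (e l) *m horner_mx A (e l') = 0.
  move=> Hl Hl' Hne; rewrite mulmxE -rmorphM /=; apply: hornerP; rewrite (Pq l) // mulrC.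
  by rewrite /e mulrACA dvdp_mull // dvdp_mul // dvd_q.
have idem l : l \in s -> horner_mx A (e l) *m horner_mx A (e l) = horner_mx A (e l).
  move=> Hl; rewrite -[RHS]mulmx1 -prjsum mulmx_sumr (bigD1_seq l) //= big_seq_cond big1 ?addr0 //.
  by move=> l' /andP[Hl' Hne]; rewrite orth // eq_sym.
have kill l l' (w : 'rV[K]_n.+1) m : l \in s -> l' != l ->
    w *m (A - l'%:M) ^+ m = 0 -> w *m horner_mx A (e l) = 0.
  move=> Hl Hne Hw.
  have : coprimep (('X - l'%:P) ^+ m) (p l).
    by rewrite coprimep_expl // coprimep_expr // coprimep_XsubC root_XsubC eq_sym.
  case/Bezout_eq1_coprimepP=> -[g h] /= E.
  have <- : w *m horner_mx A (g * ('X - l'%:P) ^+ m + h * p l) *m horner_mx A (e l) =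
      w *m horner_mx A (e l) by rewrite E rmorph1 mulmx1.
  rewrite rmorphD mulmxDr mulmxDl [g * _]mulrC [X in X + _](_ : _ = 0) ?add0r.
    rewrite -mulmxA mulmxE -rmorphM /= hornerP ?mulmx0 // (Pq l) // /e mulrACA.
    by rewrite dvdp_mull.
  rewrite /=;  have -> : horner_mx A (('X - l'%:P) ^+ m * g) = (A - l'%:M) ^+ m *m horner_mx A g.
    by rewrite rmorphM rmorphXn rmorphB /= horner_mx_X horner_mx_C.
  by rewrite mulmxA Hw !mul0mx.
exists (fun l => horner_mx A (e l)); split=> //.
- move=> l Hl; rewrite iter_mulmxr mul1mx -horner_p mulmxE -rmorphM /=.
  by apply: hornerP; rewrite (Pq l) // /e -mulrA [q l * _]mulrC dvdp_mull.
- move=> l; rewrite -{2 3}[A]horner_mx_X !mulmxE -!rmorphM mulrC //.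
- move=> l w m Hl; rewrite iter_mulmxr => Hw.
  rewrite -[RHS]mulmx1 -prjsum mulmx_sumr (bigD1_seq l) //= big_seq_cond big1 ?addr0 //.
  by move=> l' /andP[Hl' Hne]; apply: (kill l' l _ m) => //; rewrite eq_sym.
- move=> l w m Hl; rewrite iter_mulmxr => Hw.
  rewrite -[w]mulmx1 -prjsum mulmx_sumr big_seq big1 // => l' Hl'.
  by apply: (kill l' l _ m) => //; apply: contraNneq Hl => ->.
- move=> Pr Pr0 Prl PrA l w Hw; move: (e l); apply: poly_ind => [|g a IH].
    by rewrite rmorph0 mulmx0.
  rewrite rmorphD rmorphM /= horner_mx_X horner_mx_C mulmxDr addrC mul_mx_scalar.
  by apply: Prl => //; rewrite -mulmxE mulmxA; apply: PrA.
- by move=> l; rewrite mem_undup Hr => Hl; rewrite root_prod_XsubC.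
Qed.

Section SpectralCalculus.
Variables (K : fieldType) (n : nat) (A : 'M[K]_n) (s : seq K) (prj : K -> 'M[K]_n).
Hypothesis Hsp : spectral A s prj.

Lemma spectral_mul l l' : l \in s -> l' \in s ->
  prj l *m prj l' = if l == l' then prj l else 0.
Proof.
by move=> Hl Hl'; case: eqVneq => [<-|]; [apply: (spectral_id Hsp) | apply: (spectral_orth Hsp)].
Qed.

(** Acts by a scalar on each whole generalized eigenspace, so only the semisimple part of [A]
    enters. *)
Definition spectral_fun (g : K -> K) := \sum_(l <- s) g l *: prj l.

Lemma spectral_fun_prj g l : l \in s -> spectral_fun g *m prj l = g l *: prj l.
Proof.
move=> Hl; rewrite /spectral_fun mulmx_suml (bigD1_seq l) ?(spectral_uniq Hsp) //=.
rewrite -scalemxAl spectral_mul // eqxx big_seq_cond big1 ?addr0 // => l' /andP[Hl' Hne].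
by rewrite -scalemxAl spectral_mul // (negbTE Hne) scaler0.
Qed.

Lemma spectral_funM g h : spectral_fun g *m spectral_fun h = spectral_fun (fun l => g l * h l).
Proof.
rewrite {2}/spectral_fun mulmx_sumr big_seq [RHS]big_seq; apply: eq_bigr => l Hl.
by rewrite -scalemxAr spectral_fun_prj // scalerA mulrC.
Qed.

Lemma spectral_fun1 : spectral_fun (fun _ => 1) = 1%:M.
Proof. by rewrite -(spectral_sum Hsp); apply: eq_bigr => l _; rewrite scale1r. Qed.

Lemma eq_spectral_fun g h : (forall l, l \in s -> g l = h l) -> spectral_fun g = spectral_fun h.
Proof. by move=> E; apply: eq_big_seq => l Hl; rewrite E. Qed.

Lemma spectral_fun_iter g i : iter i (mulmxr (spectral_fun g)) 1%:M = spectral_fun (fun l => g l ^+ i).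
Proof.
elim: i => [|i IH] /=; first by rewrite -spectral_fun1.
by rewrite IH spectral_funM; apply: eq_spectral_fun => l _; rewrite exprSr.
Qed.

End SpectralCalculus.

(** * Gradings from automorphisms *)

Section ScBilinear.
Variables (F : fieldType) (d : nat) (c : 'I_d -> 'I_d -> 'rV[F]_d).
Notation br := (sc_bracket c).

Lemma sc_brDl x y z : br (x + y) z = br x z + br y z.
Proof.
rewrite /sc_bracket -big_split /=; apply: eq_bigr => i _.
by rewrite -big_split /=; apply: eq_bigr => j _; rewrite mxE mulrDl scalerDl.
Qed.

Lemma sc_brDr x y z : br z (x + y) = br z x + br z y.
Proof.
rewrite /sc_bracket -big_split /=; apply: eq_bigr => i _.
by rewrite -big_split /=; apply: eq_bigr => j _; rewrite mxE mulrDr scalerDl.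
Qed.

Lemma sc_brZl a x z : br (a *: x) z = a *: br x z.
Proof.
rewrite /sc_bracket scaler_sumr; apply: eq_bigr => i _.
by rewrite scaler_sumr; apply: eq_bigr => j _; rewrite mxE scalerA mulrA.
Qed.

Lemma sc_brZr a x z : br z (a *: x) = a *: br z x.
Proof.
rewrite /sc_bracket scaler_sumr; apply: eq_bigr => i _.
by rewrite scaler_sumr; apply: eq_bigr => j _; rewrite mxE scalerA mulrCA.
Qed.

Lemma sc_br0l z : br 0 z = 0.
Proof. by have := sc_brZl 0 0 z; rewrite !scale0r. Qed.

Lemma sc_br0r z : br z 0 = 0.
Proof. by have := sc_brZr 0 0 z; rewrite !scale0r. Qed.

Lemma sc_brBl x y z : br (x - y) z = br x z - br y z.
Proof. by rewrite -scaleN1r sc_brDl sc_brZl scaleN1r. Qed.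

Lemma sc_brBr x y z : br z (x - y) = br z x - br z y.
Proof. by rewrite -scaleN1r sc_brDr sc_brZr scaleN1r. Qed.

Lemma sc_br_suml I (s : seq I) (P : pred I) G z :
  br (\sum_(i <- s | P i) G i) z = \sum_(i <- s | P i) br (G i) z.
Proof. exact: (big_morph (fun x => br x z) (fun x y => sc_brDl x y z) (sc_br0l z)). Qed.

Lemma sc_br_sumr I (s : seq I) (P : pred I) G z :
  br z (\sum_(i <- s | P i) G i) = \sum_(i <- s | P i) br z (G i).
Proof. exact: (big_morph (fun x => br z x) (fun x y => sc_brDr x y z) (sc_br0r z)). Qed.

Lemma sc_br_delta i j : br (delta_mx 0 i) (delta_mx 0 j) = c i j.
Proof.
rewrite /sc_bracket (bigD1 i) //= (bigD1 j) //= !mxE !eqxx mulr1 scale1r.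
rewrite big1 ?addr0 => [|k /negbTE Hk]; last by rewrite !mxE Hk mulr0 scale0r.
rewrite big1 ?addr0 // => k /negbTE Hk; rewrite big1 // => l _.
by rewrite !mxE Hk mul0r scale0r.
Qed.

Lemma center_lin a u v : in_center c u -> in_center c v -> in_center c (a *: u + v).
Proof. by move=> Hu Hv y; rewrite sc_brDl sc_brZl Hu Hv scaler0 addr0. Qed.

Lemma center0 : in_center c 0.
Proof. by move=> y; rewrite sc_br0l. Qed.

Lemma br_mulmx (A B : 'M[F]_d) x y : br (x *m A) (y *m B) =
  \sum_i \sum_j (x 0 i * y 0 j) *: br (row i A) (row j B).
Proof.
rewrite !mulmx_sum_row sc_br_suml; apply: eq_bigr => i _.
rewrite sc_brZl sc_br_sumr scaler_sumr; apply: eq_bigr => j _.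
by rewrite sc_brZr scalerA.
Qed.

End ScBilinear.

Section BaseChange.
Variables (K : fieldType) (f : {rmorphism rat -> K}) (d : nat).
Variable c : 'I_d -> 'I_d -> 'rV[rat]_d.
Definition ext_sc : 'I_d -> 'I_d -> 'rV[K]_d := fun i j => map_mx f (c i j).
Notation br := (sc_bracket c).
Notation brK := (sc_bracket ext_sc).

Lemma ext_br x y : brK (map_mx f x) (map_mx f y) = map_mx f (br x y).
Proof.
rewrite /sc_bracket map_mx_sum; apply: eq_bigr => i _.
rewrite map_mx_sum; apply: eq_bigr => j _.
by rewrite map_mxZ !mxE rmorphM.
Qed.

Lemma ext_hom (F : 'M[rat]_d) : (forall x y, br x y *m F = br (x *m F) (y *m F)) ->
  forall x y, brK x y *m map_mx f F = brK (x *m map_mx f F) (y *m map_mx f F).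
Proof.
move=> HF x y; rewrite br_mulmx [in LHS]/sc_bracket mulmx_suml; apply: eq_bigr => i _.
rewrite mulmx_suml; apply: eq_bigr => j _; rewrite -scalemxAl; congr (_ *: _).
rewrite -!map_row ext_br -map_mxM; congr map_mx.
by rewrite -(sc_br_delta c) HF -!rowE.
Qed.

Lemma ext_center_map u : in_center c u -> in_center ext_sc (map_mx f u).
Proof.
move=> Hu y; rewrite [y]row_sum_delta sc_br_sumr big1 // => i _.
by rewrite sc_brZr -(map_delta_mx f) ext_br Hu map_mx0 scaler0.
Qed.

Lemma ext_center_coef r (b : 'I_r -> K) (u : 'I_r -> 'rV[rat]_d) : rat_free f b ->
  in_center ext_sc (\sum_k b k *: map_mx f (u k)) -> forall k, in_center c (u k).
Proof.
move=> Hb Hu k y.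
apply: (rat_free_mx (Y := fun k => br (u k) y) Hb).
rewrite -[RHS](Hu (map_mx f y)) sc_br_suml; apply: eq_bigr => l _.
by rewrite sc_brZl ext_br.
Qed.

End BaseChange.

Lemma iter_sub0 (K : fieldType) n (A : 'M[K]_n) l k :
  iter k (mulmxr (A - l%:M)) (0 : 'rV_n) = 0.
Proof. by elim: k => //= k ->; rewrite mul0mx. Qed.

(** The identity [x, y](A - l m) = [x (A - l), y A] + l [x, y (A - m)] lowers one of the two
    nilpotency orders in each term. *)
Lemma hom_iter_mul (K : fieldType) d (c : 'I_d -> 'I_d -> 'rV[K]_d) (A : 'M[K]_d) l m :
  (forall x y, sc_bracket c x y *m A = sc_bracket c (x *m A) (y *m A)) ->
  forall a b x y, iter a (mulmxr (A - l%:M)) x = 0 -> iter b (mulmxr (A - m%:M)) y = 0 ->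
  iter (a + b) (mulmxr (A - (l * m)%:M)) (sc_bracket c x y) = 0.
Proof.
move=> HA a b; move E: (a + b)%N => s; elim: s a b E => [|s IH] a b E x y.
  have [-> ->] : a = 0%N /\ b = 0%N by lia.
  by move=> /= -> _; rewrite sc_br0l.
move=> Hx Hy; rewrite iterSr.
have -> : mulmxr (A - (l * m)%:M) (sc_bracket c x y) =
   sc_bracket c (x *m (A - l%:M)) (y *m A) + l *: sc_bracket c x (y *m (A - m%:M)).
  rewrite /= !mulmxBr HA sc_brBl sc_brBr !mul_mx_scalar sc_brZl sc_brZr scalerBr scalerA.
  by rewrite addrA subrK.
have lin k B (a' : K) (u v : 'rV[K]_d) :
    iter k (mulmxr B) (u + a' *: v) = iter k (mulmxr B) u + a' *: iter k (mulmxr B) v.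
  by elim: k => //= k ->; rewrite mulmxDl -scalemxAl.
have comm k (B : 'M[K]_d) (v : 'rV[K]_d) : B *m A = A *m B ->
    iter k (mulmxr B) (v *m A) = iter k (mulmxr B) v *m A.
  by move=> HB; elim: k => //= k ->; rewrite -!mulmxA HB.
have cA t : (A - t%:M) *m A = A *m (A - t%:M).
  by rewrite mulmxBl mulmxBr scalar_mxC.
rewrite lin; case: a E Hx => [|a] E Hx.
  move: Hx => /= ->; rewrite mul0mx !sc_br0l iter_sub0 scaler0 addr0.
  by [].
case: b E Hy => [|b] E Hy.
  move: Hy => /= ->; rewrite !mul0mx !sc_br0r iter_sub0 scaler0 addr0.
  by [].
rewrite (IH a b.+1) ?(IH a.+1 b) ?scaler0 ?addr0 //; try lia.
- by rewrite -iterSr.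
- by rewrite -iterSr.
- by rewrite comm // Hy mul0mx.
Qed.

Lemma int_valued (I : finType) (q : I -> rat) : exists2 D : nat, (0 < D)%N &
  exists z : I -> int, forall i, D%:R * q i = (z i)%:~R.
Proof.
have [D HD H] := common_denom q; exists D => //.
by exists (fun i => Num.floor (D%:R * q i)) => i; rewrite Num.Theory.floorK.
Qed.

(* The relations among the elements of [s], tensored with [rat], contain the
   basis vector of [l] only if [l] is a root of unity. *)
Lemma multiplicative_weight (K : fieldType) (s : seq K) : (forall l, l \in s -> l != 0) ->
  exists chi : K -> int,
  (forall l m, l \in s -> m \in s -> l * m \in s -> chi (l * m) = chi l + chi m) /\
  (forall l, l \in s -> (forall n, (0 < n)%N -> l ^+ n != 1) -> chi l != 0).
Proof.
move=> s0; pose n := size s.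
pose ex (z : 'I_n -> int) := \prod_(i < n) s`_i ^ z i.
have si0 (i : 'I_n) : s`_i != 0 by apply/s0/mem_nth.
have exD z z' : ex (fun i => z i + z' i) = ex z * ex z'.
  by rewrite /ex -big_split; apply: eq_bigr => i _; rewrite expfzDr.
have exM z k : ex (fun i => z i * k) = ex z ^ k.
  rewrite /ex (big_morph (fun x : K => x ^ k) (id1 := 1) (op1 := *%R)).
  - by apply: eq_bigr => i _; rewrite exprz_exp.
  - by move=> x y; rewrite expfzMl.
  - by rewrite exp1rz.
have [W HW] : exists W : {vspace 'rV[rat]_n}, forall v, v \in W <->
    exists N : nat, (0 < N)%N /\ exists z : 'I_n -> int,
      (forall i, N%:R * v 0 i = (z i)%:~R) /\ ex z = 1.
  apply: vspace_of_prop.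
    exists 1%N; split=> //; exists (fun _ => 0); split; first by move=> i; rewrite mxE mulr0.
    by rewrite /ex big1 // => i _; rewrite expr0z.
  move=> a u v [N [HN [z [Hz Ez]]]] [N' [HN' [z' [Hz' Ez']]]].
  exists (`|denq a| * (N * N'))%N; split.
    by rewrite !muln_gt0 HN HN' absz_gt0 denq_neq0.
  exists (fun i => z i * (numq a * N'%:Z) + z' i * (denq a * N%:Z)); split.
    move=> i; rewrite !mxE rmorphD !rmorphM /= -Hz -Hz' ?natrM.
    have -> : (`|denq a|%N)%:R = (denq a)%:~R :> rat.
      by rewrite -[denq a in RHS]gez0_abs ?denq_ge0.
    by rewrite -!pmulrn numqE; ring.
  by rewrite exD !exM Ez Ez' !exp1rz mulr1.
have [|phi [phiL phiW phigood]] := @functional_avoid_family _ W _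
    (fun i : 'I_n => forall k, (0 < k)%N -> s`_i ^+ k != 1) (fun i => delta_mx 0 i).
  move=> i Hi.
  apply/negP => /HW[N [HN [z [Hz Ez]]]]; have /negP := Hi N HN; apply; apply/eqP.
  rewrite -Ez /ex (bigD1 i) //= big1 ?mulr1.
    have : z i = N by apply: (@intr_inj rat); rewrite -Hz mxE !eqxx mulr1.
    by move=> ->.
  move=> j Hj; have -> : z j = 0; last by rewrite expr0z.
  by apply: (@intr_inj rat); rewrite -Hz mxE (negbTE Hj) andbF mulr0.
have [D HD [z Hz]] := int_valued (fun i : 'I_n => phi (delta_mx 0 i)).
pose chi l := oapp z 0 (insub (index l s) : option 'I_n).
have chiE l (Hl : l \in s) : exists2 i : 'I_n, s`_i = l & chi l = z i.
  have Hi : (index l s < n)%N by rewrite index_mem.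
  by exists (Ordinal Hi); rewrite /chi ?insubT //= nth_index.
exists chi; split.
  move=> l m Hl Hm Hlm; have [i Ei ->] := chiE _ Hl; have [j Ej ->] := chiE _ Hm.
  have [k Ek ->] := chiE _ Hlm.
  apply: (@intr_inj rat); rewrite rmorphD /= -!Hz -mulrDr; congr (_ * _).
  pose e (t : 'I_n) := (delta_mx 0 t : 'rV[rat]_n).
  (* The relation saying that [l] times [m] is their product belongs to [W], where [phi] vanishes;
     this is the additivity of [chi]. *)
  have : phi (1 *: e i + (1 *: e j + ((-1) *: e k + 0))) = 0.
    apply: phiW; apply/HW; exists 1%N; split=> //.
    exists (fun t => (t == i)%:Z + ((t == j)%:Z + - (t == k)%:Z)); split.
      move=> t; rewrite !mxE eqxx /= mul1r !rmorphD rmorphN /= addr0 !mul1r mulN1r.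
      by rewrite -!pmulrn.
    have exd t : ex (fun u => (u == t)%:Z) = s`_t.
      rewrite /ex (bigD1 t) //= eqxx expr1z big1 ?mulr1 // => u /negbTE ->.
      by rewrite expr0z.
    rewrite (exD (fun t => (t == i)%:Z)) (exD (fun t => (t == j)%:Z)) !exd.
    have -> : ex (fun t => - (t == k)%:Z) = (s`_k)^-1.
      rewrite -exd -[_^-1]/(_ ^ (-1)) -exM; apply: eq_bigr => u _.
      by rewrite mulrN1.
    by rewrite Ei Ej Ek mulrA mulfV // mulf_neq0 ?s0.
  have phi0 : phi 0 = 0 by have := phiL (-1) 0 0; rewrite scaler0 addr0 mulN1r addNr.
  rewrite !phiL phi0 !mul1r addr0 mulN1r => /eqP; rewrite addrA subr_eq0 => /eqP <-.
  by [].
move=> l Hl Hn; have [i Ei ->] := chiE _ Hl.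
apply: contraTneq (_ : phi (delta_mx 0 i) != 0) => [E|].
  have := Hz i; rewrite E => /eqP; rewrite mulf_eq0 pnatr_eq0 eqn0Ngt HD /=.
  by move=> ->.
by apply: phigood; rewrite Ei.
Qed.

Section GradingOfAutomorphism.
Variables (K : fieldType) (d : nat) (c : 'I_d -> 'I_d -> 'rV[K]_d) (A : 'M[K]_d).
Variables (s : seq K) (prj : K -> 'M[K]_d) (chi : K -> int).
Hypothesis HA : forall x y, sc_bracket c x y *m A = sc_bracket c (x *m A) (y *m A).
Hypothesis Hsp : spectral A s prj.
Hypothesis chiM : forall l m, l \in s -> m \in s -> l * m \in s -> chi (l * m) = chi l + chi m.

Definition weight_prj k := \sum_(l <- s | chi l == k) prj l.

Lemma prj_nil l (v : 'rV[K]_d) : l \in s -> iter d (mulmxr (A - l%:M)) (v *m prj l) = 0.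
Proof.
move=> Hl; have E k (B : 'M[K]_d) : iter k (mulmxr (A - l%:M)) (v *m B) =
    v *m iter k (mulmxr (A - l%:M)) B.
  by elim: k => //= k ->; rewrite mulmxA.
have E2 k : iter k (mulmxr (A - l%:M)) (prj l) =
    prj l *m iter k (mulmxr (A - l%:M)) 1%:M.
  by elim: k => [|k IH] /=; [rewrite mulmx1 | rewrite IH mulmxA].
by rewrite E E2 (spectral_nil Hsp Hl) mulmx0.
Qed.

Lemma weight_prj_mul l k : l \in s -> prj l *m weight_prj k = if chi l == k then prj l else 0.
Proof.
move=> Hl; rewrite /weight_prj mulmx_sumr big_mkcond (bigD1_seq l) ?(spectral_uniq Hsp) //=.
rewrite big_seq_cond big1 ?addr0; first by rewrite (spectral_mul Hsp) // eqxx.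
by move=> l' /andP[Hl' Hne]; case: ifP => // _; rewrite (spectral_mul Hsp) // eq_sym (negbTE Hne).
Qed.

Lemma weight_prj_orth k k' :
  weight_prj k *m weight_prj k' = if k == k' then weight_prj k else 0.
Proof.
rewrite {1}/weight_prj mulmx_suml big_seq_cond.
under eq_bigr => l /andP[Hl _] do rewrite weight_prj_mul //.
rewrite -big_seq_cond; case: eqVneq => [<-|Hk].
  by apply: eq_bigr => l /eqP ->; rewrite eqxx.
by apply: big1 => l /eqP ->; rewrite (negbTE Hk).
Qed.

Lemma weight_space_exists k : exists W : {vspace 'rV[K]_d},
  forall v, v \in W <-> v *m weight_prj k = v.
Proof.
apply: vspace_of_prop; first by rewrite mul0mx.
by move=> a u v Hu Hv; rewrite mulmxDl -scalemxAl Hu Hv.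
Qed.

Definition weight_space k := sval (cid (weight_space_exists k)).

Lemma mem_weight_space k v : v \in weight_space k <-> v *m weight_prj k = v.
Proof. by rewrite /weight_space; case: cid. Qed.

Lemma weight_sum (v : 'rV[K]_d) :
  \sum_(k <- undup (map chi s)) v *m weight_prj k = v.
Proof.
rewrite -mulmx_sumr -[RHS]mulmx1 -(spectral_sum Hsp); congr (_ *m _).
rewrite /weight_prj (exchange_big_dep xpredT) //= big_seq [RHS]big_seq.
apply: eq_bigr => l Hl; rewrite big_mkcond (bigD1_seq (chi l)) ?undup_uniq //=; last first.
  by rewrite mem_undup map_f.
by rewrite eqxx big1 ?addr0 // => k; rewrite eq_sym => /negbTE ->.
Qed.

Lemma weight_prj_in k v : v *m weight_prj k \in weight_space k.
Proof. by apply/mem_weight_space; rewrite -mulmxA weight_prj_orth eqxx. Qed.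

Lemma prj_in_weight l v : l \in s -> v *m prj l = v -> v \in weight_space (chi l).
Proof.
by move=> Hl E; apply/mem_weight_space; rewrite -E -mulmxA weight_prj_mul // eqxx.
Qed.

Lemma weight_grading : is_grading c weight_space.
Proof.
split.
  exists (undup (map chi s)); split.
  - exact: undup_uniq.
  - move=> k; rewrite mem_undup => Hk; apply/eqP; rewrite -subv0; apply/subvP => v.
    move=> /mem_weight_space <-; rewrite memv0 /weight_prj big_seq_cond big_pred0 ?mulmx0 //.
    move=> l; apply/negbTE/andP => -[Hl /eqP E]; move/negP: Hk; apply.
    by rewrite -E map_f.
  - apply/directvP => /=; elim: (undup _) (undup_uniq (map chi s)) => [|k ks IH] /=.
      by rewrite !big_nil dimv0.
    case/andP=> Hk Hks; rewrite !big_cons -IH //; apply: dimv_disjoint_sum.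
    apply/eqP; rewrite -subv0; apply/subvP => v; rewrite memv_cap => /andP[/mem_weight_space E Hv].
    have [W HW] : exists W : {vspace 'rV[K]_d}, forall v, v \in W <-> v *m weight_prj k = 0.
      apply: vspace_of_prop; first by rewrite mul0mx.
      by move=> a u w Hu Hw; rewrite mulmxDl -scalemxAl Hu Hw scaler0 addr0.
    rewrite memv0 -E; apply/eqP/HW; suff /subvP : (\sum_(k <- ks) weight_space k <= W)%VS by apply.
    rewrite big_seq; apply: (big_ind (fun X => X <= W)%VS); rewrite ?sub0v //.
      by move=> X Y HX HY; rewrite subv_add HX.
    move=> k' Hk'; apply/subvP => w /mem_weight_space <-; apply/HW.
    rewrite -mulmxA weight_prj_orth; case: eqP => [E'|]; last by rewrite mulmx0.
    by rewrite -E' Hk' in Hk.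
  - apply/eqP; rewrite eqEsubv subvf; apply/subvP => v _; rewrite -(weight_sum v).
    apply: (big_ind2 (fun u (X : {vspace 'rV[K]_d}) => u \in X)) => [|u X u' X'|k _].
    + exact: mem0v.
    + exact: memv_add.
    + exact: weight_prj_in.
move=> k l x y /mem_weight_space <- /mem_weight_space <-.
rewrite /weight_prj !mulmx_sumr big_seq_cond sc_br_suml; apply: memv_suml => a /andP[Ha /eqP <-].
rewrite big_seq_cond sc_br_sumr; apply: memv_suml => b /andP[Hb /eqP <-].
(* The bracket lies in the generalized eigenspace of [a * b], or vanishes if that is not an
   eigenvalue. *)
have Hz := hom_iter_mul HA (prj_nil x Ha) (prj_nil y Hb).
have [Hab|Hab] := boolP (a * b \in s).
  by rewrite -chiM //; apply: prj_in_weight => //; apply: (spectral_fix Hsp _ Hz).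
by rewrite (spectral_out Hsp Hab Hz) mem0v.
Qed.

Hypothesis Ainj : forall v : 'rV[K]_d, v *m A = 0 -> v = 0.

Lemma center_mulmx v : in_center c v -> in_center c (v *m A).
Proof.
move=> Hv y; have HAu : A \in unitmx.
  by rewrite -row_free_unit; apply: inj_row_free.
have -> : y = y *m invmx A *m A by rewrite mulmxKV.
by rewrite -HA Hv mul0mx.
Qed.

(* A nonzero central vector of weight zero yields a central eigenvector. *)
Lemma weight_special :
  (forall l u, l \in s -> in_center c u -> u != 0 -> u *m A = l *: u -> chi l != 0) ->
  is_special_grading c weight_space.
Proof.
move=> Hchi; split; first exact: weight_grading.
move=> x /mem_weight_space Hx Hc; apply: contrapT => /eqP x0.
have [l Hl [Hl0 Hxl]] : exists2 l, l \in s & chi l = 0 /\ x *m prj l != 0.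
  apply: contrapT => H; move/eqP: x0; apply; rewrite -Hx /weight_prj mulmx_sumr.
  rewrite big_seq_cond big1 // => l /andP[Hl /eqP Hl0]; apply: contrapT => /eqP E.
  by apply: H; exists l.
have Cl : in_center c (x *m prj l).
  apply: (spectral_stable Hsp (center0 c)) => //; first exact: center_lin.
  exact: center_mulmx.
have := prj_nil x Hl; move: (x *m prj l) Hxl Cl => u {x Hx Hc x0}.
elim: (d in iter d) u => [|m IH] u u0 Cu; first by move/eqP: u0.
rewrite iterSr; have [E|E] := eqVneq (mulmxr (A - l%:M) u) 0.
  move=> _; suff /eqP[] : chi l != 0 by []; apply: (Hchi l u) => //.
  by move: E => /eqP; rewrite /= mulmxBr mul_mx_scalar subr_eq0 => /eqP.
apply: IH => //; rewrite /= mulmxBr mul_mx_scalar -scaleNr addrC.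
by apply: center_lin => //; apply: center_mulmx.
Qed.

End GradingOfAutomorphism.

Definition rat_to_C : {rmorphism rat -> Cplx} := @ratr (complex Rdefinitions.R).

Lemma complexifyE d (c : 'I_d -> 'I_d -> 'rV[rat]_d) : complexify c = ext_sc rat_to_C c.
Proof. by []. Qed.

Lemma Cplx_split (p : {poly Cplx}) : p \is monic ->
  exists r : seq Cplx, p = \prod_(z <- r) ('X - z%:P).
Proof.
move=> Hp; have [r Hr] := closed_field_poly_normal (p : {poly complex Rdefinitions.R}).
by exists r; rewrite [LHS]Hr (eqP Hp) scale1r.
Qed.

Lemma trivial_special_grading (F : fieldType) d (c : 'I_d -> 'I_d -> 'rV[F]_d) :
  (forall v : 'rV[F]_d, v = 0) -> has_special_grading c.
Proof.
move=> H0; exists (fun _ => 0%VS); split; last by move=> x _ _; apply: H0.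
split; last by move=> k l x y _ _; rewrite [sc_bracket _ _ _]H0 mem0v.
exists [::]; split=> //; first by apply/directvP; rewrite /= !big_nil dimv0.
rewrite big_nil; apply/eqP; rewrite eqEsubv sub0v; apply/subvP => v _.
by rewrite [v]H0 mem0v.
Qed.

Section AutomorphismGrading.
Variables (d : nat) (c : 'I_d -> 'I_d -> 'rV[rat]_d) (F : 'M[rat]_d) (N : nat).
Hypothesis Lbr : is_lie (sc_bracket c).
Hypothesis HN : lcs (sc_bracket c) fullv N = 0%VS.
Hypothesis HF : forall x y, sc_bracket c x y *m F = sc_bracket c (x *m F) (y *m F).
Hypothesis Hbound : forall v K, (0 < K)%N ->
  (forall i, (forall y, sc_bracket c (iter i (mulmxr F) v) y = 0) /\
     latt 1 K (iter i (mulmxr F) v)) -> v = 0.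

(** From the deep end of the series: the brackets with a kernel vector are kernel vectors lying
    deeper, hence zero. So the vector is central, and its orbit, followed by zeros, is bounded. *)
Lemma bounded_inj (v : 'rV[rat]_d) : v *m F = 0 -> v = 0.
Proof.
suff K j : forall v : 'rV[rat]_d, v \in lcs (sc_bracket c) fullv (N - j) -> v *m F = 0 -> v = 0.
  by apply: (K N); rewrite subnn memvf.
elim: j => [|j IH] {}v; first by rewrite subn0 HN memv0 => /eqP.
have [Hj|Hj] := leqP N j.
  by rewrite (_ : N - j.+1 = N - j)%N; [apply: IH | lia].
move=> Hv HvF; have Hc y : sc_bracket c v y = 0.
  apply: IH; last by rewrite HF HvF (br0l Lbr).
  rewrite (_ : N - j = (N - j.+1).+1)%N; last by lia.
  by apply: br_lcsSr => //; apply: memvf.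
have [K HK HKv] := latt_exists v; apply: (Hbound HK) => -[|i]; first by [].
have -> : iter i.+1 (mulmxr F) v = 0 by elim: i => [//|i /= ->]; rewrite mul0mx.
by split=> [y|]; [rewrite (br0l Lbr) | apply: latt0].
Qed.

(** A finite orbit has a common denominator. *)
Lemma bounded_periodic (v : 'rV[rat]_d) m : (0 < m)%N -> in_center c v ->
  iter m (mulmxr F) v = v -> v = 0.
Proof.
move=> Hm Hc Hv; pose K i := sval (cid2 (latt_exists (iter i (mulmxr F) v))).
have HK i : (0 < K i)%N by rewrite /K; case: cid2.
apply: (Hbound (K := \prod_(i < m) K i)); first by apply: prodn_gt0.
have Cv i : in_center c (iter i (mulmxr F) v).
  by elim: i => //= i IH; apply: center_mulmx => //; apply: bounded_inj.
move=> i; split; first exact: Cv.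
have -> : iter i (mulmxr F) v = iter (i %% m) (mulmxr F) v.
  rewrite {1}(divn_eq i m) addnC iterD; congr iter.
  by elim: (i %/ m)%N => // q IH; rewrite mulSn iterD IH.
rewrite (bigD1 (Ordinal (ltn_pmod i Hm))) //=; apply: lattMr.
by rewrite /K; case: cid2.
Qed.

(** A central complex eigenvector with l^m = 1 would have central rational coefficients fixed by
    F^m, which [bounded_periodic] excludes. So [chi] is nonzero on every eigenvalue that occurs in
    the center. *)
Lemma bounded_special_grading : has_special_grading (complexify c).
Proof.
rewrite complexifyE; set f := rat_to_C; pose A := map_mx f F.
have HA := ext_hom f HF.
have Ainj (v : 'rV[Cplx]_d) : v *m A = 0 -> v = 0.
  have [r [b [Y [Hb ->]]]] := matrix_rat_basis f v => E.
  apply: big1 => k _; rewrite (bounded_inj (rat_free_mulmx Hb E k)).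
  by rewrite map_mx0 scaler0.
have [r Hr] := Cplx_split (char_poly_monic A).
have [prj Hprj] := spectral_exists Hr.
have eig l : l \in undup r -> exists2 v : 'rV[Cplx]_d, v *m A = l *: v & v != 0.
  by move=> /(spectral_root Hprj); rewrite -eigenvalue_root_char => /eigenvalueP.
have [chi [chiM chi0]] := @multiplicative_weight _ (undup r) (fun l Hl => ltac:(
  have [v Hv v0] := eig l Hl; apply: contraNneq v0 => E; apply/eqP/Ainj;
  by rewrite Hv E scale0r)).
exists (weight_space (undup r) prj chi); apply: (weight_special HA Hprj chiM Ainj).
move=> l u Hl Hu u0 Hul; apply: chi0 => // m Hm; apply: contraNneq u0 => Em.
have [r' [b [Y [Hb Eu]]]] := matrix_rat_basis f u.
have Yc k : in_center c (Y k) by apply: ext_center_coef Hb _ k; rewrite -Eu.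
have iterM (K : fieldType) (B : 'M[K]_d) (v : 'rV[K]_d) i :
    iter i (mulmxr B) v = v *m iter i (mulmxr B) 1%:M.
  by elim: i => [|i IH] /=; rewrite ?mulmx1 // IH mulmxA.
have mapI i : map_mx f (iter i (mulmxr F) 1%:M) = iter i (mulmxr A) 1%:M.
  by elim: i => [|i IH] /=; rewrite ?map_mx1 // map_mxM IH.
have um i : iter i (mulmxr A) u = l ^+ i *: u.
  by elim: i => [|i IH] /=; rewrite ?scale1r // IH -scalemxAl Hul scalerA -exprSr.
have Yk k : Y k = 0.
  apply: (bounded_periodic Hm) => //; rewrite iterM; apply/eqP; rewrite -subr_eq0.
  rewrite -[X in _ - X]mulmx1 -mulmxBr; apply/eqP; move: k; apply: (rat_free_mulmx Hb).
  by rewrite -Eu map_mxB mulmxBr map_mx1 mulmx1 mapI -iterM um Em scale1r subrr.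
by rewrite Eu big1 // => k _; rewrite Yk map_mx0 scaler0.
Qed.

End AutomorphismGrading.

Lemma transitive_special_grading (G : groupType) d (c : 'I_d -> 'I_d -> 'rV[rat]_d)
    (iota : G -> 'rV[rat]_d) :
  is_malcev_lie_algebra c iota -> transitive_self_similar G ->
  has_special_grading (complexify c).
Proof.
move=> Hm Ht; have [T [T3 HT]] := malcev_bch Hm.
have [G1|[R HR]] := transitive_virtual_endo Ht.
  apply: trivial_special_grading => v.
  have E : (0%VS : {vspace 'rV[rat]_d}) = fullv.
    apply: (malcev_gen Hm) => [g|x y]; first by rewrite (G1 g) (iota1 Hm T3 HT) mem0v.
    by rewrite !memv0 => /eqP-> _; rewrite (br0l (malcev_lie Hm)).
  have Hd : d = 0%N.
    by have := congr1 (fun W : {vspace _} => \dim W) E; rewrite /= dimv0 dimvf /dim /= mul1n.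
  by apply/rowP => -[i Hi]; suff: (i < 0)%N by []; rewrite -Hd.
have [F [HF Hb]] := virtual_endo_automorphism Hm T3 HT HR.
have [N HN] := malcev_lcs Hm.
exact: (bounded_special_grading (malcev_lie Hm) (HN fullv) HF Hb).
Qed.

(** * Rational derivations from gradings *)

Definition is_derivation (F : fieldType) d (c : 'I_d -> 'I_d -> 'rV[F]_d) (D : 'M[F]_d) :=
  forall x y, sc_bracket c x y *m D = sc_bracket c (x *m D) y + sc_bracket c x (y *m D).

Lemma special_grading_derivation (F : numFieldType) d (c : 'I_d -> 'I_d -> 'rV[F]_d) :
  has_special_grading c -> exists D : 'M[F]_d, is_derivation c D /\
    forall v, in_center c v -> v *m D = 0 -> v = 0.
Proof.
case=> V [[[s [us Vout Hdir Hfull]] Hbr] Hsp].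
pose W (i : 'I_(size s)) := V s`_i.
have Wdir : directv (\sum_i W i).
  have E1 : (\sum_(k <- s) V k)%VS = (\sum_(i < size s) W i)%VS by rewrite (big_nth 0) big_mkord.
  have E2 : (\sum_(k <- s) \dim (V k) = \sum_(i < size s) \dim (W i))%N by rewrite (big_nth 0) big_mkord.
  have /eqP E3 : directv (\sum_(k <- s) V k) := Hdir.
  rewrite /= in E3.
  apply/directvP; rewrite /= -E1 -E2; exact: E3.
have Wfull v : v \in (\sum_i W i)%VS.
  by have := memvf v; rewrite -Hfull (big_nth 0) big_mkord.
have dec v : exists w : 'I_(size s) -> 'rV[F]_d, (forall i, w i \in W i) /\ v = \sum_i w i.
  by have /memv_sumP[w Hw Ev] := Wfull v; exists w; split=> // i; apply: Hw.
pose w j := sval (cid (dec (delta_mx 0 j))).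
have Hw j : (forall i, w j i \in W i) /\ delta_mx 0 j = \sum_i w j i by rewrite /w; case: cid.
pose E i : 'M[F]_d := \matrix_(j < d) w j i.
have EW i v : v *m E i \in W i.
  by rewrite mulmx_sum_row; apply: memv_suml => j _; rewrite rowK memvZ //; case: (Hw j).
have Esum (v : 'rV[F]_d) : v = \sum_i v *m E i.
  rewrite -mulmx_sumr -[LHS]mulmx1; congr (_ *m _); apply/row_matrixP => j.
  rewrite row1 linear_sum /=; have [_ ->] := Hw j; apply: eq_bigr => i _.
  by rewrite rowK.
have Winj (u : 'I_(size s) -> 'rV[F]_d) : (forall i, u i \in W i) -> \sum_i u i = 0 ->
    forall i, u i = 0.
  by move=> Hu Eu i; apply: (elimT directv_sum_independent Wdir).
(* Multiplication by the degree; characteristic zero makes it injective on the nonzero degrees. *)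
pose D : 'M[F]_d := \sum_(i < size s) (s`_i)%:~R *: E i.
have DW k x : x \in V k -> x *m D = k%:~R *: x.
  move=> Hx; have [Hk|Hk] := boolP (k \in s); last first.
    by move: Hx; rewrite Vout // memv0 => /eqP->; rewrite mul0mx scaler0.
  have Hi : (index k s < size s)%N by rewrite index_mem.
  pose i0 := Ordinal Hi; have Ei0 : s`_i0 = k by rewrite nth_index.
  have Ex : forall i, x *m E i - (if i == i0 then x else 0) = 0.
    apply: Winj => [i|].
      by rewrite rpredB //; case: eqP => [->|_]; rewrite ?mem0v // /W Ei0.
    by rewrite sumrB -Esum -big_mkcond big_pred1_eq subrr.
  rewrite /D mulmx_sumr (bigD1 i0) //= big1 ?addr0.
    by rewrite -scalemxAr Ei0; have /eqP := Ex i0; rewrite eqxx subr_eq0 => /eqP->.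
  move=> i /negbTE Hne; rewrite -scalemxAr; have := Ex i; rewrite Hne subr0 => ->.
  by rewrite scaler0.
exists D; split.
  move=> x y; pose br := sc_bracket c.
  pose P u v := br u v *m D = br (u *m D) v + br u (v *m D).
  have PDl v : P 0 v by rewrite /P !mul0mx /br !sc_br0l mul0mx addr0.
  have PDr u : P u 0 by rewrite /P !mul0mx /br !sc_br0r mul0mx addr0.
  rewrite -/(P x y) (Esum x) (Esum y); apply: (big_ind (fun u => P u _)) => //.
    move=> u u' Hu Hu'; rewrite /P /br mulmxDl !sc_brDl mulmxDl -/br Hu Hu'.
    by rewrite addrACA.
  move=> i _; apply: (big_ind (P _)) => //.
    move=> u u' Hu Hu'; rewrite /P /br mulmxDl !sc_brDr mulmxDl -/br Hu Hu'.
    by rewrite addrACA.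
  move=> j _; rewrite /P /br (DW _ _ (Hbr _ _ _ _ (EW i x) (EW j y))) !(DW _ _ (EW _ _)).
  by rewrite sc_brZl sc_brZr -scalerDl -intrD.
move=> v Hv HD; apply: Hsp => //; rewrite [v]Esum; apply: memv_suml => i _.
have [E0|E0] := eqVneq s`_i 0; first by rewrite -E0; apply: EW.
suff -> : v *m E i = 0 by rewrite mem0v.
have : forall i : 'I_(size s), (s`_i)%:~R *: (v *m E i) = 0.
  apply: Winj => [j|]; first by rewrite memvZ // EW.
  by rewrite -[RHS]HD /D mulmx_sumr; apply: eq_bigr => j _; rewrite scalemxAr.
move=> /(_ i) /eqP; rewrite scaler_eq0 intr_eq0 (negbTE E0) => /eqP //.
Qed.

Lemma poly_nonroot (K : fieldType) (f : {rmorphism rat -> K}) (p : {poly K}) : p != 0 ->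
  exists n : nat, ~~ root p (f n%:R).
Proof.
move=> p0; apply: contrapT => H.
have : (size [seq f n%:R | n <- iota 0 (size p)] < size p)%N.
  apply: max_poly_roots => //.
    apply/allP => x /seq.mapP[n _ ->]; apply: contrapT => /negP Hn; apply: H; by exists n.
  rewrite map_inj_uniq ?iota_uniq // => m n /fmorph_inj /eqP.
  by rewrite eqr_nat => /eqP.
by rewrite size_map size_iota ltnn.
Qed.

(** The coefficients become rational one at a time: in a single coefficient the determinant is a
    nonzero polynomial, which some natural number does not annihilate. *)
Lemma det_specialize (K : fieldType) (f : {rmorphism rat -> K}) r m
    (M : 'I_r -> 'M[rat]_m) (b : 'I_r -> K) :
  \det (\sum_k b k *: map_mx f (M k)) != 0 ->
  exists q : 'I_r -> rat, \det (\sum_k q k *: M k) != 0.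
Proof.
move=> Hb.
have K' t : (t <= r)%N -> exists b' : 'I_r -> K, exists q : 'I_r -> rat,
    (forall k : 'I_r, (k < t)%N -> b' k = f (q k)) /\
    \det (\sum_k b' k *: map_mx f (M k)) != 0.
  elim: t => [|t IH] Ht; first by exists b, (fun _ => 0).
  have [b' [q [Hq Hdet]]] := IH (ltnW Ht).
  pose t0 := Ordinal Ht; pose A := \sum_(k | k != t0) b' k *: map_mx f (M k).
  pose p := \det (map_mx polyC A + 'X *: map_mx polyC (map_mx f (M t0))).
  have pE x : p.[x] = \det (A + x *: map_mx f (M t0)).
    rewrite -horner_evalE -det_map_mx; congr (\det _); apply/matrixP => i j.
    by rewrite !mxE /= /horner_eval hornerD hornerM hornerX !hornerC.
  have p0 : p != 0.
    apply: contraNneq Hdet => p0; rewrite (bigD1 t0) //= addrC -pE p0 horner0 //.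
  have [n Hn] := poly_nonroot f p0.
  exists (fun k => if k == t0 then f n%:R else b' k), (fun k => if k == t0 then n%:R else q k).
  split=> [k Hk|].
    case: eqP => // /eqP Hne; apply: Hq; rewrite ltn_neqAle -ltnS Hk andbT.
    by apply: contra Hne => /eqP E; apply/eqP/val_inj.
  rewrite (bigD1 t0) //= eqxx addrC; move: Hn; rewrite /root pE.
  congr (~~ (\det (_ + _) == _)); apply: eq_bigr => k /negbTE Hk.
  by rewrite Hk.
have [b' [q [Hq Hdet]]] := K' r (leqnn r); exists q.
rewrite -(fmorph_eq0 f) -det_map_mx map_mx_sum; congr (~~ (\det _ == 0)) : Hdet.
by apply: eq_bigr => k _; rewrite map_mxZ Hq.
Qed.

Lemma derivation_center (F : fieldType) d (c : 'I_d -> 'I_d -> 'rV[F]_d) D v :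
  is_derivation c D -> in_center c v -> in_center c (v *m D).
Proof.
move=> HD Hv y; have := HD v y; rewrite !Hv mul0mx addr0 => <- //.
Qed.

(** The coefficients [Y k] of [D] are rational derivations, and injectivity on the center is the
    nonvanishing of a determinant, which survives a suitable rational choice of the scalars. *)
Lemma derivation_descent (K : fieldType) (f : {rmorphism rat -> K}) d
    (c : 'I_d -> 'I_d -> 'rV[rat]_d) (D : 'M[K]_d) :
  is_derivation (ext_sc f c) D ->
  (forall v, in_center (ext_sc f c) v -> v *m D = 0 -> v = 0) ->
  exists D' : 'M[rat]_d, is_derivation c D' /\
    forall v, in_center c v -> v *m D' = 0 -> v = 0.
Proof.
move=> HD Hinj; have [r [b [Y [Hb ED]]]] := matrix_rat_basis f D.
have YD k : is_derivation c (Y k).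
  move=> x y; apply/eqP; rewrite -subr_eq0; apply/eqP; move: k.
  apply: (rat_free_mx Hb (Y := fun k => sc_bracket c x y *m Y k -
     (sc_bracket c (x *m Y k) y + sc_bracket c x (y *m Y k)))).
  have := HD (map_mx f x) (map_mx f y) => /eqP; rewrite -subr_eq0 => /eqP E.
  rewrite -[RHS]E ED !mulmx_sumr sc_br_suml sc_br_sumr -big_split -sumrB.
  apply: eq_bigr => k _; rewrite map_mxB map_mxD !map_mxM -!ext_br !map_mxM.
  by rewrite -!scalemxAr sc_brZl sc_brZr scalerBr scalerDr.
have [W HW] : exists W : {vspace 'rV[rat]_d}, forall v, v \in W <-> in_center c v.
  apply: vspace_of_prop; first exact: center0.
  exact: center_lin.
pose m := \dim W; pose B : 'M[rat]_(m, d) := \matrix_(i < m) (vbasis W)`_i.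
have BW (u : 'rV[rat]_m) : u *m B \in W.
  rewrite mulmx_sum_row; apply: memv_suml => i _; rewrite rowK memvZ //.
  by apply: vbasis_mem; apply: mem_nth; rewrite size_tuple.
have WB v : v \in W -> exists u : 'rV[rat]_m, v = u *m B.
  move=> Hv; exists (\row_i coord (vbasis W) i v); rewrite {1}(coord_vbasis Hv) mulmx_sum_row.
  by apply: eq_bigr => i _; rewrite rowK mxE.
have Bfree (u : 'rV[rat]_m) : u *m B = 0 -> u = 0.
  rewrite mulmx_sum_row => E; apply/rowP => i; rewrite mxE.
  have /freeP := basis_free (vbasisP W); apply.
  by rewrite -[RHS]E; apply: eq_bigr => j _; rewrite rowK.
have HM k : exists M : 'M[rat]_m, B *m Y k = M *m B.
  have Hi (i : 'I_m) : exists u : 'rV[rat]_m, row i B *m Y k = u *m B.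
    apply: WB; apply/HW/derivation_center => //; apply/HW.
    by rewrite rowE; apply: BW.
  exists (\matrix_(i < m) sval (cid (Hi i))); apply/row_matrixP => i.
  by rewrite row_mul [RHS]row_mul [X in X *m B]rowK; exact: (svalP (cid (Hi i))).
pose M k := sval (cid (HM k)); have HMk k : B *m Y k = M k *m B by exact: (svalP (cid (HM k))).
have Hdet : \det (\sum_k b k *: map_mx f (M k)) != 0.
  rewrite -unitfE -unitmxE -row_free_unit; apply: inj_row_free => u Hu.
  suff E : u *m map_mx f B = 0.
    have Hfree : row_free (map_mx f B) by rewrite row_free_map; apply: inj_row_free.
    by apply: (row_free_inj Hfree); rewrite E mul0mx.
  apply: Hinj.
    rewrite mulmx_sum_row; move: (index_enum _) => s.
    elim: s => [|i s IH]; first by rewrite big_nil; apply: center0.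
    rewrite big_cons; apply: center_lin => //; rewrite -map_row; apply: ext_center_map.
    by apply/HW; rewrite rowE; apply: BW.
  rewrite ED -mulmxA mulmx_sumr.
  have -> : \sum_k map_mx f B *m (b k *: map_mx f (Y k)) =
     (\sum_k b k *: map_mx f (M k)) *m map_mx f B.
    rewrite mulmx_suml; apply: eq_bigr => k _.
    by rewrite -scalemxAr -map_mxM HMk map_mxM -scalemxAl.
  by rewrite mulmxA Hu mul0mx.
have [q Hq] := det_specialize Hdet.
exists (\sum_k q k *: Y k); split.
  move=> x y; rewrite !mulmx_sumr sc_br_suml sc_br_sumr -big_split; apply: eq_bigr => k _.
  by rewrite -!scalemxAr YD sc_brZl sc_brZr scalerDr.
move=> v /HW/WB[u ->]; rewrite -mulmxA mulmx_sumr.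
have -> : \sum_k B *m (q k *: Y k) = (\sum_k q k *: M k) *m B.
  by rewrite mulmx_suml; apply: eq_bigr => k _; rewrite -scalemxAr HMk -scalemxAl.
rewrite mulmxA => /Bfree Hu; suff -> : u = 0 by rewrite mul0mx.
have Hun : row_free (\sum_k q k *: M k) by rewrite row_free_unit unitmxE unitfE.
by apply: (row_free_inj Hun); rewrite Hu mul0mx.
Qed.

(** * Arithmetic at the norm of an element close to one *)

Lemma galois_splitting (p : {poly rat}) : p \is monic ->
  exists (L : splittingFieldType rat) (theta : L) (r : seq L),
  [/\ map_poly (in_alg L) p = \prod_(z <- r) ('X - z%:P),
      theta != 0,
      forall x : L, exists g : {poly rat}, x = (map_poly (in_alg L) g).[theta],
      forall x : L, (forall s : gal_of {:L}, s x = x) -> exists q, x = in_alg L q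
    & forall s t : gal_of {:L}, s theta = t theta -> s = t].
Proof.
move=> mp; have [rs Hrs] := closed_field_poly_normal (map_poly (ratr : rat -> algC) p).
have [L0 [LC [r Er Lgen]]] := num_field_exists rs.
have Dp : map_poly (in_alg L0) p = \prod_(z <- r) ('X - z%:P).
  apply: (map_poly_inj LC); rewrite -map_poly_comp rmorph_prod /=.
  have -> : map_poly (LC \o in_alg L0) p = map_poly ratr p.
    by apply: eq_map_poly => a /=; rewrite rmorphZ_num /= rmorph1 mulr1.
  rewrite Hrs lead_coef_map (monicP mp) rmorph1 scale1r -Er big_map.
  by apply: eq_bigr => z _; rewrite rmorphB /= map_polyX map_polyC.
have Lsplit : splittingFieldFor 1 (map_poly (in_alg L0) p) {:L0}.
  by exists r; [rewrite Dp eqpxx | exact: Lgen].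
have p1 (q : {poly rat}) : map_poly (in_alg L0) q \is a polyOver 1%VS.
  by apply/polyOverP => i; rewrite coef_map /= memvZ // mem1v.
have L_ax : FieldExt_isSplittingField _ L0.
  by constructor; exists (map_poly (in_alg L0) p).
pose L : splittingFieldType rat := HB.pack_for (splittingFieldType rat) L0 L_ax.
have ch0 : has_char0 L0 by move=> q; rewrite -(fmorph_pchar LC) Cpchar.
have sepL (K E : {subfield L0}) : separable K E.
  by apply/separableP => y _; apply: pcharf0_separable.
have galL : galois 1%AS {:L}%AS.
  apply/and3P; split; [exact: sub1v | exact: sepL | ].
  by apply/splitting_normalField; [exact: sub1v | exists (map_poly (in_alg L0) p)].
pose th := separable_generator 1%AS {:L0}%AS.
have Eth : fullv = <<1%AS; th>>%VS :> {vspace L0}.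
  exact: (eq_adjoin_separable_generator (sepL 1%AS {:L0}%AS) (sub1v _)).
(* A zero generator, possible only for the rationals themselves, is replaced by 1: the norm of 1 + n
   theta has to vary with n later on. *)
have th0 : exists t : L0, t != 0 /\ fullv = <<1; t>>%VS :> {vspace L0}.
  have [E|E] := eqVneq th 0; last by exists th.
  exists 1; split; first exact: oner_neq0.
  by rewrite Eth E; apply/eqP; rewrite eqEsubv; apply/andP; split; apply/FadjoinP;
    rewrite ?subv_adjoin ?rpred0 ?rpred1.
have [t [t0 Et]] := th0; exists L, t, r; split=> //.
- move=> x; have : x \in <<1; t>>%VS by rewrite -Et memvf.
  move/Fadjoin_polyP=> [q /polyOver1P[g ->] ->]; by exists g.
- move=> x Hx; have : x \in fixedField (L := L) (V := {:L}) 'Gal({:L}%AS / 1%AS)%g.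
    by apply/fixedFieldP; [exact: memvf | move=> s _; apply: Hx].
  move/galois_fixedField: galL => -> /vlineP[q ->]; by exists q.
- move=> s s' Hs; apply/eqP/gal_eqP => x _.
  have : x \in <<1; t>>%VS by rewrite -Et memvf.
  move/Fadjoin_polyP=> [q /polyOver1P[g ->] ->].
  rewrite -!horner_map /= Hs -!map_poly_comp; congr (_.[_]).
  by apply: eq_map_poly => a /=; rewrite !linearZ /= !rmorph1.
Qed.

Lemma rat_integral_int (q : rat) (p : {poly int}) : p \is monic ->
  root (map_poly (intr : int -> rat) p) q -> q \in Num.int.
Proof.
move=> mp rp; have Hq : (ratr q : algC) \in Num.int.
  apply: Cint_rat_Aint; first exact: Crat_rat.
  apply: (@root_monic_Aint (map_poly (intr : int -> algC) p)).
  - have -> : map_poly (intr : int -> algC) p = map_poly ratr (map_poly intr p).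
      by rewrite -map_poly_comp; apply: eq_map_poly => z /=; rewrite ratr_int.
    exact: rmorph_root.
  - exact: monic_map.
  - by apply/polyOverP => i; rewrite coef_map /= intr_int.
have /intrP[z Hz] := Hq.
by have -> : q = z%:~R by apply: (fmorph_inj (@ratr algC)); rewrite [LHS]Hz [RHS]ratr_int.
Qed.

(** Integrality at all primes dividing [P], where [P] itself need not be prime. *)
Definition locZ (P : nat) (q : rat) :=
  exists b : nat, coprime b P /\ b%:R * q \in (Num.int : {pred rat}).

Definition algint (L : fieldType) (x : L) := integralOver (intr : int -> L) x.

Definition locO (L : fieldType) (P : nat) (x : L) :=
  exists b : nat, coprime b P /\ algint (b%:R * x).

Section LocZ.
Variable P : nat.

Lemma locZ_int q : q \in Num.int -> locZ P q.
Proof. by move=> Hq; exists 1%N; rewrite coprime1n mul1r. Qed.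

Lemma locZD p q : locZ P p -> locZ P q -> locZ P (p + q).
Proof.
move=> [a [Ha Hp]] [b [Hb Hq]]; exists (a * b)%N; rewrite coprimeMl Ha Hb; split=> //.
rewrite natrM; have -> : a%:R * b%:R * (p + q) = b%:R * (a%:R * p) + a%:R * (b%:R * q) by ring.
by rewrite rpredD // rpredM // natr_int.
Qed.

Lemma locZM p q : locZ P p -> locZ P q -> locZ P (p * q).
Proof.
move=> [a [Ha Hp]] [b [Hb Hq]]; exists (a * b)%N; rewrite coprimeMl Ha Hb; split=> //.
by rewrite natrM mulrACA rpredM.
Qed.

Lemma locZN p : locZ P p -> locZ P (- p).
Proof. by move=> [a [Ha Hp]]; exists a; rewrite mulrN rpredN. Qed.

Lemma locZ_sum I (s : seq I) (Q : pred I) F : (forall i, Q i -> locZ P (F i)) ->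
  locZ P (\sum_(i <- s | Q i) F i).
Proof.
move=> H; apply: (big_ind (locZ P)) => //; [exact/locZ_int/rpred0 | exact: locZD].
Qed.

Lemma locZX p k : locZ P p -> locZ P (p ^+ k).
Proof.
by move=> Hp; elim: k => [|k IH]; rewrite ?expr0 ?exprS; [exact/locZ_int/rpred1|exact: locZM].
Qed.

Lemma locZ_divisible q : (1 < P)%N -> (forall k, locZ P (q / P%:R ^+ k)) -> q = 0.
Proof.
move=> HP Hq; apply: contrapT => /eqP q0.
have Hn : numq q != 0 by rewrite numq_eq0.
have P0 : P%:R != 0 :> rat by rewrite pnatr_eq0 -lt0n; apply: leq_trans HP.
(* The absolute value n of the numerator serves as exponent, because P^n exceeds n. *)
have [b [Hb /intrP[z Hz]]] := Hq `|numq q|%N.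
have E : b%:Z * numq q = z * (P%:Z ^+ `|numq q| * denq q).
  apply: (@intr_inj rat); rewrite !intrM -Hz numqE.
  rewrite rmorphXn /= -!pmulrn; field; exact: expf_neq0.
have : (P ^ `|numq q| %| b * `|numq q|)%N.
  have := congr1 absz E; rewrite !abszM abszX /= => ->.
  by rewrite mulnA dvdn_mulr // mulnC dvdn_mulr.
rewrite Gauss_dvdr; last by rewrite coprime_sym coprimeXr.
have : (0 < `|numq q|)%N by rewrite absz_gt0.
by move=> H /(dvdn_leq H); rewrite leqNgt ltn_expl.
Qed.

End LocZ.

Section LocO.
Variables (L : fieldType) (f : {rmorphism rat -> L}).

Lemma algint_int (z : int) : algint (z%:~R : L).
Proof. exact: (integral_id (intr : {rmorphism int -> L}) z). Qed.
Lemma algintD (x y : L) : algint x -> algint y -> algint (x + y).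
Proof. exact: (integral_add (RtoK := (intr : {rmorphism int -> L}))). Qed.
Lemma algintM (x y : L) : algint x -> algint y -> algint (x * y).
Proof. exact: (integral_mul (RtoK := (intr : {rmorphism int -> L}))). Qed.
Lemma algintN (x : L) : algint x -> algint (- x).
Proof. exact: (integral_opp (RtoK := (intr : {rmorphism int -> L}))). Qed.

Lemma algint_ap (g : {rmorphism L -> L}) (x : L) : algint x -> algint (g x).
Proof.
case=> p mp rp; exists p => //.
have -> : map_poly (intr : int -> L) p = map_poly g (map_poly (intr : int -> L) p).
  by rewrite -map_poly_comp; apply: eq_map_poly => z /=; rewrite rmorph_int.
exact: rmorph_root.
Qed.

Lemma algint_rat q : algint (f q) -> q \in Num.int.
Proof.
case=> p mp rp; apply: (@rat_integral_int q p mp).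
rewrite -(fmorph_root f) -map_poly_comp.
by have -> : map_poly (f \o intr) p = map_poly (intr : int -> L) p
  by apply: eq_map_poly => z /=; rewrite rmorph_int.
Qed.

Lemma algint_nat n : algint (n%:R : L).
Proof. by rewrite -[n%:R]/(n%:Z%:~R); apply: algint_int. Qed.

Lemma algint_ratint q : q \in Num.int -> algint (f q).
Proof. by case/intrP=> z ->; rewrite rmorph_int; apply: algint_int. Qed.

Lemma algint_sum I (s : seq I) (Q : pred I) (F : I -> L) : (forall i, Q i -> algint (F i)) ->
  algint (\sum_(i <- s | Q i) F i).
Proof.
move=> H; apply: (big_ind (@algint L)) => //; [exact: (algint_int 0) | exact: algintD].
Qed.

Lemma algint_prod I (s : seq I) (Q : pred I) (F : I -> L) : (forall i, Q i -> algint (F i)) ->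
  algint (\prod_(i <- s | Q i) F i).
Proof.
move=> H; apply: (big_ind (@algint L)) => //; [exact: (algint_int 1) | exact: algintM].
Qed.

Lemma algintX (x : L) k : algint x -> algint (x ^+ k).
Proof.
by move=> Hx; elim: k => [|k IH]; rewrite ?expr0 ?exprS; [exact: (algint_int 1)|exact: algintM].
Qed.

Variable P : nat.

Lemma locO_algint (x : L) : algint x -> locO P x.
Proof. by move=> Hx; exists 1%N; rewrite coprime1n mul1r. Qed.

Lemma locOD (x y : L) : locO P x -> locO P y -> locO P (x + y).
Proof.
move=> [a [Ha Hp]] [b [Hb Hq]]; exists (a * b)%N; rewrite coprimeMl Ha Hb; split=> //.
rewrite natrM; have -> : a%:R * b%:R * (x + y) = b%:R * (a%:R * x) + a%:R * (b%:R * y) by ring.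
by apply: algintD; apply: algintM => //; apply: algint_nat.
Qed.

Lemma locOM (x y : L) : locO P x -> locO P y -> locO P (x * y).
Proof.
move=> [a [Ha Hp]] [b [Hb Hq]]; exists (a * b)%N; rewrite coprimeMl Ha Hb; split=> //.
by rewrite natrM mulrACA; apply: algintM.
Qed.

Lemma locON (x : L) : locO P x -> locO P (- x).
Proof. by move=> [a [Ha Hp]]; exists a; rewrite mulrN; split=> //; apply: algintN. Qed.

Lemma locOB (x y : L) : locO P x -> locO P y -> locO P (x - y).
Proof. by move=> Hx Hy; apply/locOD/locON. Qed.

Lemma locO0 : locO P (0 : L). Proof. exact/locO_algint/(algint_int 0). Qed.
Lemma locO1 : locO P (1 : L). Proof. exact/locO_algint/(algint_int 1). Qed.

Lemma locO_sum I (s : seq I) (Q : pred I) (F : I -> L) : (forall i, Q i -> locO P (F i)) ->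
  locO P (\sum_(i <- s | Q i) F i).
Proof. by move=> H; apply: (big_ind (locO P)) => //; [exact: locO0 | exact: locOD]. Qed.

Lemma locO_prod I (s : seq I) (Q : pred I) (F : I -> L) : (forall i, Q i -> locO P (F i)) ->
  locO P (\prod_(i <- s | Q i) F i).
Proof. by move=> H; apply: (big_ind (locO P)) => //; [exact: locO1 | exact: locOM]. Qed.

Lemma locOX (x : L) k : locO P x -> locO P (x ^+ k).
Proof.
by move=> Hx; elim: k => [|k IH]; rewrite ?expr0 ?exprS; [exact: locO1|exact: locOM].
Qed.

Lemma locO_ap (g : {rmorphism L -> L}) (x : L) : locO P x -> locO P (g x).
Proof.
by case=> b [Hb Hx]; exists b; split=> //; rewrite -(rmorph_nat g) -rmorphM; apply: algint_ap.
Qed.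

Lemma locO_rat q : locO P (f q) <-> locZ P q.
Proof.
split=> -[b [Hb H]]; exists b; split=> //.
  by apply: algint_rat; rewrite rmorphM rmorph_nat.
by rewrite -(rmorph_nat f) -rmorphM; apply: algint_ratint.
Qed.

End LocO.

(** * Residues modulo powers of alpha *)

Section LocalArithmetic.
Variables (L : fieldType) (f : {rmorphism rat -> L}) (gT : finGroupType).
Variable ap : gT -> {rmorphism L -> L}.
Hypothesis apM : forall s t x, ap (s * t)%g x = ap t (ap s x).
Hypothesis ap1 : forall x, ap 1%g x = x.
Hypothesis apfix : forall x, (forall s, ap s x = x) -> exists q, x = f q.

Lemma ap_rat s q : ap s (f q) = f q.
Proof. by rewrite -[LHS]/((ap s \o f) q) fmorph_eq_rat [RHS]fmorph_eq_rat. Qed.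

Definition normL x := \prod_s ap s x.

Lemma normL_rat x : exists q, normL x = f q.
Proof.
apply: apfix => t; rewrite /normL rmorph_prod /=.
rewrite [RHS](reindex_inj (mulIg t)) /=; apply: eq_bigr => s _.
by rewrite apM.
Qed.

Lemma normL_eq0 x : normL x = 0 -> x = 0.
Proof.
move=> E; have /prodf_eq0[s _] : normL x == 0 by rewrite E.
by rewrite fmorph_eq0 => /eqP.
Qed.

Lemma rational_polynomial (q : {poly L}) : (forall s, map_poly (ap s) q = q) ->
  exists p : {poly rat}, q = map_poly f p.
Proof.
move=> Hq; have H i : exists c, q`_i = f c.
  by apply: apfix => s; rewrite -{2}(Hq s) coef_map.
exists (\poly_(i < size q) sval (cid (H i))); apply/polyP => i.
rewrite coef_map coef_poly; case: ltnP => Hi; first exact: (svalP (cid (H i))).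
by rewrite nth_default //; apply/esym/rmorph0.
Qed.

Lemma algint_multiple (x : L) : exists2 n : nat, (0 < n)%N & algint (n%:R * x).
Proof.
pose q : {poly L} := \prod_s ('X - (ap s x)%:P).
have [p Ep] : exists p : {poly rat}, q = map_poly f p.
  apply: rational_polynomial => t; rewrite /q rmorph_prod /=.
  rewrite [RHS](reindex_inj (mulIg t)) /=; apply: eq_bigr => s _.
  by rewrite rmorphB /= map_polyX map_polyC apM.
have mp : p \is monic.
  by have := monic_prod_XsubC (index_enum gT) xpredT (fun s => ap s x);
    rewrite -/q Ep map_monic.
have qx : (map_poly f p).[x] = 0.
  apply/eqP; rewrite -Ep horner_prod; apply/prodf_eq0; exists 1%g => //.
  by rewrite ap1 hornerXsubC subrr.
pose m := (size p).-1; have sp : size p = m.+1 by rewrite /m polySpred // monic_neq0.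
have pm : p`_m = 1 by have /monicP := mp; rewrite lead_coefE.
have [N HN HNp] := common_denom (fun i : 'I_m.+1 => p`_i).
have Hint (i : nat) : (i <= m)%N -> (N%:R ^+ (m - i) * p`_i : rat) \in Num.int.
  rewrite leq_eqVlt => /orP[/eqP->|Hi]; first by rewrite subnn expr0 mul1r pm rpred1.
  have -> : (m - i = (m - i.+1).+1)%N by lia.
  rewrite exprSr -mulrA rpredM ?rpredX ?natr_int //.
  exact: (HNp (Ordinal (leqW Hi : i < m.+1)%N)).
(* The monic polynomial whose roots are [N] times those of [p]; the powers of [N] make its
   coefficients integral. *)
pose qz : {poly int} := \poly_(i < m.+1) Num.floor (N%:R ^+ (m - i) * p`_i : rat).
have qzE i : (i <= m)%N -> ((qz`_i)%:~R : rat) = N%:R ^+ (m - i) * p`_i.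
  by move=> Hi; rewrite coef_poly ltnS Hi floorK // Hint.
have qm : qz`_m = 1 by apply: (@intr_inj rat); rewrite qzE // subnn expr0 mul1r pm.
have szq : size qz = m.+1.
  apply/eqP; rewrite eqn_leq size_poly /= ltnNge; apply/negP => H.
  by move: qm; rewrite nth_default.
exists N => //; exists qz; first by apply/monicP; rewrite lead_coefE szq.
apply/eqP; rewrite (@horner_coef_wide _ m.+1); last by rewrite -szq size_map_poly_id0 ?leqnn // lead_coefE szq qm oner_neq0.
transitivity (N%:R ^+ m * (map_poly f p).[x]); last by rewrite qx mulr0.
rewrite (@horner_coef_wide _ m.+1 (map_poly f p)); last by rewrite size_map_poly sp.
rewrite mulr_sumr; apply: eq_bigr => i _; rewrite !coef_map /=.
have Hi : (i <= m)%N by rewrite -ltnS.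
rewrite -(rmorph_int f) qzE // rmorphM rmorphXn rmorph_nat exprMn.
have -> : N%:R ^+ m = N%:R ^+ (m - i) * N%:R ^+ i :> L by rewrite -exprD subnK.
by ring.
Qed.

Variables (P : nat) (eps : rat) (alpha theta : L) (x0 : nat).
Hypothesis P_gt1 : (1 < P)%N.
Hypothesis eps2 : eps * eps = 1.
Hypothesis normP : normL alpha = f (eps * P%:R).
Hypothesis x0P : coprime x0 P.
Hypothesis x0_gt0 : (0 < x0)%N.
Hypothesis Ealpha : alpha = 1 + x0%:R * theta.
Hypothesis theta_loc : locO P theta.
Hypothesis diff_loc : forall s, s != 1%g -> ap s theta != theta /\ locO P (ap s theta - theta)^-1.
Hypothesis conj_poly : forall s, exists h : {poly rat}, (forall i, locZ P h`_i) /\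
  ap s theta = (map_poly f h).[theta].
Notation R := (locO P).

Let eps_loc : R (f eps).
Proof.
have [->|->] : eps = 1 \/ eps = - 1.
- have : (eps - 1) * (eps + 1) == 0 by rewrite mulrDr mulrBl mulrBl eps2; apply/eqP; ring.
  by rewrite mulf_eq0 subr_eq0 addr_eq0 => /orP[/eqP|/eqP]; [left|right].
- by rewrite rmorph1; apply: locO1.
- by rewrite rmorphN1; apply/locON/locO1.
Qed.

Let P_neq0 : P%:R != 0 :> rat.
Proof. by rewrite pnatr_eq0 -lt0n; apply: leq_trans P_gt1. Qed.

Let fP_neq0 : f P%:R != 0. Proof. by rewrite fmorph_eq0. Qed.

Let eps_neq0 : eps != 0.
Proof. by apply: contraTneq (oner_neq0 rat) => E; rewrite -eps2 E mul0r eqxx. Qed.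

Lemma ap_alpha_neq0 s : ap s alpha != 0.
Proof.
rewrite fmorph_eq0; apply: contraTneq (mulf_neq0 eps_neq0 P_neq0) => E.
rewrite negbK -(fmorph_eq0 f) -normP /normL (bigD1 1%g) //= E rmorph0 mul0r.
by rewrite eqxx.
Qed.

Let alpha_neq0 : alpha != 0. Proof. by rewrite -(ap1 alpha) ap_alpha_neq0. Qed.

Let x0_neq0 : x0%:R != 0 :> L.
Proof. by rewrite -(rmorph_nat f) fmorph_eq0 pnatr_eq0 -lt0n. Qed.

Let x0V_loc : R (x0%:R^-1 : L).
Proof. by exists x0; split=> //; rewrite mulfV //; exact: (@algint_int L 1). Qed.

Let alpha_loc : R alpha.
Proof.
rewrite Ealpha; apply: locOD; first exact: locO1.
by apply: locOM => //; apply/locO_algint/algint_nat.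
Qed.

(** Up to sign the product of the other conjugates of [alpha]. Since it is invertible modulo
    [alpha], its powers may be multiplied in freely when integrality or divisibility is tested
    there. *)
Definition cofactor_alpha := f P%:R / alpha.
Notation alpha' := cofactor_alpha.

Lemma cofactorE : alpha' = f eps * \prod_(s | s != 1%g) ap s alpha.
Proof.
apply: (mulIf alpha_neq0); rewrite divfK // -mulrA.
have -> : \prod_(s | s != 1%g) ap s alpha * alpha = normL alpha.
  by rewrite /normL [RHS](bigD1 1%g) //= ap1 mulrC.
by rewrite normP -rmorphM mulrA eps2 mul1r.
Qed.

Lemma cofactor_loc : R alpha'.
Proof.
rewrite cofactorE; apply: locOM => //; apply: locO_prod => s _.
exact: locO_ap.
Qed.

Lemma cofactor_div_loc s : s != 1%g -> R (alpha' / ap s alpha).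
Proof.
move=> Hs; rewrite cofactorE (bigD1 s) //=.
have -> (a b e : L) : a != 0 -> b * (a * e) / a = b * e by move=> a0; field.
  by apply: locOM => //; apply: locO_prod => t _; apply: locO_ap.
exact: ap_alpha_neq0.
Qed.

Let telescope (a : gT -> L) (l : seq gT) u : (forall s, R (a s)) ->
  (forall s, R (u * (1 - a s))) -> R (u * (1 - \prod_(s <- l) a s)).
Proof.
move=> Ha Hu; elim: l => [|s l IH]; first by rewrite big_nil subrr mulr0; apply: locO0.
rewrite big_cons; set B := \prod_(_ <- _) _ in IH *.
have -> : u * (1 - a s * B) = u * (1 - B) + B * (u * (1 - a s)) by ring.
apply: locOD => //; apply: locOM => //.
exact: locO_prod.
Qed.

(* Multiplying over all conjugates turns [alpha w] into a multiple of [P]. *)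
Lemma locZ_core u w : R w -> R (f u * (1 - alpha * w)) -> locZ P u.
Proof.
move=> Hw Hu; have H s : R (f u * (1 - ap s alpha * ap s w)).
  by have := locO_ap (ap s) Hu; rewrite !rmorphM rmorphB rmorph1 rmorphM /= ap_rat.
have Ha s : R (ap s alpha * ap s w) by apply: locOM; apply: locO_ap.
have := @telescope (fun s => ap s alpha * ap s w) (index_enum gT) (f u) Ha H.
rewrite big_split /= -[\prod_s ap s alpha]/(normL alpha) -[\prod_s ap s w]/(normL w) normP.
have [W0 EW] := normL_rat w.
have [b [Hb Hn]] : locZ P W0.
  by apply/(locO_rat f); rewrite -EW; apply: locO_prod => s _; apply: locO_ap.
rewrite EW -rmorphM -(rmorph1 f) -rmorphB -rmorphM => K.
have {K} [c [Hc Hz]] : locZ P (u * (1 - eps * P%:R * W0)).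
  by apply/(locO_rat f); exact: K.
have /intrP[e He] : eps \in Num.int.
  suff [->|->] : eps = 1 \/ eps = - 1 by rewrite ?rpredN rpred1.
  have : (eps - 1) * (eps + 1) == 0.
    by have -> : (eps - 1) * (eps + 1) = eps * eps - 1 by [ring]; rewrite eps2 subrr.
  by rewrite mulf_eq0 subr_eq0 addr_eq0 => /orP[/eqP|/eqP]; [left|right].
have /intrP[w0 Hw0] := Hn; have /intrP[z Ez] := Hz.
(* [b] times 1 - eps P W0 is this integer, which is prime to [P] because [b] is. *)
pose n : int := b%:Z - e * P%:Z * w0.
have En : n%:~R = b%:R * (1 - eps * P%:R * W0) :> rat.
  by rewrite /n rmorphB !rmorphM /= -He -Hw0 -!pmulrn; ring.
have Hcop : coprime `|n| P.
  have : coprimez n P.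
    rewrite /n coprimez_sym; apply/coprimezP.
    have /coprimezP[[a1 a2] /= E12] : coprimez b%:Z P%:Z by [].
    by exists (a2 + a1 * (e * w0), a1) => /=; rewrite -E12; ring.
  by [].
exists (`|n| * c)%N; rewrite coprimeMl Hcop Hc; split=> //.
rewrite natrM natr_absz intr_norm.
have [->|->] : `|n%:~R : rat| = n%:~R \/ `|n%:~R : rat| = - n%:~R.
- by case: (lerP 0 (n%:~R : rat)) => H0; [left; rewrite ger0_norm | right; rewrite ltr0_norm].
- have -> : n%:~R * c%:R * u = b%:R * (c%:R * (u * (1 - eps * P%:R * W0))) by rewrite En; ring.
  by rewrite rpredM // natr_int.
- have -> : - n%:~R * c%:R * u = - (b%:R * (c%:R * (u * (1 - eps * P%:R * W0)))) by rewrite En; ring.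
  by rewrite rpredN rpredM // natr_int.
Qed.

(** Each s(alpha) differs from [alpha] by x0 (s(theta) - theta), a unit at [P], so it is invertible
    modulo [alpha]; the inverses are multiplied over all s other than 1. *)
Lemma cofactor_comax : exists v w, [/\ R v, R w & alpha' * v = 1 + alpha * w].
Proof.
pose g s := (x0%:R * (ap s theta - theta))^-1.
have Hg s : s != 1%g -> R (g s) /\ g s * ap s alpha = 1 + alpha * g s.
  move=> /diff_loc[H0 Hd]; split; first by rewrite /g invfM; apply: locOM.
  have d0 : x0%:R * (ap s theta - theta) != 0 by rewrite mulf_neq0 // subr_eq0.
  rewrite {1}Ealpha rmorphD rmorph1 rmorphM rmorph_nat.
  have -> : 1 + x0%:R * ap s theta = alpha + x0%:R * (ap s theta - theta).
    by rewrite Ealpha; ring.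
  by rewrite mulrDr /g mulVf // addrC [alpha * _]mulrC.
have [w [Hw Ew]] : exists w, R w /\ \prod_(s | s != 1%g) (g s * ap s alpha) = 1 + alpha * w.
  apply: (big_ind (fun p => exists w, R w /\ p = 1 + alpha * w)) => [|x y [w1 [Hw1 ->]] [w2 [Hw2 ->]]|s /Hg[H1 H2]].
  - by exists 0; split; [exact: locO0 | rewrite mulr0 addr0].
  - exists (w1 + w2 + alpha * (w1 * w2)); split; last by ring.
    apply: locOD; first exact: locOD.
    by apply: locOM => //; apply: locOM.
  - by exists (g s).
exists (f eps * \prod_(s | s != 1%g) g s), w; split=> //.
  by apply: locOM => //; apply: locO_prod => s /Hg[].
rewrite cofactorE -Ew big_split /=.
have -> (a b e : L) : e * a * (e * b) = (e * e) * (b * a) by ring.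
by rewrite -rmorphM eps2 rmorph1 mul1r.
Qed.

Let comaxX k : exists v w, [/\ R v, R w & alpha' ^+ k * v = 1 + alpha * w].
Proof.
have [v [w [Hv Hw E]]] := cofactor_comax; elim: k => [|k [v' [w' [Hv' Hw' E']]]].
  by exists 1, 0; split; [exact: locO1 | exact: locO0 | rewrite expr0 mulr0 addr0 mulr1].
exists (v * v'), (w + w' + alpha * (w * w')); split; first exact: locOM.
  by apply: locOD; [exact: locOD | apply: locOM => //; exact: locOM].
by rewrite exprS mulrACA E E'; ring.
Qed.

Let comaxXX k l : exists v w, [/\ R v, R w & alpha' ^+ k * v = 1 + alpha ^+ l * w].
Proof.
have [v [w [Hv Hw E]]] := comaxX k.
elim: l => [|l [v' [w' [Hv' Hw' E']]]].
  exists v, (alpha * w); split=> //; first exact: locOM.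
  by rewrite expr0 mul1r.
exists (v + v' - alpha' ^+ k * (v * v')), (- (w * w')); split.
- apply: locOB; first exact: locOD.
  by apply: locOM; [apply/locOX/cofactor_loc | apply: locOM].
- by apply/locON/locOM.
- have -> : alpha' ^+ k * (v + v' - alpha' ^+ k * (v * v')) =
     1 - (alpha' ^+ k * v - 1) * (alpha' ^+ k * v' - 1) by ring.
  by rewrite E E' exprS; ring.
Qed.

(** A multiple of alpha'^c is 1 + alpha w, so u (1 + alpha w) is integral, and [locZ_core] removes
    the second factor. *)
Lemma locZ_of_cofactor u c : R (alpha' ^+ c * f u) -> locZ P u.
Proof.
move=> Hu; have [v [w [Hv Hw E]]] := comaxX c.
apply: (@locZ_core u (- w)); first exact: locON.
by rewrite mulrN opprK -E mulrC mulrAC; apply: locOM.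
Qed.

Lemma locZ_of_power u k r : R r -> f u = alpha ^+ k * r -> locZ P (u / P%:R ^+ k).
Proof.
move=> Hr E; apply: (@locZ_of_cofactor _ k).
rewrite rmorphM fmorphV rmorphXn /= E /cofactor_alpha expr_div_n.
have -> : f P%:R ^+ k / alpha ^+ k * (alpha ^+ k * r / f P%:R ^+ k) = r; last by [].
by field; rewrite !expf_neq0.
Qed.

Definition approx k u := exists q r, [/\ locZ P q, R r & u = f q + alpha ^+ k * r].

Lemma approx_rat k q : locZ P q -> approx k (f q).
Proof. by move=> Hq; exists q, 0; split=> //; [exact: locO0 | rewrite mulr0 addr0]. Qed.

Lemma approxD k u v : approx k u -> approx k v -> approx k (u + v).
Proof.
move=> [q [r [Hq Hr ->]]] [q' [r' [Hq' Hr' ->]]]; exists (q + q'), (r + r').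
by split; [exact: locZD | exact: locOD | rewrite rmorphD; ring].
Qed.

Lemma approxM k u v : approx k u -> approx k v -> approx k (u * v).
Proof.
move=> [q [r [Hq Hr ->]]] [q' [r' [Hq' Hr' ->]]].
exists (q * q'), (f q * r' + f q' * r + alpha ^+ k * (r * r')); split.
- exact: locZM.
- apply: locOD; last by apply: locOM; [exact: locOX | exact: locOM].
  by apply: locOD; apply: locOM => //; apply/locO_rat.
- by rewrite rmorphM; ring.
Qed.

Lemma approx_horner k (h : {poly rat}) u : (forall i, locZ P h`_i) -> approx k u ->
  approx k (map_poly f h).[u].
Proof.
move=> Hh Hu; rewrite horner_coef; apply: (big_ind (approx k)).
- by rewrite -(rmorph0 f); apply/approx_rat/locZ_int/rpred0.
- exact: approxD.
- move=> i _; rewrite coef_map; apply: approxM; first exact: approx_rat.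
  elim: (i : nat) => [|j IH]; last by rewrite exprS; apply: approxM.
  by rewrite expr0 -(rmorph1 f); apply/approx_rat/locZ_int/rpred1.
Qed.

(** A bootstrap through P = alpha alpha'. The cofactor is a polynomial in [theta], so modulo
    alpha^(k+1) it is a rational number n, and n is a unit at [P]. Then alpha is P / n modulo
    alpha^(k+2), which gains one power for theta = (alpha - 1) / x0. *)
Lemma approx_theta k : approx k theta.
Proof.
elim: k => [|k IH].
  exists 0, theta; split=> //; first exact/locZ_int/rpred0.
  by rewrite rmorph0 expr0 add0r mul1r.
have x0Vq : locZ P (x0%:R^-1).
  by apply/(locO_rat f); rewrite fmorphV rmorph_nat.
case: k IH => [_|k IH].
  exists (- x0%:R^-1), (x0%:R^-1); split=> //; first exact: locZN.
  by rewrite expr1 Ealpha rmorphN fmorphV rmorph_nat; field.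
have [v [w [Hv Hw E]]] := cofactor_comax.
have [n [r [Hn Hr En]]] : approx k.+1 alpha'.
  rewrite cofactorE; apply: approxM.
    by apply: approx_rat; apply/(locO_rat f).
  apply: (big_ind (approx k.+1)).
  - by rewrite -(rmorph1 f); apply/approx_rat/locZ_int/rpred1.
  - exact: approxM.
  - move=> s _; rewrite Ealpha rmorphD rmorph1 rmorphM rmorph_nat; apply: approxD.
      by rewrite -(rmorph1 f); apply/approx_rat/locZ_int/rpred1.
    apply: approxM.
      by rewrite -(rmorph_nat f); apply/approx_rat/locZ_int/natr_int.
    by have [h [Hh ->]] := conj_poly s; apply: approx_horner.
pose w2 := alpha ^+ k * (r * v) - w.
have Hw2 : R w2 by apply: locOB => //; apply: locOM; [exact: locOX | exact: locOM].
have Env : f n * v = 1 - alpha * w2.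
  have -> : f n = alpha' - alpha ^+ k.+1 * r by rewrite En addrK.
  by rewrite mulrBl E /w2 exprS; ring.
have n0 : n != 0.
  apply: contraTneq P_gt1 => n0; rewrite n0 rmorph0 mul0r in Env.
  have [b [Hb]] : locZ P (P%:R^-1).
    by apply: (locZ_core Hw2); rewrite -Env mulr0; apply: locO0.
  case/intrP=> z Hz; have E2 : b%:Z = z * P%:Z.
    by apply: (@intr_inj rat); rewrite intrM -Hz -!pmulrn divfK.
  have : (P %| b)%N.
    by have := congr1 absz E2; rewrite abszM /= => ->; rewrite dvdn_mull.
  move=> /gcdn_idPr; rewrite gcdnC => HP; move: Hb; rewrite /coprime gcdnC HP => /eqP ->.
  by [].
have Hn1 : locZ P n^-1.
  apply: (locZ_core Hw2); rewrite -Env mulrA -rmorphM mulVf // rmorph1 mul1r //.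
have fn0 : f n != 0 by rewrite fmorph_eq0.
exists ((P%:R / n - 1) / x0%:R), (- (r / (f n * x0%:R))); split.
- apply: locZM => //; apply: locZD; last by apply/locZ_int; rewrite rpredN rpred1.
  by apply: locZM => //; apply/locZ_int/natr_int.
- apply: locON; rewrite invfM; apply: locOM => //; apply: locOM => //.
  by rewrite -fmorphV; apply/locO_rat.
- have -> : theta = (alpha - 1) / x0%:R by rewrite Ealpha; field.
  have EP : alpha = f P%:R / f n - alpha ^+ k.+2 * r / f n.
    have -> : f P%:R = alpha * (f n + alpha ^+ k.+1 * r).
      by rewrite -En /cofactor_alpha mulrC divfK.
    by rewrite [alpha ^+ k.+2]exprS; field.
  rewrite {1}EP rmorphM rmorphB rmorph1 rmorphM !fmorphV !rmorph_nat.
  by field; rewrite x0_neq0.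
Qed.

(** Comaximality removes the powers of [alpha'], so [u] is divisible by all powers of [alpha], and
    the norm of an integral multiple of [u] by all powers of [P]. *)
Lemma infinitely_divisible u :
  (forall k, exists c r, R r /\ alpha' ^+ c * u = alpha ^+ k * r) -> u = 0.
Proof.
move=> Hu; have [D HD HDu] := algint_multiple u.
have D0 : D%:R != 0 :> L by rewrite -(rmorph_nat f) fmorph_eq0 pnatr_eq0 -lt0n.
suff E : normL (D%:R * u) = 0.
  by move/eqP: (normL_eq0 E); rewrite mulf_eq0 (negbTE D0) => /eqP.
have [q Eq] := normL_rat (D%:R * u); rewrite Eq.
suff -> : q = 0 by rewrite rmorph0.
apply: (locZ_divisible P_gt1) => k.
have [c [r [Hr Er]]] := Hu k; have [v [w [Hv Hw E]]] := comaxXX c k.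
have EDu : D%:R * u = alpha ^+ k * (v * (D%:R * r) - w * (D%:R * u)).
  have -> : alpha ^+ k * (v * (D%:R * r) - w * (D%:R * u)) =
    v * D%:R * (alpha ^+ k * r) - alpha ^+ k * w * (D%:R * u) by ring.
  rewrite -Er; have -> : v * D%:R * (alpha' ^+ c * u) = (alpha' ^+ c * v) * (D%:R * u) by ring.
  by rewrite E; ring.
have HR : R (v * (D%:R * r) - w * (D%:R * u)).
  apply: locOB; apply: locOM => //; last exact: locO_algint.
  by apply: locOM => //; apply/locO_algint/algint_nat.
apply/(locO_rat f); rewrite rmorphM -Eq EDu /normL.
under eq_bigr => s _ do rewrite rmorphM rmorphXn.
rewrite big_split prodrXl -[\prod_s ap s alpha]/(normL alpha) normP.
rewrite fmorphV rmorphXn /= rmorphM exprMn mulrAC mulfK ?expf_neq0 //.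
apply: locOM; first exact: locOX.
by apply: locO_prod => s _; apply: locO_ap.
Qed.

(** The denominator is inverted modulo P^k, which is a multiple of alpha^k. *)
Lemma integer_residue k q : locZ P q -> exists (z : int) r, R r /\ f q = z%:~R + alpha ^+ k * r.
Proof.
move=> [b [Hb /intrP[a Ha]]].
have Hbk : coprimez b%:Z (P ^ k)%N%:Z by rewrite /coprimez /= -[gcdz _ _]/(gcdn b (P ^ k))%:Z; apply: coprimeXr.
have /coprimezP[[u v] /= E] := Hbk.
have b0 : b%:R != 0 :> rat.
  by rewrite pnatr_eq0; apply: contraTneq Hb => ->; rewrite /coprime gcd0n gtn_eqF.
exists (a * u), (alpha' ^+ k * f (v%:~R * q)); split.
  apply: locOM; first exact/locOX/cofactor_loc.
  by apply/locO_rat; apply: locZM; [apply/locZ_int/intr_int | exists b; rewrite Ha; split=> //; apply: intr_int].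
have -> : alpha ^+ k * (alpha' ^+ k * f (v%:~R * q)) = f (P%:R ^+ k * v%:~R * q).
  have Eaa : alpha * alpha' = f P%:R by rewrite /cofactor_alpha mulrC divfK.
  by rewrite mulrA -exprMn Eaa -rmorphXn -rmorphM mulrA.
rewrite -(rmorph_int f) -rmorphD; congr (f _).
have : (u * b%:Z + v * (P ^ k)%N%:Z)%:~R = 1 :> rat by rewrite E.
rewrite !rmorphD !rmorphM /= -Ha -!pmulrn natrX => E2.
have E3 : q = (u%:~R * b%:R + v%:~R * P%:R ^+ k) * q by rewrite E2 mul1r.
by rewrite {1}E3; ring.
Qed.

Lemma approx_theta_int k : exists (z : int) r, R r /\ theta = z%:~R + alpha ^+ k * r.
Proof.
have [q [r [Hq Hr E]]] := approx_theta k; have [z [r' [Hr' E']]] := integer_residue k Hq.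
exists z, (r' + r); split; first exact: locOD.
by rewrite E E'; ring.
Qed.

Lemma horner_residue k (z : int) r (h : {poly rat}) : R r -> theta = z%:~R + alpha ^+ k * r ->
  (forall i, locZ P h`_i) ->
  exists2 r', R r' & (map_poly f h).[theta] = f h.[z%:~R] + alpha ^+ k * r'.
Proof.
move=> Hr E Hh; rewrite horner_coef size_map_poly (horner_coef h).
apply: (big_ind2 (fun x y => exists2 r', R r' & x = f y + alpha ^+ k * r')).
- by exists 0; [exact: locO0 | rewrite rmorph0 mulr0 addr0].
- move=> _ y _ y' [r1 H1 ->] [r2 H2 ->]; exists (r1 + r2); first exact: locOD.
  by rewrite rmorphD; ring.
- move=> i _; rewrite coef_map rmorphM /=.
  have [r1 H1 ->] : exists2 r1, R r1 & theta ^+ i = f (z%:~R ^+ i) + alpha ^+ k * r1.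
    elim: (i : nat) => [|j [r1 H1 E1]].
      by exists 0; [exact: locO0 | rewrite !expr0 rmorph1 mulr0 addr0].
    exists (z%:~R * r1 + r * theta ^+ j).
      apply: locOD; apply: locOM => //; last exact: locOX.
      exact/locO_algint/algint_int.
    rewrite exprS {1}E mulrDl -mulrA; rewrite {1}E1 exprS rmorphM rmorph_int; ring.
  exists (f h`_i * r1); last by ring.
  by apply: locOM => //; apply/locO_rat.
Qed.

Definition matO m n (X : 'M[L]_(m, n)) := forall i j, R (X i j).
Definition matZ m n (X : 'M[rat]_(m, n)) := forall i j, locZ P (X i j).

Lemma matO_map m n (X : 'M[rat]_(m, n)) : matO (map_mx f X) <-> matZ X.
Proof. by split=> H i j; have := H i j; rewrite mxE; move/(locO_rat f). Qed.

Lemma matOD m n (X Y : 'M[L]_(m, n)) : matO X -> matO Y -> matO (X + Y).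
Proof. by move=> HX HY i j; rewrite mxE; apply: locOD. Qed.

Lemma matOZ m n a (X : 'M[L]_(m, n)) : R a -> matO X -> matO (a *: X).
Proof. by move=> Ha HX i j; rewrite mxE; apply: locOM. Qed.

Lemma matON m n (X : 'M[L]_(m, n)) : matO X -> matO (- X).
Proof. by move=> HX i j; rewrite mxE; apply: locON. Qed.

Lemma matOM m n p (X : 'M[L]_(m, n)) (Y : 'M[L]_(n, p)) : matO X -> matO Y -> matO (X *m Y).
Proof. by move=> HX HY i j; rewrite mxE; apply: locO_sum => k _; apply: locOM. Qed.

Lemma matO_sum m n I (r : seq I) (Q : pred I) (X : I -> 'M[L]_(m, n)) :
  (forall i, Q i -> matO (X i)) -> matO (\sum_(i <- r | Q i) X i).
Proof. by move=> HX i j; rewrite summxE; apply: locO_sum => k Hk; apply: HX. Qed.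

(** * Separating the negative weights at one modulus *)

Section LocalSplitting.
Variables (d : nat) (A : 'M[rat]_d) (s : seq L) (prj : L -> 'M[L]_d).
Hypothesis Hsp : spectral (map_mx f A) s prj.
Hypothesis Hprj : forall l, l \in s -> matO (prj l).
Variables (t : L -> L) (eta : L -> int) (c : nat).
Hypothesis t0 : forall l, l \in s -> t l != 0.
Hypothesis t_nneg : forall l, l \in s -> 0 <= eta l -> R (alpha' ^+ c * t l).
Hypothesis t_neg : forall l, l \in s -> eta l < 0 ->
  exists2 r, R r & alpha' ^+ c * (t l)^-1 = alpha * r.
Hypothesis t_bnd : forall l, l \in s ->
  R (f P%:R ^+ c * t l) /\ R (f P%:R ^+ c * (t l)^-1).
Variables (F Fi : 'M[rat]_d).
Hypothesis EF : map_mx f F = spectral_fun s prj t.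
Hypothesis EFi : map_mx f Fi = spectral_fun s prj (fun l => (t l)^-1).
Let neg (l : L) : L := if eta l < 0 then 1 else 0.
Variables (rr : nat) (b : 'I_rr -> L) (h : 'I_rr -> {poly rat}) (E : 'I_rr -> 'M[rat]_d).
Hypothesis Eneg : spectral_fun s prj neg = \sum_k b k *: map_mx f (E k).
Hypothesis Eb : forall k, b k = (map_poly f (h k)).[theta].
Hypothesis Hh : forall k i, locZ P (h k)`_i.
Hypothesis HE : forall k, matZ (E k).

Let spectral_loc g : (forall l, l \in s -> R (g l)) -> matO (spectral_fun s prj g).
Proof.
by move=> Hg; rewrite /spectral_fun big_seq; apply: matO_sum => l Hl; apply: matOZ; auto.
Qed.

Let Eaa : alpha * alpha' = f P%:R.
Proof. by rewrite /cofactor_alpha mulrC divfK. Qed.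

Let mat_cofactor m n (X : 'M[rat]_(m, n)) k : matO (alpha' ^+ k *: map_mx f X) -> matZ X.
Proof. by move=> HX i j; apply: (@locZ_of_cofactor _ k); have := HX i j; rewrite !mxE. Qed.

Let mat_power m n (X : 'M[rat]_(m, n)) k (Y : 'M[L]_(m, n)) : matO Y ->
  map_mx f X = alpha ^+ k *: Y -> matZ (P%:R ^- k *: X).
Proof.
move=> HY EX i j; rewrite mxE mulrC; apply: (@locZ_of_power _ k (Y i j)) => //.
by have /matrixP/(_ i j) := EX; rewrite !mxE.
Qed.

(* Specializing [theta] to an integer congruent to it modulo a high power of
   [alpha] turns the projection onto the negative weights into a rational
   matrix that is an approximate projection at [P]. *)
Lemma local_splitting M k0 : exists z : int, let e := \sum_k (h k).[z%:~R] *: E k in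
  [/\ forall i, (i <= k0)%N -> matZ (iter i (mulmxr Fi) e), matZ ((1%:M - e) *m F)
    & matZ (P%:R ^- M *: (e *m e - e))].
Proof.
(* The precision: [M] for the idempotency, and [c] for each of the at most [k0] factors [Fi], or for
   the single factor [F], whose denominators must be absorbed. *)
pose M' := (M + c * k0.+1)%N.
have [z [r [Hr Ez]]] := approx_theta_int M'; exists z; set e := \sum_k _.
have Hres k : exists r', R r' /\ b k = f (h k).[z%:~R] + alpha ^+ M' * r'.
  by have [r' H1 H2] := horner_residue Hr Ez (Hh k); exists r'; rewrite Eb.
pose X := \sum_k sval (cid (Hres k)) *: map_mx f (E k).
have HX : matO X.
  apply: matO_sum => k _; apply: matOZ; first by case: cid => r' [].
  exact/matO_map.
pose EN := spectral_fun s prj neg.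
have Ee : map_mx f e = EN - alpha ^+ M' *: X.
  rewrite /EN Eneg /X scaler_sumr -sumrB map_mx_sum; apply: eq_bigr => k _.
  case: cid => r' [_ /= ->]; rewrite map_mxZ scalerA -scalerBl; congr (_ *: _).
  by rewrite addrK.
have ENloc : matO EN.
  by apply: spectral_loc => l _; rewrite /neg; case: ifP => _; [exact: locO1 | exact: locO0].
have idem : EN *m EN = EN.
  rewrite /EN (spectral_funM Hsp); apply: eq_spectral_fun => l _.
  by rewrite /neg; case: ifP; rewrite ?mulr1 ?mulr0.
have iterM p (B : 'M[L]_d) (v : 'M[L]_(p, d)) i :
    iter i (mulmxr B) v = v *m iter i (mulmxr B) 1%:M.
  by elim: i => [|i IH] /=; rewrite ?mulmx1 // IH mulmxA.
have mapI i : map_mx f (iter i (mulmxr Fi) e) =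
    map_mx f e *m spectral_fun s prj (fun l => (t l)^-1 ^+ i).
  rewrite -(spectral_fun_iter Hsp) -EFi -iterM; elim: i => //= i IH.
  by rewrite map_mxM IH.
have sfZ a g : a *: spectral_fun s prj g = spectral_fun s prj (fun l => a * g l).
  by rewrite /spectral_fun scaler_sumr; apply: eq_bigr => l _; rewrite scalerA.
have cofR := cofactor_loc.
split.
(* Rational matrices may be tested after multiplication by powers of [alpha']. These make the
   negative part integral by [t_neg]; in the error term they combine with powers of [alpha] into
   powers of [P]. *)
- move=> i Hi; apply: (@mat_cofactor _ _ _ (c * i)); rewrite mapI Ee mulmxBl scalerBr.
  apply: matOD; last apply: matON.
    rewrite /EN (spectral_funM Hsp) sfZ; apply: spectral_loc => l Hl; rewrite /neg.
    case: ifP => Hn; last by rewrite mul0r mulr0; apply: locO0.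
    rewrite mul1r exprM -exprMn; have [r' Hr' ->] := t_neg Hl Hn.
    by apply/locOX/locOM.
  rewrite -scalemxAl scalerA scalemxAr sfZ; apply: matOM => //; apply: spectral_loc => l Hl.
  have -> : alpha' ^+ (c * i) * alpha ^+ M' * (t l)^-1 ^+ i =
      alpha ^+ (M' - c * i) * (f P%:R ^+ c * (t l)^-1) ^+ i.
    have -> : M' = (M' - c * i + c * i)%N by rewrite /M'; nia.
    rewrite addnK exprD [in RHS]exprMn -exprM -Eaa [in RHS]exprMn.
    by rewrite !mulrA; congr (_ * _); rewrite -!mulrA mulrC -mulrA.
  by apply: locOM; [exact: locOX | apply/locOX; case: (t_bnd Hl)].
- apply: (@mat_cofactor _ _ _ c); rewrite map_mxM map_mxB map_mx1 Ee EF.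
  rewrite opprB addrA addrAC mulmxDl scalerDr; apply: matOD.
    rewrite -(spectral_fun1 Hsp) /EN.
    have -> : spectral_fun s prj (fun=> 1) - spectral_fun s prj neg =
        spectral_fun s prj (fun l => 1 - neg l).
      by rewrite /spectral_fun -sumrB; apply: eq_bigr => l _; rewrite scalerBl.
    rewrite (spectral_funM Hsp) sfZ; apply: spectral_loc => l Hl; rewrite /neg.
    case: ltP => Hn; first by rewrite subrr mul0r mulr0; apply: locO0.
    by rewrite subr0 mul1r; apply: t_nneg.
  rewrite -scalemxAl scalerA scalemxAr sfZ; apply: matOM => //; apply: spectral_loc => l Hl.
  have -> : alpha' ^+ c * alpha ^+ M' * t l = alpha ^+ (M' - c) * (f P%:R ^+ c * t l).
    have -> : M' = (M' - c + c)%N by rewrite /M'; nia.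
    rewrite addnK exprD -Eaa [in RHS]exprMn.
    by rewrite !mulrA; congr (_ * _); rewrite -!mulrA mulrC -mulrA.
  by apply: locOM; [exact: locOX | case: (t_bnd Hl)].
- apply: (@mat_power _ _ _ _ (alpha ^+ (M' - M) *: (X - EN *m X - X *m EN + alpha ^+ M' *: (X *m X)))).
    apply: matOZ; first exact: locOX.
    apply: matOD; last by apply: matOZ; [exact: locOX | apply: matOM].
    by apply: matOD; [apply: matOD => //|]; apply/matON/matOM.
  rewrite scalerA -exprD subnKC; last by rewrite /M' leq_addr.
  rewrite map_mxB map_mxM Ee mulmxBl !mulmxBr idem -!scalemxAl -!scalemxAr.
  rewrite !(scalerDr, scalerN).
  set a := alpha ^+ M'; set u := a *: X; set v := a *: (EN *m X); set w := a *: (X *m EN).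
  set y := a *: (a *: (X *m X)).
  by clearbody EN u v w y; clear; apply/matrixP => i j; rewrite !mxE; ring.
Qed.

(** The component of [v] at [l] is t^-k times that of its k-th iterate, whose denominators are
    bounded, and each factor 1/t contributes one [alpha] up to powers of [alpha']. *)
Lemma negative_weight_divisible (v : 'rV[rat]_d) K : (0 < K)%N ->
  (forall i, latt 1 K (iter i (mulmxr F) v)) ->
  forall l, l \in s -> eta l < 0 -> map_mx f v *m prj l = 0.
Proof.
move=> HK Hv l Hl Hn; apply/rowP => j; rewrite [RHS]mxE.
have K0 : K%:R != 0 :> L by rewrite -(rmorph_nat f) fmorph_eq0 pnatr_eq0 -lt0n.
suff : K%:R * (map_mx f v *m prj l) 0 j = 0.
  by move=> /eqP; rewrite mulf_eq0 (negbTE K0) => /eqP.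
apply: infinitely_divisible => k.
have Ev : map_mx f (iter k (mulmxr F) v) *m prj l = t l ^+ k *: (map_mx f v *m prj l).
  elim: k => [|k IH]; first by rewrite expr0 scale1r.
  by rewrite /= map_mxM EF -mulmxA (spectral_fun_prj Hsp) // -scalemxAr IH scalerA -exprS.
have {Ev} -> : map_mx f v *m prj l = (t l)^-1 ^+ k *: (map_mx f (iter k (mulmxr F) v) *m prj l).
  by rewrite Ev scalerA -exprMn mulVf ?t0 // expr1n scale1r.
have [r Hr Er] := t_neg Hl Hn.
exists (c * k)%N, (r ^+ k * (K%:R *: (map_mx f (iter k (mulmxr F) v)) *m prj l) 0 j); split.
  apply: locOM; first exact: locOX.
  apply: matOM => [i' j'|]; last exact: Hprj.
  rewrite !mxE -(rmorph_nat f) -rmorphM; apply/(locO_rat f)/locZ_int.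
  by have := Hv k j'; rewrite divr1 (ord1 i').
rewrite -scalemxAl !mxE; set S := \sum_(_ | _) _.
have -> : alpha' ^+ (c * k) * (K%:R * ((t l)^-1 ^+ k * S)) = (alpha' ^+ c * (t l)^-1) ^+ k * (K%:R * S).
  rewrite exprM [(_ * (t l)^-1) ^+ k]exprMn -[in RHS]mulrA; congr (_ * _).
  by rewrite mulrCA.
by rewrite Er exprMn; ring.
Qed.

End LocalSplitting.

End LocalArithmetic.

(** * The expanding automorphism of a derivation *)

Lemma galois_data (p : {poly rat}) : p \is monic ->
  exists (L : fieldType) (f : {rmorphism rat -> L}) (gT : finGroupType)
    (ap : gT -> {rmorphism L -> L}) (theta : L) (r : seq L) (y : L -> rat),
  [/\ (forall s t x, ap (s * t)%g x = ap t (ap s x)) /\ (forall x, ap 1%g x = x),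
      (forall x, (forall s, ap s x = x) -> exists q, x = f q) /\
        (forall s, ap s theta = theta -> s = 1%g),
      map_poly f p = \prod_(z <- r) ('X - z%:P),
      [/\ theta != 0, algint theta & forall x, exists g : {poly rat}, x = (map_poly f g).[theta]]
    & [/\ forall u v, y (u + v) = y u + y v, forall l, l \in r -> y l \in Num.int
      & forall l, l \in r -> l != 0 -> y l != 0]].
Proof.
move=> mp; have [L [theta [r [Hr th0 Hgen Hfix Hinj]]]] := galois_splitting mp.
pose f : {rmorphism rat -> L} := in_alg L.
pose ap (s : gal_of {:L}) : {rmorphism L -> L} := s.
have apM s t x : ap (s * t)%g x = ap t (ap s x) by apply: galM; apply: memvf.
have ap1 x : ap 1%g x = x by apply: gal_id.
have [n n0 Hn] := algint_multiple (f := f) apM ap1 Hfix theta.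
have [|phi [phi1 _ phi2]] := @functional_avoid L 0%VS [seq l <- r | l != 0].
  by move=> v; rewrite mem_filter memv0 => /andP[].
have phiD u v : phi (u + v) = phi u + phi v by rewrite -(scale1r u) phi1 mul1r scale1r.
have [M M0 HM] : exists2 M : nat, (0 < M)%N & forall l, l \in r -> M%:R * phi l \in Num.int.
  elim: (r) => [|l r' [M M0 HM]]; first by exists 1%N.
  pose k := `|denq (phi l)|%N.
  have k0 : (0 < k)%N by rewrite absz_gt0 denq_neq0.
  exists (k * M)%N; first by rewrite muln_gt0 k0.
  move=> l'; rewrite inE natrM => /orP[/eqP->|/HM H]; last by rewrite -mulrA rpredM // rpred_nat.
  rewrite mulrAC rpredM ?rpred_nat // /k pmulrn gez0_abs ?denq_ge0 //.
  by rewrite mulrC -numqE intr_int.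
have n1 : n%:R != 0 :> rat by rewrite pnatr_eq0 -lt0n.
have fn1 : f n%:R != 0 by rewrite fmorph_eq0.
(* [n] makes the generator an algebraic integer, and [M] makes the functional integral on the
   eigenvalues. *)
exists L, f, (gal_of {:L}), ap, (n%:R * theta), r, (fun l => M%:R * phi l); split=> //.
- split=> // s; rewrite rmorphM rmorph_nat -(rmorph_nat f) => /(mulfI fn1) E.
  by apply: Hinj; rewrite gal_id.
- split=> //; first by rewrite mulf_neq0 // -(rmorph_nat f).
  move=> x; have [g ->] := Hgen x; exists (g \Po (n%:R^-1 *: 'X)).
  rewrite map_comp_poly map_polyZ map_polyX horner_comp hornerZ hornerX fmorphV.
  by rewrite rmorph_nat mulKf // -(rmorph_nat f).
- split=> // [u v|l Hl l0]; first by rewrite phiD mulrDr.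
  by rewrite mulf_neq0 ?pnatr_eq0 -?lt0n // phi2 // mem_filter l0.
Qed.

Section NormPrimes.
Variables (L : fieldType) (f : {rmorphism rat -> L}) (gT : finGroupType).
Variable ap : gT -> {rmorphism L -> L}.
Hypothesis apM : forall s t x, ap (s * t)%g x = ap t (ap s x).
Hypothesis ap1 : forall x, ap 1%g x = x.
Hypothesis apfix : forall x, (forall s, ap s x = x) -> exists q, x = f q.
Variable theta : L.
Hypothesis theta0 : theta != 0.
Hypothesis theta_int : algint theta.

(** [P] is the absolute value of the norm and [eps] its sign. Since [N] divides [x], the generator
    is 1 modulo [N] and [P] is prime to [N]. *)
Record norm_modulus (N x P : nat) (eps : rat) : Prop := NormModulus {
  modulus_gt1 : (1 < P)%N;
  modulus_eps : eps * eps = 1;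
  modulus_norm : normL ap (1 + x%:R * theta) = f (eps * P%:R);
  modulus_coprime : coprime x P;
  modulus_pos : (0 < x)%N;
  modulus_dvd : (N %| x)%N }.

Lemma norm_one_plus (x : nat) : exists2 a : L, algint a & normL ap (1 + x%:R * theta) = 1 + x%:R * a.
Proof.
rewrite /normL; apply: (big_ind (fun u : L => exists2 a : L, algint a & u = 1 + x%:R * a)).
- by exists 0; [exact: (algint_int L 0) | rewrite mulr0 addr0].
- move=> _ _ [a Ha ->] [b Hb ->]; exists (a + b + x%:R * (a * b)); last by ring.
  by apply: algintD; [exact: algintD | apply: algintM; [exact: algint_nat | exact: algintM]].
- move=> s _; exists (ap s theta); first exact: algint_ap.
  by rewrite rmorphD rmorph1 rmorphM rmorph_nat.
Qed.

(** The norm of 1 + N n theta is an integer congruent to 1 modulo N n and a nonconstant polynomial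
    in [n], so some [n] avoids the values 0, 1 and -1. *)
Lemma norm_modulus_exists N : (0 < N)%N -> exists x P eps, norm_modulus N x P eps.
Proof.
move=> N0; have fN0 n : (0 < n)%N -> n%:R != 0 :> L.
  by move=> n0; rewrite -(rmorph_nat f) fmorph_eq0 pnatr_eq0 -lt0n.
pose p : {poly L} := \prod_s (1 + (ap s (N%:R * theta)) *: 'X).
have pE n : p.[f n%:R] = normL ap (1 + (N * n)%:R * theta).
  rewrite horner_prod; apply: eq_bigr => s _.
  rewrite hornerD hornerC hornerZ hornerX !rmorphE natrM.
  by ring.
have pr : p.[- (N%:R * theta)^-1] = 0.
  rewrite horner_prod (bigD1 1%g) //= hornerD hornerC hornerZ hornerX ap1 mulrN mulfV ?subrr ?mul0r //.
  by rewrite mulf_neq0 ?fN0.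
have p1 : p.[0] = 1.
  by rewrite horner_prod big1 // => s _; rewrite hornerD hornerC hornerZ hornerX mulr0 addr0.
(* [p] is 1 at 0 and has the root found in [pr], where its square minus 1 is -1. *)
have q0 : p * (p ^+ 2 - 1) != 0.
  rewrite mulf_neq0 //; first by apply: contra_eq_neq p1 => ->; rewrite horner0 eq_sym oner_neq0.
  apply: contra_neq (oner_neq0 L) => /(congr1 (fun g => - g.[- (N%:R * theta)^-1])).
  by rewrite hornerD hornerN hornerC expr2 hornerM pr mul0r sub0r opprK horner0 oppr0.
have [n Hn] := poly_nonroot f q0; exists (N * n)%N; set x := (N * n)%N.
have [q Eq] := normL_rat apM apfix (1 + x%:R * theta).
move: Hn; rewrite /root hornerM hornerD hornerN hornerC horner_exp pE -/x Eq => Hn.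
have [a Ha Ea] := norm_one_plus x; rewrite Eq in Ea.
have n0 : (0 < n)%N.
  rewrite lt0n; apply: contraNneq Hn => n0.
  by rewrite Ea /x n0 muln0 mul0r addr0 expr1n subrr mulr0.
have x0 : (0 < x)%N by rewrite muln_gt0 N0.
have {a Ha Ea} [z Ez] : exists z : int, q = 1 + x%:R * z%:~R.
  have /algint_rat/intrP[z Ez] : algint (f ((q - 1) / x%:R)).
    rewrite rmorphM rmorphB fmorphV rmorph1 rmorph_nat Ea [1 + _]addrC addrK mulrC mulKf //.
    exact: fN0.
  exists z; rewrite -Ez mulrC divfK; first by rewrite addrC subrK.
  by rewrite pnatr_eq0 -lt0n.
pose w : int := 1 + x%:Z * z.
have Ew : q = w%:~R by rewrite Ez /w rmorphD rmorphM /= rmorph1 pmulrn.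
exists `|w|%N, (sgz w)%:~R; split=> //.
- move: Hn; have -> : f q * (f q ^+ 2 - 1) = f (w * (w ^+ 2 - 1))%:~R.
    by rewrite Ew !rmorph_int !expr2 !(intrM, intrB).
  rewrite fmorph_eq0 intr_eq0; case: (w) => [[|[|k]]|[|k]] //.
- rewrite -rmorphM -[RHS](rmorph1 intr); congr (_%:~R); rewrite -expr2 sqr_sg.
  suff -> : w != 0 by [].
  by apply: contraNneq Hn => w0; rewrite Ew w0 rmorph0 mul0r.
- rewrite Eq Ew; congr (f _); rewrite pmulrn -rmorphM; congr (_%:~R).
  by rewrite abszE -sgrz -numEsg.
- rewrite -[coprime _ _]/(coprimez x w) /w; apply/coprimezP; exists (- z, 1) => /=; ring.
- by rewrite dvdn_mulr.
Qed.

End NormPrimes.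

Section Equivariance.
Variables (L : fieldType) (f : {rmorphism rat -> L}) (gT : finGroupType).
Variable ap : gT -> {rmorphism L -> L}.
Hypothesis apM : forall s t x, ap (s * t)%g x = ap t (ap s x).
Hypothesis ap1 : forall x, ap 1%g x = x.
Hypothesis apfix : forall x, (forall s, ap s x = x) -> exists q, x = f q.
Variables (d : nat) (A : 'M[rat]_d) (s : seq L) (prj : L -> 'M[L]_d).
Hypothesis Hsp : spectral (map_mx f A) s prj.
Hypothesis Hroot : forall l, root (char_poly (map_mx f A)) l -> l \in s.

Lemma rational_mx m n (X : 'M[L]_(m, n)) : (forall g, map_mx (ap g) X = X) ->
  exists Y, X = map_mx f Y.
Proof.
move=> HX; have H i j : exists q, X i j = f q.
  by apply: apfix => g; have /matrixP/(_ i j) := HX g; rewrite mxE.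
exists (\matrix_(i, j) sval (cid (H i j))); apply/matrixP => i j; rewrite !mxE.
by case: cid.
Qed.

Lemma ap_map_mx g m n (X : 'M[rat]_(m, n)) : map_mx (ap g) (map_mx f X) = map_mx f X.
Proof. by apply/matrixP => i j; rewrite !mxE ap_rat. Qed.

Lemma ap_spec g l : l \in s -> ap g l \in s.
Proof.
move=> /(spectral_root Hsp) Hl; apply: Hroot.
have -> : char_poly (map_mx f A) = map_poly (ap g) (char_poly (map_mx f A)).
  by rewrite map_char_poly ap_map_mx.
exact: rmorph_root.
Qed.

(** The conjugated projections sum to 1 and map into the conjugate generalized eigenspaces, which
    determines them. *)
Lemma ap_prj g l : l \in s -> map_mx (ap g) (prj l) = prj (ap g l).
Proof.
move=> Hl; pose P m := map_mx (ap g) (prj m).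
have iterM (B : 'M[L]_d) (v : 'M[L]_d) i : iter i (mulmxr B) v = v *m iter i (mulmxr B) 1%:M.
  by elim: i => [|i IH] /=; rewrite ?mulmx1 // IH mulmxA.
have row_iter (B X : 'M[L]_d) i k : row k (iter i (mulmxr B) X) = iter i (mulmxr B) (row k X).
  by elim: i => //= i IH; rewrite row_mul IH.
have nil m : m \in s -> iter d (mulmxr (map_mx f A - (ap g m)%:M)) (P m) = 0.
  move=> Hm; have := congr1 (map_mx (ap g)) (spectral_nil Hsp Hm).
  rewrite -iterM map_mx0 => <-; elim: (d in iter d) => //= i ->.
  by rewrite map_mxM map_mxB ap_map_mx map_scalar_mx.
have fix_ m : m \in s -> P m *m prj (ap g m) = P m.
  move=> Hm; apply/row_matrixP => k; rewrite row_mul.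
  apply: (spectral_fix Hsp (m := d)); first exact: ap_spec.
  by rewrite -row_iter nil // row0.
have -> : prj (ap g l) = (\sum_(m <- s) P m) *m prj (ap g l).
  have := congr1 (map_mx (ap g)) (spectral_sum Hsp); rewrite map_mx1 map_mx_sum.
  by rewrite /P => ->; rewrite mul1mx.
rewrite mulmx_suml (bigD1_seq l) ?(spectral_uniq Hsp) //= fix_ // big_seq_cond big1 ?addr0 //.
move=> m /andP[Hm Hne]; rewrite -(fix_ m Hm) -mulmxA (spectral_orth Hsp) ?mulmx0 ?ap_spec //.
by apply: contraNneq Hne => /fmorph_inj->.
Qed.

Lemma ap_perm g : perm_eq [seq ap g l | l <- s] s.
Proof.
have us := spectral_uniq Hsp.
have us' : uniq [seq ap g l | l <- s] by rewrite map_inj_uniq //; apply: fmorph_inj.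
apply: uniq_perm => //; have [] // := uniq_min_size us' (s2 := s); last by rewrite size_map.
by move=> _ /seq.mapP[l Hl ->]; apply: ap_spec.
Qed.

(** The Galois group permutes eigenvalues and projections compatibly, so an equivariant [h] gives an
    invariant matrix. *)
Lemma rational_spectral_fun h : (forall g l, l \in s -> ap g (h l) = h (ap g l)) ->
  exists Y, spectral_fun s prj h = map_mx f Y.
Proof.
move=> Hh; apply: rational_mx => g.
rewrite /spectral_fun map_mx_sum -[RHS](perm_big _ (ap_perm g)) big_map.
by apply: eq_big_seq => l Hl; rewrite map_mxZ Hh // ap_prj.
Qed.

End Equivariance.

Section DerivationWeights.
Variables (K : fieldType) (d : nat) (c : 'I_d -> 'I_d -> 'rV[K]_d) (A : 'M[K]_d).
Hypothesis HA : is_derivation c A.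

Lemma derivation_iter_add l m a b x y :
  iter a (mulmxr (A - l%:M)) x = 0 -> iter b (mulmxr (A - m%:M)) y = 0 ->
  iter (a + b) (mulmxr (A - (l + m)%:M)) (sc_bracket c x y) = 0.
Proof.
move E: (a + b)%N => s; elim: s a b E x y => [|s IH] a b E x y.
  have [-> ->] : a = 0%N /\ b = 0%N by lia.
  by move=> /= -> _; rewrite sc_br0l.
move=> Hx Hy; rewrite iterSr.
have -> : mulmxr (A - (l + m)%:M) (sc_bracket c x y) =
   sc_bracket c (x *m (A - l%:M)) y + sc_bracket c x (y *m (A - m%:M)).
  rewrite /= !mulmxBr HA sc_brBl sc_brBr !mul_mx_scalar sc_brZl sc_brZr scalerDl.
  by rewrite addrACA -opprD.
have iterD k (B : 'M[K]_d) (u v : 'rV[K]_d) :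
    iter k (mulmxr B) (u + v) = iter k (mulmxr B) u + iter k (mulmxr B) v.
  by elim: k => //= k ->; rewrite mulmxDl.
have iter0 k (B : 'M[K]_d) : iter k (mulmxr B) (0 : 'rV[K]_d) = 0.
  by elim: k => //= k ->; rewrite mul0mx.
rewrite iterD [X in X + _](_ : _ = 0) ?add0r.
  case: b E Hy => [|b] E Hy; last by apply: (IH a b); [lia | | rewrite -iterSr].
  by have -> : y = 0 by []; rewrite mul0mx sc_br0r iter0.
case: a E Hx => [|a] E Hx; last by apply: (IH a b); [lia | rewrite -iterSr |].
by have -> : x = 0 by []; rewrite mul0mx sc_br0l iter0.
Qed.

Variables (s : seq K) (prj : K -> 'M[K]_d) (t : K -> K).
Hypothesis Hsp : spectral A s prj.
Hypothesis tM : forall l m, l \in s -> m \in s -> l + m \in s -> t (l + m) = t l * t m.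

(** A bracket of weights [l] and [m] has weight [l + m], or vanishes if that is not an eigenvalue,
    so multiplicativity is asked only for sums that are eigenvalues. *)
Lemma spectral_fun_hom x y :
  sc_bracket c x y *m spectral_fun s prj t =
  sc_bracket c (x *m spectral_fun s prj t) (y *m spectral_fun s prj t).
Proof.
have dec (v : 'rV[K]_d) : v = \sum_(l <- s) v *m prj l.
  by rewrite -mulmx_sumr (spectral_sum Hsp) mulmx1.
have iterM (B : 'M[K]_d) (v : 'rV[K]_d) i : iter i (mulmxr B) v = v *m iter i (mulmxr B) 1%:M.
  by elim: i => [|i IH] /=; rewrite ?mulmx1 // IH mulmxA.
have nil (v : 'rV[K]_d) l : l \in s -> iter d (mulmxr (A - l%:M)) (v *m prj l) = 0.
  by move=> Hl; rewrite iterM -mulmxA (spectral_nil Hsp Hl) mulmx0.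
have EF (v : 'rV[K]_d) : v *m spectral_fun s prj t = \sum_(l <- s) t l *: (v *m prj l).
  by rewrite /spectral_fun mulmx_sumr; apply: eq_bigr => l _; rewrite -scalemxAr.
rewrite [X in _ = sc_bracket c X _]EF [X in _ = sc_bracket c _ X]EF.
rewrite {1}(dec x) {1}(dec y) !sc_br_suml mulmx_suml; apply: eq_big_seq => l Hl.
rewrite !sc_br_sumr mulmx_suml; apply: eq_big_seq => m Hm.
rewrite sc_brZl sc_brZr scalerA.
have Hz := derivation_iter_add (nil x l Hl) (nil y m Hm).
have [Hlm|Hlm] := boolP (l + m \in s); last first.
  by rewrite (spectral_out Hsp Hlm Hz) mul0mx scaler0.
have E := spectral_fix Hsp Hlm Hz.
rewrite -{1}E -mulmxA.
have -> : prj (l + m) *m spectral_fun s prj t = t (l + m) *: prj (l + m).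
  rewrite /spectral_fun mulmx_sumr (bigD1_seq (l + m)) ?(spectral_uniq Hsp) //= -scalemxAr.
  rewrite (spectral_id Hsp) // big_seq_cond big1 ?addr0 // => k /andP[Hk Hne].
  by rewrite -scalemxAr (spectral_orth Hsp) ?scaler0 // eq_sym.
by rewrite tM // -scalemxAr E.
Qed.

End DerivationWeights.

Lemma eventually_all (T : eqType) (s : seq T) (Pr : T -> nat -> Prop) :
  (forall l, l \in s -> exists k0, forall k, (k0 <= k)%N -> Pr l k) ->
  exists k0, forall k, (k0 <= k)%N -> forall l, l \in s -> Pr l k.
Proof.
elim: s => [|l s IH] H; first by exists 0%N.
have [k1 H1] := H l (mem_head _ _).
have [|k2 H2] := IH; first by move=> m Hm; apply: H; rewrite inE Hm orbT.
exists (maxn k1 k2) => k; rewrite geq_max => /andP[Hk1 Hk2] m.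
by rewrite inE => /orP[/eqP->|]; [apply: H1 | apply: H2].
Qed.

Lemma closed_exprz (L : fieldType) (Pr : L -> Prop) u (z : int) :
  Pr 1 -> (forall a b, Pr a -> Pr b -> Pr (a * b)) -> Pr u -> Pr u^-1 -> Pr (u ^ z).
Proof.
move=> P1 PM Hu HuV; have HX v n : Pr v -> Pr (v ^+ n).
  by move=> Hv; elim: n => [|n IH]; rewrite ?expr0 // exprS; apply: PM.
case: z => n; first exact: HX.
by rewrite NegzE -exprnN -exprVn; apply: HX.
Qed.

Section Weights.
Variables (L : fieldType) (f : {rmorphism rat -> L}) (gT : finGroupType).
Variable ap : gT -> {rmorphism L -> L}.
Hypothesis apM : forall s t x, ap (s * t)%g x = ap t (ap s x).
Hypothesis ap1 : forall x, ap 1%g x = x.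
Variable theta : L.
Hypothesis theta_int : algint theta.

Section OneModulus.
Variables (N x P : nat) (eps : rat).
Hypothesis HP : norm_modulus f ap theta N x P eps.
Notation alpha := (1 + x%:R * theta).

Lemma modulus_eps_int : eps \in Num.int.
Proof.
have : (eps - 1) * (eps + 1) == 0 by rewrite mulrDr mulrBl mulrBl (modulus_eps HP); apply/eqP; ring.
by rewrite mulf_eq0 subr_eq0 addr_eq0 => /orP[]/eqP->; rewrite ?rpredN rpred1.
Qed.

Lemma modulus_neq0 : P%:R != 0 :> L.
Proof. by rewrite -(rmorph_nat f) fmorph_eq0 pnatr_eq0 -lt0n (ltn_trans _ (modulus_gt1 HP)). Qed.

Lemma modulus_generator_neq0 : alpha != 0.
Proof.
apply: contraNneq modulus_neq0 => E; have := modulus_norm HP.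
rewrite /normL (bigD1 1%g) //= E rmorph0 mul0r rmorphM rmorph_nat => /esym/eqP.
rewrite mulf_eq0 => /orP[|//]; rewrite fmorph_eq0 => /eqP e0.
by have := modulus_eps HP; rewrite e0 mul0r => /esym/eqP; rewrite oner_eq0.
Qed.

Lemma algint_modulus_generator : algint alpha.
Proof. by apply: algintD; [exact: (algint_int L 1) | apply: algintM => //; exact: algint_nat]. Qed.

Lemma algint_modulus_inverse g : algint (P%:R * (ap g alpha)^-1).
Proof.
have -> : P%:R * (ap g alpha)^-1 = ap g (P%:R * alpha^-1) by rewrite rmorphM fmorphV rmorph_nat.
apply: algint_ap; have a0 := modulus_generator_neq0.
have -> : P%:R / alpha = f eps * \prod_(s | s != 1%g) ap s alpha.
  apply: (mulIf a0); rewrite divfK // -mulrA.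
  have -> : \prod_(s | s != 1%g) ap s alpha * alpha = normL ap alpha.
    by rewrite /normL [RHS](bigD1 1%g) //= ap1 mulrC.
  by rewrite (modulus_norm HP) -rmorphM mulrA (modulus_eps HP) mul1r rmorph_nat.
apply: algintM; first exact/algint_ratint/modulus_eps_int.
by apply: algint_prod => s _; apply/algint_ap/algint_modulus_generator.
Qed.

End OneModulus.

(* The product over conjugates makes [spectral_fun s prj (unit_weight a b Y)]
   invariant under the Galois group, hence rational. *)
Definition unit_weight (a b : L) (Y : L -> int) (l : L) :=
  \prod_g (ap g a ^ Y (ap g^-1%g l) * ap g b ^ (- Y (ap g^-1%g l))).

Lemma unit_weight_swap a b Y l : unit_weight a b Y l = unit_weight b a (fun m => - Y m) l.
Proof. by apply: eq_bigr => g _; rewrite opprK mulrC. Qed.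

Lemma unit_weight_inv a b Y l : (unit_weight a b Y l)^-1 = unit_weight a b (fun m => - Y m) l.
Proof.
rewrite /unit_weight -prodfV; apply: eq_bigr => g _.
by rewrite invfM -!invr_expz.
Qed.

Lemma unit_weight_neq0 a b Y l : a != 0 -> b != 0 -> unit_weight a b Y l != 0.
Proof.
by move=> a0 b0; apply/prodf_neq0 => g _; rewrite mulf_neq0 // expfz_neq0 // fmorph_eq0.
Qed.

Lemma unit_weight_ap a b Y g l : a != 0 -> b != 0 -> ap g (unit_weight a b Y l) = unit_weight a b Y (ap g l).
Proof.
move=> a0 b0; rewrite /unit_weight rmorph_prod [RHS](reindex_inj (mulIg g)) /=; apply: eq_bigr => h _.
by rewrite rmorphM !rmorphXz ?unitfE ?fmorph_eq0 // -!apM invMg apM -apM mulgA mulgV mul1g.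
Qed.

Lemma unit_weight_add a b Y l m : a != 0 -> b != 0 ->
  (forall g, Y (ap g (l + m)) = Y (ap g l) + Y (ap g m)) ->
  unit_weight a b Y (l + m) = unit_weight a b Y l * unit_weight a b Y m.
Proof.
move=> a0 b0 HY; rewrite /unit_weight -big_split; apply: eq_bigr => g _ /=.
by rewrite HY opprD !expfzDr ?fmorph_eq0 // mulrACA.
Qed.

Section TwoModuli.
Variables (N x P x' Q : nat) (eps eps' : rat).
Hypothesis HP : norm_modulus f ap theta N x P eps.
Hypothesis HQ : norm_modulus f ap theta N x' Q eps'.
Hypothesis PQ : coprime P Q.
Hypothesis N0 : (0 < N)%N.
Notation alpha := (1 + x%:R * theta).
Notation beta := (1 + x'%:R * theta).
Notation t := (unit_weight alpha beta).

Let fN0 : N%:R != 0 :> L.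
Proof. by rewrite -(rmorph_nat f) fmorph_eq0 pnatr_eq0 -lt0n. Qed.

(** The elements congruent to 1 modulo [N], up to powers of [P * Q], are closed under products. They
    contain the conjugates of both generators and their inverses, because [N] divides [x] and
    [x']. *)
Lemma unit_weight_cong Y l : exists k0, forall k, (k0 <= k)%N ->
  algint ((P * Q)%:R ^+ k * (t Y l - 1) / N%:R).
Proof.
pose C (u : L) := exists k, algint ((P * Q)%:R ^+ k * (u - 1) / N%:R).
have int_nat n : algint (n%:R : L) := algint_nat L n.
have C1 : C 1 by exists 0%N; rewrite subrr mulr0 mul0r; exact: (algint_int L 0).
have CM u v : C u -> C v -> C (u * v).
  move=> [k Hk] [k' Hk']; exists (k + k')%N.
  have -> : (P * Q)%:R ^+ (k + k') * (u * v - 1) / N%:R =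
     ((P * Q)%:R ^+ k * (u - 1) / N%:R) * (N%:R * ((P * Q)%:R ^+ k' * (v - 1) / N%:R) + (P * Q)%:R ^+ k')
     + (P * Q)%:R ^+ k * ((P * Q)%:R ^+ k' * (v - 1) / N%:R).
    by rewrite exprD; field.
  by do !(exact: Hk || exact: Hk' || apply: algintD || apply: algintM || apply: algintX || apply: int_nat).
have CG x1 P1 eps1 R1 g (H1 : norm_modulus f ap theta N x1 P1 eps1) :
    (P * Q = P1 * R1)%N -> C (ap g (1 + x1%:R * theta)) /\ C (ap g (1 + x1%:R * theta))^-1.
  move=> E; have [m Em] := dvdnP (modulus_dvd H1).
  have H : algint ((ap g (1 + x1%:R * theta) - 1) / N%:R).
    have -> : (ap g (1 + x1%:R * theta) - 1) / N%:R = m%:R * ap g theta.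
      by rewrite rmorphD rmorphM rmorph1 rmorph_nat Em natrM; field.
    by apply: algintM => //; apply: algint_ap.
  split; first by exists 0%N; rewrite expr0 mul1r.
  exists 1%N; have a0 := modulus_generator_neq0 H1.
  have -> : (P * Q)%:R ^+ 1 * ((ap g (1 + x1%:R * theta))^-1 - 1) / N%:R =
     - (R1%:R * ((P1%:R * (ap g (1 + x1%:R * theta))^-1) * ((ap g (1 + x1%:R * theta) - 1) / N%:R))).
    rewrite E natrM; move: (ap g _) (fmorph_eq0 (ap g) (1 + x1%:R * theta)) => u.
    by rewrite (negbTE a0) => /negbT u0; field; rewrite ?u0 ?fN0.
  apply/algintN/algintM => //; apply: algintM => //.
  exact: (algint_modulus_inverse H1).
have [k Hk] : C (t Y l).
  apply: (big_ind C) => // g _; apply: (CM); apply: (closed_exprz _ C1 CM).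
  - by case: (CG _ _ _ Q g HP erefl).
  - by case: (CG _ _ _ Q g HP erefl).
  - by case: (CG _ _ _ P g HQ (mulnC _ _)).
  - by case: (CG _ _ _ P g HQ (mulnC _ _)).
exists k => k' Hk'.
have -> : (P * Q)%:R ^+ k' * (t Y l - 1) / N%:R =
    (P * Q)%:R ^+ (k' - k) * ((P * Q)%:R ^+ k * (t Y l - 1) / N%:R).
  by rewrite !mulrA -exprD subnK.
by apply: algintM => //; apply: algintX.
Qed.

Notation R := (locO P).
Notation alpha' := (cofactor_alpha f P alpha).

(** Only the factor of the identity automorphism, alpha^(Y l), matters at alpha: the other
    conjugates of alpha divide [alpha'], and those of beta are units at [P] because [Q] is prime to
    [P]. *)
Lemma unit_weight_local Y l : exists k0, forall k, (k0 <= k)%N ->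
  [/\ 0 <= Y l -> R (alpha' ^+ k * t Y l),
      Y l < 0 -> exists2 r, R r & alpha' ^+ k * (t Y l)^-1 = alpha * r,
      R (f P%:R ^+ k * t Y l) & R (f P%:R ^+ k * (t Y l)^-1)].
Proof.
have a0 := modulus_generator_neq0 HP; have b0 := modulus_generator_neq0 HQ.
have aL : R alpha by apply/locO_algint/algint_modulus_generator.
have Eal : alpha * alpha' = P%:R by rewrite /cofactor_alpha mulrC divfK // rmorph_nat.
have a'L : R alpha'.
  apply: locO_algint; have := algint_modulus_inverse HP 1%g.
  by rewrite ap1 /cofactor_alpha rmorph_nat.
pose W (u : L) := exists k, R (alpha' ^+ k * u).
have W1 : W 1 by exists 0%N; rewrite mulr1; exact: locO1.
have WR u : R u -> W u by move=> Hu; exists 0%N; rewrite mul1r.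
have WM u v : W u -> W v -> W (u * v).
  move=> [k Hk] [k' Hk']; exists (k + k')%N.
  by rewrite exprD mulrACA; apply: locOM.
have Wa g : g != 1%g -> W (ap g alpha) /\ W (ap g alpha)^-1.
  move=> g1; split; first exact/WR/locO_ap.
  exists 1%N; rewrite expr1.
  exact: (cofactor_div_loc ap1 (modulus_gt1 HP) (modulus_eps HP) (modulus_norm HP) erefl (locO_algint _ theta_int) g1).
have Wb g : W (ap g beta) /\ W (ap g beta)^-1.
  split; apply: WR; first exact/locO_algint/algint_ap/algint_modulus_generator.
  exists Q; split; first by rewrite coprime_sym.
  exact: (algint_modulus_inverse HQ).
pose w Z := \prod_(g | g != 1%g) ap g alpha ^ (Z (ap g^-1%g l)) *
  \prod_g ap g beta ^ (- Z (ap g^-1%g l)).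
have Ww Z : W (w Z).
  apply: (WM); apply: (big_ind W) => // g Hg; apply: (closed_exprz _ W1 WM).
  - by case: (Wa g Hg).
  - by case: (Wa g Hg).
  - by case: (Wb g).
  - by case: (Wb g).
have Et Z : t Z l = alpha ^ Z l * w Z.
  rewrite /unit_weight big_split /= (bigD1 1%g) //= ap1 invg1 ap1 -mulrA //.
have mono k0 k u : (k0 <= k)%N -> R (alpha' ^+ k0 * u) -> R (alpha' ^+ k * u).
  by move=> Hk H; rewrite -(subnK Hk) exprD -mulrA; apply: locOM => //; apply: locOX.
have Pbound Z : exists k0, forall k, (k0 <= k)%N -> R (f P%:R ^+ k * t Z l).
  have [k0 Hk0] := unit_weight_cong Z l; exists k0 => k /Hk0 H.
  have [q Eq] : exists q, q = (P * Q)%:R ^+ k * t Z l by eexists.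
  have Hq : R q.
    apply: locO_algint; rewrite Eq.
    have -> : (P * Q)%:R ^+ k * t Z l =
        N%:R * ((P * Q)%:R ^+ k * (t Z l - 1) / N%:R) + (P * Q)%:R ^+ k by field.
    by apply: algintD; [apply: algintM => //; exact: algint_nat | exact/algintX/algint_nat].
  have Q0 := modulus_neq0 HQ.
  have -> : f P%:R ^+ k * t Z l = Q%:R^-1 ^+ k * q.
    rewrite Eq rmorph_nat natrM exprMn exprVn.
    by rewrite [P%:R ^+ k * Q%:R ^+ k]mulrC -mulrA mulKf // expf_neq0.
  apply: locOM => //; apply: locOX; exists Q; split; first by rewrite coprime_sym.
  by rewrite mulfV //; exact: (algint_int L 1).
have [k1 H1] := Ww Y; have [k2 H2] := Ww (fun m => - Y m).
have [k3 H3] := Pbound Y; have [k4 H4] := Pbound (fun m => - Y m).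
exists (k1 + k2 + k3 + k4)%N => k Hk; split.
- move=> HY; rewrite Et mulrCA; apply: locOM; last by apply: mono H1; lia.
  by case: (Y l) HY => // n _; apply: locOX.
- move=> HY; exists (alpha ^+ (`|Y l|%N.-1) * (alpha' ^+ k * w (fun m => - Y m))).
    by apply: locOM; [apply: locOX | apply: mono H2; lia].
  rewrite unit_weight_inv Et mulrCA [RHS]mulrA -exprS; congr (_ * _).
  by case: (Y l) HY => // n _.
- by apply: H3; lia.
- by rewrite unit_weight_inv; apply: H4; lia.
Qed.

End TwoModuli.
End Weights.

Lemma denq_dvd (b : nat) (q : rat) : b%:R * q \in Num.int -> (`|denq q| %| b)%N.
Proof.
move=> /intrP[z Ez]; have d0 : (denq q)%:~R != 0 :> rat by rewrite intr_eq0 denq_neq0.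
have E : (b%:Z * numq q = z * denq q)%R.
  apply: (@intr_inj rat); rewrite !rmorphM /= -Ez -pmulrn -mulrA; congr (_ * _).
  exact: numqE.
have : (denq q %| b%:Z * numq q)%Z by rewrite E dvdz_mull.
rewrite Gauss_dvdzl; first by rewrite dvdzE.
by rewrite /coprimez gcdzC; have := coprime_num_den q; rewrite /coprime /gcdz => /eqP->.
Qed.

Lemma locZ_mul P Q q : locZ P q -> locZ Q q -> locZ (P * Q) q.
Proof.
move=> [b [Hb /denq_dvd Db]] [b' [Hb' /denq_dvd Db']]; exists `|denq q|%N; split.
  by rewrite coprimeMr (coprime_dvdl Db Hb) (coprime_dvdl Db' Hb').
rewrite pmulrn gez0_abs ?denq_ge0 // mulrC -numqE; exact: intr_int.
Qed.

Section MatZ.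
Variable P : nat.

Lemma matZD m n (X Y : 'M[rat]_(m, n)) : matZ P X -> matZ P Y -> matZ P (X + Y).
Proof. by move=> HX HY i j; rewrite mxE; apply: locZD. Qed.

Lemma matZN m n (X : 'M[rat]_(m, n)) : matZ P X -> matZ P (- X).
Proof. by move=> HX i j; rewrite mxE; apply: locZN. Qed.

Lemma matZB m n (X Y : 'M[rat]_(m, n)) : matZ P X -> matZ P Y -> matZ P (X - Y).
Proof. by move=> HX HY; apply/matZD/matZN. Qed.

Lemma matZZ m n a (X : 'M[rat]_(m, n)) : locZ P a -> matZ P X -> matZ P (a *: X).
Proof. by move=> Ha HX i j; rewrite mxE; apply: locZM. Qed.

Lemma matZM m n p (X : 'M[rat]_(m, n)) (Y : 'M[rat]_(n, p)) : matZ P X -> matZ P Y -> matZ P (X *m Y).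
Proof. by move=> HX HY i j; rewrite mxE; apply: locZ_sum => k _; apply: locZM. Qed.

Lemma matZ_sum m n I (r : seq I) (Q : pred I) (X : I -> 'M[rat]_(m, n)) :
  (forall i, Q i -> matZ P (X i)) -> matZ P (\sum_(i <- r | Q i) X i).
Proof. by move=> HX i j; rewrite summxE; apply: locZ_sum => k Hk; apply: HX. Qed.

Lemma locZ_nat n : locZ P n%:R. Proof. exact/locZ_int/rpred_nat. Qed.

Lemma locZV Q : coprime Q P -> (0 < Q)%N -> locZ P Q%:R^-1.
Proof. by move=> QP Q0; exists Q; rewrite mulfV // pnatr_eq0 -lt0n. Qed.

End MatZ.

Lemma matZ_mul P Q m n (X : 'M[rat]_(m, n)) : matZ P X -> matZ Q X -> matZ (P * Q) X.
Proof. by move=> H1 H2 i j; apply: locZ_mul. Qed.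

(** * Gluing the splittings at two coprime moduli *)

Section Combine.
Variables (d : nat) (F Fi : 'M[rat]_d) (c : nat).

(** What density asks for: the part of a vector selected by [e] stays integral under [k0] steps of
    [Fi], the rest under one step of [F]. The third field measures how nearly [e] is a
    projection. *)
Record local_splitting_mx (P : nat) (M k0 : nat) (e : 'M[rat]_d) : Prop := LocalSplittingMx {
  splitting_back : forall i, (i <= k0)%N -> matZ P (iter i (mulmxr Fi) e);
  splitting_forth : matZ P ((1%:M - e) *m F);
  splitting_idem : matZ P (P%:R ^- M *: (e *m e - e)) }.

(** [F] and [Fi] have denominator at most P^c at [P], so a change of [e] divisible by P^a survives
    all the products that occur. *)
Lemma splitting_perturb P Q M k0 a e X :
  (1 < P)%N -> (0 < Q)%N -> coprime P Q ->
  matZ P (P%:R ^+ c *: F) -> matZ P (P%:R ^+ c *: Fi) ->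
  local_splitting_mx P M k0 e -> matZ P X -> (M + c * k0.+1 <= a)%N ->
  let e' := e + P%:R ^+ a *: X in
  [/\ forall i, (i <= k0)%N -> matZ P (iter i (mulmxr Fi) e'), matZ P ((1%:M - e') *m F)
    & matZ P ((P * Q)%:R ^- M *: (e' *m e' - e'))].
Proof.
move=> P1 Q0 PQ HF HFi [H1 H2 H3] HX Ha e'.
have P0 : P%:R != 0 :> rat by rewrite pnatr_eq0 -lt0n ltnW.
have HPX k : locZ P (P%:R ^+ k) by apply/locZX/locZ_nat.
have He : matZ P e by apply: (H1 0%N).
split.
- move=> i Hi.
  have -> : iter i (mulmxr Fi) e' = iter i (mulmxr Fi) e + P%:R ^+ (a - c * i) *: iter i (mulmxr (P%:R ^+ c *: Fi)) X.
    rewrite /e'; elim: i Hi => [|i IH] Hi /=; first by rewrite muln0 subn0.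
    rewrite IH; last exact: ltnW.
    rewrite mulmxDl -scalemxAl -!scalemxAr scalerA -exprD; congr (_ + _ ^+ _ *: _); nia.
  apply: matZD; first exact: H1.
  by apply: matZZ => //; elim: i {Hi} => //= i IH; apply: matZM.
- have -> : (1%:M - e') *m F = (1%:M - e) *m F - P%:R ^+ (a - c) *: (X *m (P%:R ^+ c *: F)).
    rewrite /e' opprD addrA mulmxBl -scalemxAl -scalemxAr scalerA -exprD.
    by congr (_ - _ ^+ _ *: _); nia.
  by apply: matZB => //; apply: matZZ => //; apply: matZM.
- have -> : (P * Q)%:R ^- M *: (e' *m e' - e') = Q%:R ^- M *: (P%:R ^- M *: (e *m e - e)) +
      Q%:R ^- M *: (P%:R ^+ (a - M) *: (e *m X + X *m e + P%:R ^+ a *: (X *m X) - X)).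
    rewrite -scalerDr.
    have -> : P%:R ^- M *: (e *m e - e) + P%:R ^+ (a - M) *: (e *m X + X *m e + P%:R ^+ a *: (X *m X) - X) = P%:R ^- M *: (e' *m e' - e').
      have -> : P%:R ^+ (a - M) = P%:R ^- M * P%:R ^+ a :> rat.
        by rewrite expfB_cond ?(negbTE P0) ?add0n 1?mulrC //; lia.
      rewrite -scalerA -scalerDr /e'; congr (_ *: _).
      rewrite mulmxDl !mulmxDr -!scalemxAl -!scalemxAr.
      by apply/matrixP => i j; rewrite !mxE; ring.
    by rewrite scalerA natrM exprMn invfM mulrC.
  have HQ : locZ P (Q%:R ^- M) by rewrite -exprVn; apply/locZX/locZV; rewrite 1?coprime_sym.
  apply: matZD; apply: matZZ => //; apply: matZZ => //.
  apply: matZB => //; apply: matZD; last by apply: matZZ => //; apply: matZM.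
  by apply: matZD; apply: matZM.
Qed.

(** Chinese remainder theorem: each coefficient is 1 modulo the a-th power of one modulus and 0
    modulo that of the other, so the sum is a small perturbation of [eP] at [P] and of [eQ] at
    [Q]. *)
Lemma splitting_combine P Q M k0 : (1 < P)%N -> (1 < Q)%N -> coprime P Q ->
  matZ P (P%:R ^+ c *: F) -> matZ P (P%:R ^+ c *: Fi) ->
  matZ Q (Q%:R ^+ c *: F) -> matZ Q (Q%:R ^+ c *: Fi) ->
  forall eP eQ, local_splitting_mx P M k0 eP -> local_splitting_mx Q M k0 eQ ->
  matZ Q eP -> matZ P eQ ->
  exists u v, local_splitting_mx (P * Q) M k0 (u *: eP + v *: eQ).
Proof.
move=> P1 Q1 PQ FP FiP FQ FiQ eP eQ HeP HeQ QeP PeQ.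
pose a := (M + c * k0.+1)%N.
have : coprimez (P ^ a)%N%:Z (Q ^ a)%N%:Z.
  by rewrite /coprimez -[gcdz _ _]/(gcdn (P ^ a) (Q ^ a))%:Z; apply/coprimeXl/coprimeXr.
case/coprimezP=> -[z w] /= E.
have Er : z%:~R * P%:R ^+ a + w%:~R * Q%:R ^+ a = 1 :> rat.
  have := congr1 (fun z : int => z%:~R : rat) E.
  by rewrite !rmorphD !rmorphM /= -!pmulrn !natrX.
exists (w%:~R * Q%:R ^+ a), (z%:~R * P%:R ^+ a); set e := _ + _.
have H1 : e = eP + P%:R ^+ a *: (z%:~R *: (eQ - eP)).
  rewrite /e scalerA [_ ^+ _ * _%:~R]mulrC scalerBr.
  have -> : w%:~R * Q%:R ^+ a = 1 - z%:~R * P%:R ^+ a :> rat by apply/eqP; rewrite eq_sym subr_eq [_ + _]addrC Er.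
  by rewrite scalerBl scale1r addrAC addrA.
have H2 : e = eQ + Q%:R ^+ a *: (w%:~R *: (eP - eQ)).
  rewrite /e scalerA [_ ^+ _ * _%:~R]mulrC scalerBr.
  have -> : z%:~R * P%:R ^+ a = 1 - w%:~R * Q%:R ^+ a :> rat by apply/eqP; rewrite eq_sym subr_eq Er.
  by rewrite scalerBl scale1r addrC [RHS]addrA addrAC.
have zi R (z' : int) : locZ R z'%:~R by apply/locZ_int/intr_int.
have PeP := splitting_back HeP (leq0n k0); have QeQ := splitting_back HeQ (leq0n k0).
have [] := @splitting_perturb P Q M k0 a eP (z%:~R *: (eQ - eP)) P1 (ltnW Q1) PQ FP FiP HeP.
- by apply: matZZ => //; apply: matZB.
- by [].
rewrite -H1 => A1 A2 A3.
have [] := @splitting_perturb Q P M k0 a eQ (w%:~R *: (eP - eQ)) Q1 (ltnW P1) _ FQ FiQ HeQ.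
- by rewrite coprime_sym.
- by apply: matZZ => //; apply: matZB.
- by [].
rewrite -H2 => B1 B2 B3; split.
- by move=> i Hi; apply: matZ_mul; auto.
- exact: matZ_mul.
- by apply: matZ_mul; rewrite // mulnC.
Qed.

End Combine.

(** Conditions that fail at finitely many primes are phrased by one integer [N] to be avoided; for a
    finite family these integers are multiplied. *)
Lemma almost_all_coprime (T : eqType) (r : seq T) (Pr : T -> nat -> Prop) :
  (forall t, t \in r -> exists2 N, (0 < N)%N & forall P, coprime N P -> Pr t P) ->
  exists2 N, (0 < N)%N & forall P, coprime N P -> forall t, t \in r -> Pr t P.
Proof.
elim: r => [|t r IH] H; first by exists 1%N.
have [N1 N10 H1] := H t (mem_head _ _).
have [|N2 N20 H2] := IH; first by move=> m Hm; apply: H; rewrite inE Hm orbT.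
exists (N1 * N2)%N => [|P]; first by rewrite muln_gt0 N10.
rewrite coprimeMl => /andP[/H1 HP1 /H2 HP2] m.
by rewrite inE => /orP[/eqP->|/HP2].
Qed.

Lemma almost_all_locZ (q : rat) : exists2 N, (0 < N)%N & forall P, coprime N P -> locZ P q.
Proof.
exists `|denq q|%N; first by rewrite absz_gt0 denq_neq0.
move=> P HP; exists `|denq q|%N; split=> //.
by rewrite pmulrn gez0_abs ?denq_ge0 // mulrC -numqE intr_int.
Qed.

Lemma almost_all_poly (h : {poly rat}) :
  exists2 N, (0 < N)%N & forall P, coprime N P -> forall i, locZ P h`_i.
Proof.
have [N N0 H] := @almost_all_coprime _ h (fun q P => locZ P q) (fun q _ => almost_all_locZ q).
exists N => // P /H HP i; have [Hi|Hi] := ltnP i (size h); first exact/HP/mem_nth.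
by rewrite nth_default //; apply/locZ_int/rpred0.
Qed.

Lemma almost_all_matZ m n (X : 'M[rat]_(m, n)) :
  exists2 N, (0 < N)%N & forall P, coprime N P -> matZ P X.
Proof.
have [N N0 H] := @almost_all_coprime _ (enum {: 'I_m * 'I_n}) (fun p P => locZ P (X p.1 p.2))
  (fun p _ => almost_all_locZ _).
by exists N => // P /H HP i j; apply: (HP (i, j)); rewrite mem_enum.
Qed.

Lemma vspace_kernel_mx d (U : {vspace 'rV[rat]_d}) :
  exists Z : 'M[rat]_d, forall u, (u \in U) = (u *m Z == 0).
Proof.
exists (1%:M - lin1_mx (projv U)) => u; rewrite mulmxBr mulmx1 mul_rV_lin1 subr_eq0 eq_sym.
by apply/idP/eqP => [/projv_id|<-] //; apply: memv_proj.
Qed.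

(** What is kept of being a polynomial in [A]. It makes the approximate projections respect the
    lower central series, which every derivation preserves. *)
Definition stable_under d (A e : 'M[rat]_d) := forall U : {vspace 'rV[rat]_d},
  (forall u, u \in U -> u *m A \in U) -> forall u, u \in U -> u *m e \in U.

Section Global.
Variables (L : fieldType) (f : {rmorphism rat -> L}) (gT : finGroupType).
Variable ap : gT -> {rmorphism L -> L}.
Hypothesis apM : forall s t x, ap (s * t)%g x = ap t (ap s x).
Hypothesis ap1 : forall x, ap 1%g x = x.
Hypothesis apfix : forall x, (forall s, ap s x = x) -> exists q, x = f q.
Variable theta : L.
Hypothesis theta0 : theta != 0.
Hypothesis theta_int : algint theta.
Hypothesis theta_inj : forall s, ap s theta = theta -> s = 1%g.
Hypothesis theta_gen : forall x, exists g : {poly rat}, x = (map_poly f g).[theta].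
Variables (d : nat) (A : 'M[rat]_d) (s : seq L) (prj : L -> 'M[L]_d).
Hypothesis Hsp : spectral (map_mx f A) s prj.

Lemma almost_all_locO (x : L) : exists2 N, (0 < N)%N & forall P, coprime N P -> locO P x.
Proof. by have [N N0 HN] := algint_multiple apM ap1 apfix x; exists N => // P HP; exists N. Qed.

Definition good_modulus P :=
  [/\ forall l, l \in s -> matO P (prj l),
      forall g, g != 1%g -> ap g theta != theta /\ locO P (ap g theta - theta)^-1
    & forall g, exists h : {poly rat}, (forall i, locZ P h`_i) /\ ap g theta = (map_poly f h).[theta]].

Lemma almost_all_good : exists2 N, (0 < N)%N & forall P, coprime N P -> good_modulus P.
Proof.
have [N1 N10 H1] : exists2 N, (0 < N)%N & forall P, coprime N P -> forall l, l \in s -> matO P (prj l).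
  apply: almost_all_coprime => l _.
  have [N N0 H] := @almost_all_coprime _ (enum {: 'I_d * 'I_d}) (fun p P => locO P (prj l p.1 p.2))
    (fun p _ => almost_all_locO _).
  by exists N => // P /H HP i j; apply: (HP (i, j)); rewrite mem_enum.
have [N2 N20 H2] := @almost_all_coprime _ (enum gT)
  (fun g P => locO P (ap g theta - theta)^-1) (fun g _ => almost_all_locO _).
have [N3 N30 H3] : exists2 N, (0 < N)%N & forall P, coprime N P -> forall g, g \in enum gT ->
    exists h : {poly rat}, (forall i, locZ P h`_i) /\ ap g theta = (map_poly f h).[theta].
  apply: almost_all_coprime => g _; have [h Eh] := theta_gen (ap g theta).
  by have [N N0 HN] := almost_all_poly h; exists N => // P HP; exists h; split=> //; apply: HN.
exists (N1 * N2 * N3)%N => [|P]; first by rewrite !muln_gt0 N10 N20.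
rewrite !coprimeMl => /andP[/andP[/H1 HP1 /H2 HP2] /H3 HP3]; split=> //.
- move=> g g1; split; last by apply: HP2; rewrite mem_enum.
  by apply: contraNneq g1 => /theta_inj->.
- by move=> g; apply: HP3; rewrite mem_enum.
Qed.

Definition neg_indicator (eta : L -> int) (l : L) : L := if eta l < 0 then 1 else 0.

Lemma rational_coefficients (g : L -> L) : exists r (h : 'I_r -> {poly rat}) (E : 'I_r -> 'M[rat]_d) N,
  [/\ (0 < N)%N, spectral_fun s prj g = \sum_k (map_poly f (h k)).[theta] *: map_mx f (E k),
      forall P, coprime N P -> (forall k i, locZ P (h k)`_i) /\ (forall k, matZ P (E k))
    & forall k, stable_under A (E k)].
Proof.
have [r [b [E [Hb Eb]]]] := matrix_rat_basis f (spectral_fun s prj g).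
pose h k := sval (cid (theta_gen (b k))).
have Eh k : b k = (map_poly f (h k)).[theta] by rewrite /h; case: cid.
have [N1 N10 H1] := @almost_all_coprime _ (enum 'I_r) (fun k P => forall i, locZ P (h k)`_i)
  (fun k _ => almost_all_poly _).
have [N2 N20 H2] := @almost_all_coprime _ (enum 'I_r) (fun k P => matZ P (E k))
  (fun k _ => almost_all_matZ _).
exists r, h, E, (N1 * N2)%N; split; first by rewrite muln_gt0 N10.
- by rewrite Eb; apply: eq_bigr => k _; rewrite Eh.
- move=> P; rewrite coprimeMl => /andP[/H1 HP1 /H2 HP2].
  by split=> k; [apply: HP1 | apply: HP2]; rewrite mem_enum.
(* [Z] gives rational equations for [U]. Over [L] their solutions are stable under [A], hence under
   the projections, and the coefficients [E k] inherit this. *)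
- move=> k U HU u Hu; have [Z HZ] := vspace_kernel_mx U.
  rewrite HZ; apply/eqP; move: k.
  apply: (rat_free_mulmx (Y := fun k => u *m E k) Hb).
  have -> : \sum_k b k *: map_mx f (u *m E k) = map_mx f u *m spectral_fun s prj g.
    by rewrite Eb mulmx_sumr; apply: eq_bigr => k _; rewrite map_mxM -scalemxAr.
  pose Q (v : 'rV[L]_d) := v *m map_mx f Z = 0.
  have Qlin a v w : Q v -> Q w -> Q (a *: v + w).
    by rewrite /Q => E1 E2; rewrite mulmxDl -scalemxAl E1 E2 scaler0 add0r.
  have QA v : Q v -> Q (v *m map_mx f A).
    have [r' [b' [Y [Hb' ->]]]] := matrix_rat_basis f v.
    rewrite /Q => /(rat_free_mulmx Hb') HY; rewrite !mulmx_suml big1 // => k _.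
    rewrite -!scalemxAl -!map_mxM.
    have /HU : Y k \in U by rewrite HZ HY eqxx.
    by rewrite HZ => /eqP->; rewrite map_mx0 scaler0.
  have Q0 : Q 0 by rewrite /Q mul0mx.
  have Qu : Q (map_mx f u).
    by rewrite /Q -map_mxM; move: Hu; rewrite HZ => /eqP->; rewrite map_mx0.
  rewrite -[_ *m _ = 0]/(Q _) /spectral_fun mulmx_sumr.
  apply: (big_ind Q) => // [v w Hv Hw|l _]; first by rewrite -(scale1r v); apply: Qlin.
  by rewrite -scalemxAr -[_ *: _]addr0; apply: (Qlin) => //; apply: (spectral_stable Hsp Q0 Qlin QA).
Qed.

Section HalfSplitting.
Variables (N x P x' Q : nat) (eps eps' : rat) (Y : L -> int).
Hypothesis HP : norm_modulus f ap theta N x P eps.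
Hypothesis HQ : norm_modulus f ap theta N x' Q eps'.
Hypothesis PQ : coprime P Q.
Hypothesis N0 : (0 < N)%N.
Hypothesis Hgood : good_modulus P.
Notation t := (unit_weight ap (1 + x%:R * theta) (1 + x'%:R * theta) Y).
Variables F Fi : 'M[rat]_d.
Hypothesis EF : map_mx f F = spectral_fun s prj t.
Hypothesis EFi : map_mx f Fi = spectral_fun s prj (fun l => (t l)^-1).

Let bounds : exists k0, forall k, (k0 <= k)%N -> forall l, l \in s ->
  [/\ 0 <= Y l -> locO P (cofactor_alpha f P (1 + x%:R * theta) ^+ k * t l),
      Y l < 0 -> exists2 r, locO P r &
        cofactor_alpha f P (1 + x%:R * theta) ^+ k * (t l)^-1 = (1 + x%:R * theta) * r,
      locO P (f P%:R ^+ k * t l) & locO P (f P%:R ^+ k * (t l)^-1)].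
Proof.
apply: eventually_all => l _.
exact: (unit_weight_local ap1 theta_int HP HQ PQ N0 Y l).
Qed.

Lemma half_bounded : exists k0, forall k, (k0 <= k)%N ->
  matZ P (P%:R ^+ k *: F) /\ matZ P (P%:R ^+ k *: Fi).
Proof.
have [k0 Hk0] := bounds; have [Hprj _ _] := Hgood; exists k0 => k /Hk0 H.
split; apply/(matO_map f); rewrite map_mxZ ?EF ?EFi /spectral_fun scaler_sumr big_seq;
  apply: matO_sum => l Hl; rewrite scalerA rmorphXn; apply: matOZ; auto;
  by case: (H l Hl).
Qed.

(** One modulus treats the eigenvalues with [Y] negative. With the moduli exchanged and [Y] replaced
    by its opposite, as [unit_weight_swap] allows, the same statement treats the positive ones. *)
Lemma half_splitting r (h : 'I_r -> {poly rat}) (E : 'I_r -> 'M[rat]_d) :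
  spectral_fun s prj (neg_indicator Y) = \sum_k (map_poly f (h k)).[theta] *: map_mx f (E k) ->
  (forall R, R = P \/ R = Q -> (forall k i, locZ R (h k)`_i) /\ (forall k, matZ R (E k))) ->
  (forall k, stable_under A (E k)) -> forall M k0,
  exists e, [/\ local_splitting_mx F Fi P M k0 e, matZ Q e & stable_under A e].
Proof.
move=> Eneg HE Hst M k0; have [c Hc] := bounds; have [Hprj Hdiff Hconj] := Hgood.
have {}Hc l (Hl : l \in s) := Hc c (leqnn c) l Hl.
have [HhP HEP] := HE P (or_introl erefl); have [HhQ HEQ] := HE Q (or_intror erefl).
have [|||z [H1 H2 H3]] := local_splitting apM ap1 apfix (modulus_gt1 HP) (modulus_eps HP)
  (modulus_norm HP) (modulus_coprime HP) (modulus_pos HP) erefl (locO_algint P theta_int)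
  Hdiff Hconj Hsp Hprj (eta := Y) (c := c) _ _ _ EF EFi Eneg (fun=> erefl) HhP HEP M k0.
- by move=> l Hl; case: (Hc l Hl).
- by move=> l Hl; case: (Hc l Hl).
- by move=> l Hl; case: (Hc l Hl).
exists (\sum_k (h k).[z%:~R] *: E k); split; first by [].
- apply: matZ_sum => k _; apply: matZZ => //; rewrite horner_coef; apply: locZ_sum => i _.
  by apply: locZM => //; apply/locZX/locZ_int/intr_int.
- move=> U HU u Hu; rewrite mulmx_sumr; apply: memv_suml => k _.
  by rewrite -scalemxAr memvZ //; apply: Hst.
Qed.

Lemma half_bounded_orbit (v : 'rV[rat]_d) K : (0 < K)%N ->
  (forall i, latt 1 K (iter i (mulmxr F) v)) ->
  forall l, l \in s -> Y l < 0 -> map_mx f v *m prj l = 0.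
Proof.
have [c Hc] := bounds; have [Hprj Hdiff Hconj] := Hgood.
have {}Hc l (Hl : l \in s) := Hc c (leqnn c) l Hl.
apply: (negative_weight_divisible apM ap1 apfix (modulus_gt1 HP) (modulus_eps HP)
  (modulus_norm HP) (modulus_coprime HP) (modulus_pos HP) erefl (locO_algint P theta_int)
  Hdiff Hsp Hprj (c := c) _ _ EF).
- move=> l _; apply: unit_weight_neq0; [exact: (modulus_generator_neq0 HP) | exact: (modulus_generator_neq0 HQ)].
- by move=> l Hl; case: (Hc l Hl).
Qed.

End HalfSplitting.

End Global.

Lemma ext_derivation (K : fieldType) (f : {rmorphism rat -> K}) d
    (c : 'I_d -> 'I_d -> 'rV[rat]_d) (D : 'M[rat]_d) :
  is_derivation c D -> is_derivation (ext_sc f c) (map_mx f D).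
Proof.
move=> HD x y; have [r [b [X [_ ->]]]] := matrix_rat_basis f x.
have [r' [b' [Y [_ ->]]]] := matrix_rat_basis f y.
rewrite !sc_br_suml !mulmx_suml !sc_br_suml -big_split; apply: eq_bigr => k _ /=.
rewrite !sc_br_sumr !mulmx_suml -big_split; apply: eq_bigr => l _ /=.
rewrite -!scalemxAl !(sc_brZl, sc_brZr) -!map_mxM !ext_br -!scalemxAl -!map_mxM HD map_mxD.
by rewrite !scalerDr.
Qed.

Lemma derivation_nil_center d (c : 'I_d -> 'I_d -> 'rV[rat]_d) (D : 'M[rat]_d) :
  is_derivation c D -> (forall v, in_center c v -> v *m D = 0 -> v = 0) ->
  forall k v, in_center c v -> iter k (mulmxr D) v = 0 -> v = 0.
Proof.
move=> HD Hinj; elim=> [|k IH] v Hv //; rewrite iterSr => /IH E; apply: Hinj => //.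
by apply: E; apply: derivation_center Hv.
Qed.

Theorem global_automorphism d (c : 'I_d -> 'I_d -> 'rV[rat]_d) (D : 'M[rat]_d) N0 :
  is_derivation c D -> (forall v, in_center c v -> v *m D = 0 -> v = 0) -> (0 < N0)%N ->
  exists (F Fi : 'M[rat]_d) (P k : nat),
  [/\ [/\ (0 < P)%N, coprime N0 P, F *m Fi = 1%:M, Fi *m F = 1%:M
        & forall x y, sc_bracket c x y *m F = sc_bracket c (x *m F) (y *m F)],
      forall i j, P%:R ^+ k * (F - 1%:M) i j / N0%:R \in Num.int,
      forall v K, in_center c v -> (0 < K)%N ->
        (forall i, latt 1 K (iter i (mulmxr F) v)) -> v = 0
    & forall M k0, exists e, local_splitting_mx F Fi P M k0 e /\ stable_under D e].
Proof.
move=> HD Hinj N0_gt0.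
have [L [f [gT [ap [theta [r [y [[apM ap1] [apfix theta_inj] Hr [th0 th_int th_gen] [yD yint ynz]]]]]]]]] :=
  galois_data (char_poly_monic D).
rewrite map_char_poly in Hr.
have [prj Hsp] := spectral_exists Hr; set s := undup r in Hsp.
have Hroot l : root (char_poly (map_mx f D)) l -> l \in s.
  by rewrite Hr root_prod_XsubC mem_undup.
pose Y l := numq (y l).
have EY l : l \in s -> (Y l)%:~R = y l :> rat.
  by rewrite mem_undup => /yint/numqK->.
have Y0 l : l \in s -> Y l = 0 -> l = 0.
  move=> Hl E; apply: contraTeq isT => l0.
  by have := ynz l; rewrite -mem_undup -(EY l Hl) E eqxx => /(_ Hl l0).
have Yadd l m : l \in s -> m \in s -> l + m \in s -> forall g, Y (ap g (l + m)) = Y (ap g l) + Y (ap g m).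
  move=> Hl Hm Hlm g; apply: (@intr_inj rat); rewrite intrD.
  by rewrite !EY ?(ap_spec ap Hsp Hroot) // rmorphD yD.
have [N1 N10 HN1] := almost_all_good apM ap1 apfix theta_inj th_gen s prj.
have [r1 [h1 [E1 [N2 [N20 Eneg1 HN2 St1]]]]] := rational_coefficients th_gen Hsp (neg_indicator Y).
have [r2 [h2 [E2 [N3 [N30 Eneg2 HN3 St2]]]]] :=
  rational_coefficients th_gen Hsp (neg_indicator (fun l => - Y l)).
have [N4 N40 HN4] : exists2 N, (0 < N)%N & forall l, l \in s -> forall i j, algint (N%:R * prj l i j).
  pose X := [seq prj p.1 p.2.1 p.2.2 | p <- [seq (l, q) | l <- s, q <- enum {: 'I_d * 'I_d}]].
  have [N N_gt0 HN] : exists2 N, (0 < N)%N & forall u, u \in X -> algint (N%:R * u).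
    elim: X => [|u X [N N_gt0 HN]]; first by exists 1%N.
    have [n n0 Hn] := algint_multiple apM ap1 apfix u.
    exists (n * N)%N => [|w]; first by rewrite muln_gt0 n0.
    rewrite inE natrM => /orP[/eqP->|/HN Hw].
      by rewrite mulrAC; apply: algintM => //; apply: algint_nat.
    by rewrite -mulrA; apply: algintM => //; apply: algint_nat.
  exists N => // l Hl i j; apply: HN; apply/seq.mapP; exists (l, (i, j)) => //.
  by apply/allpairsP; exists (l, (i, j)); rewrite mem_enum.
(* [N0] is the prescribed congruence, [N1] to [N3] exclude the bad moduli, and [N4] clears the
   denominators of the projections. *)
pose N := (N0 * N1 * N2 * N3 * N4)%N.
have N_gt0 : (0 < N)%N by rewrite !muln_gt0 N0_gt0 N10 N20 N30.
have [x [P [eps HP]]] := norm_modulus_exists apM ap1 apfix th0 th_int N_gt0.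
have P1 := modulus_gt1 HP; have P0 := ltnW P1.
(* Asking for [N * P] instead of [N] makes [Q] prime to [P]. *)
have [x' [Q [eps' HQ']]] : exists x' Q eps', norm_modulus f ap theta (N * P) x' Q eps'.
  by apply: norm_modulus_exists => //; rewrite muln_gt0 N_gt0.
have HQ : norm_modulus f ap theta N x' Q eps'.
  by case: HQ' => *; split=> //; apply: dvdn_trans (dvdn_mulr _ _) _; eauto.
have Q1 := modulus_gt1 HQ.
have PQ : coprime P Q.
  by apply: coprime_dvdl (modulus_coprime HQ'); apply: dvdn_trans (modulus_dvd HQ'); apply: dvdn_mull.
have cN R x0 eps0 : norm_modulus f ap theta N x0 R eps0 -> coprime N R.
  by move=> H; apply: coprime_dvdl (modulus_dvd H) (modulus_coprime H).
have cN' R : coprime N R -> [/\ coprime N0 R, coprime N1 R, coprime N2 R & coprime N3 R].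
  by rewrite !coprimeMl => /andP[/andP[/andP[/andP[]]]].
have [cP0 cP1 cP2 cP3] := cN' _ (cN _ _ _ HP); have [cQ0 cQ1 cQ2 cQ3] := cN' _ (cN _ _ _ HQ).
set a := 1 + x%:R * theta in HP; set b := 1 + x'%:R * theta in HQ.
have a0 : a != 0 := modulus_generator_neq0 HP; have b0 : b != 0 := modulus_generator_neq0 HQ.
pose t := unit_weight ap a b Y.
have t0 l : t l != 0 by apply: unit_weight_neq0.
have tap g l : ap g (t l) = t (ap g l) by apply: unit_weight_ap.
have [F EF] := rational_spectral_fun apfix Hsp Hroot (fun g l _ => tap g l).
have [|Fi EFi] := rational_spectral_fun apfix Hsp Hroot (h := fun l => (t l)^-1).
  by move=> g l _; rewrite fmorphV tap.
have tM l m : l \in s -> m \in s -> l + m \in s -> t (l + m) = t l * t m.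
  by move=> Hl Hm Hlm; apply: unit_weight_add => // g; apply: Yadd.
have swap l : t l = unit_weight ap b a (fun m => - Y m) l by apply: unit_weight_swap.
have EF' : map_mx f F = spectral_fun s prj (unit_weight ap b a (fun m => - Y m)).
  by rewrite -EF; apply: eq_spectral_fun => l _; rewrite swap.
have EFi' : map_mx f Fi = spectral_fun s prj (fun l => (unit_weight ap b a (fun m => - Y m) l)^-1).
  by rewrite -EFi; apply: eq_spectral_fun => l _; rewrite swap.
have [k1 Hk1] := half_bounded ap1 th_int HP HQ PQ N_gt0 (HN1 _ cP1) (esym EF) (esym EFi).
have QP : coprime Q P by rewrite coprime_sym.
have [k2 Hk2] := half_bounded ap1 th_int HQ HP QP N_gt0 (HN1 _ cQ1) EF' EFi'.
have [k3 Hk3] : exists k0, forall k, (k0 <= k)%N -> forall l, l \in s ->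
    algint ((P * Q)%:R ^+ k * (t l - 1) / N%:R).
  by apply: eventually_all => l _; apply: (unit_weight_cong ap1 th_int HP HQ).
pose k := (k1 + k2 + k3)%N.
have [FP FiP] := Hk1 k ltac:(rewrite /k; lia).
have [FQ FiQ] := Hk2 k ltac:(rewrite /k; lia).
exists F, Fi, (P * Q)%N, k; split; first split.
- by rewrite muln_gt0 P0 ltnW.
- by rewrite coprimeMr cP0.
- apply: (map_mx_inj (f := f)); rewrite map_mxM -EF -EFi map_mx1 (spectral_funM Hsp).
  by rewrite -(spectral_fun1 Hsp); apply: eq_spectral_fun => l _; rewrite mulfV.
- apply: (map_mx_inj (f := f)); rewrite map_mxM -EF -EFi map_mx1 (spectral_funM Hsp).
  by rewrite -(spectral_fun1 Hsp); apply: eq_spectral_fun => l _; rewrite mulVf.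
- move=> u v; apply: (map_mx_inj (f := f)); rewrite map_mxM -!ext_br !map_mxM -EF.
  exact: (spectral_fun_hom (ext_derivation f HD) Hsp tM).
- move=> i j; apply: (algint_rat (f := f)).
  have -> : f ((P * Q)%:R ^+ k * (F - 1%:M) i j / N0%:R) =
      \sum_(l <- s) ((P * Q)%:R ^+ k * (t l - 1) / N%:R) * ((N1 * N2 * N3)%:R * (N4%:R * prj l i j)).
    have -> : f ((P * Q)%:R ^+ k * (F - 1%:M) i j / N0%:R) = (P * Q)%:R ^+ k * (map_mx f F - 1%:M) i j / N0%:R.
      by rewrite -(map_mx1 f) -map_mxB [in RHS]mxE (rmorphM f _ N0%:R^-1) fmorphV (rmorphM f (_ ^+ _)) rmorphXn !(rmorph_nat f).
    rewrite -EF -(spectral_sum Hsp) /spectral_fun -sumrB summxE mulr_sumr mulr_suml.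
    apply: eq_bigr => l _; rewrite !mxE /N !natrM.
    have nz m : (0 < m)%N -> m%:R != 0 :> L by move=> m0; rewrite -(rmorph_nat f) fmorph_eq0 pnatr_eq0 -lt0n.
    by field; rewrite !nz.
  rewrite big_seq; apply: algint_sum => l Hl; apply: algintM.
    by apply: Hk3 => //; rewrite /k; lia.
  by apply: algintM; [apply: algint_nat | apply: HN4].
(* The components at nonzero eigenvalues vanish, because of [P] when [Y] is negative and of [Q] when
   it is positive. On what is left [D] is nilpotent, yet it is injective on the center. *)
- move=> v K Cv K0 Hv; apply: (derivation_nil_center HD Hinj (k := d)) => //.
  apply: (map_mx_inj (f := f)); rewrite map_mx0.
  have iterE m : map_mx f (iter m (mulmxr D) v) =
      map_mx f v *m iter m (mulmxr (map_mx f D - 0%:M)) 1%:M.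
    elim: m => [|m IH] /=; first by rewrite mulmx1.
    by rewrite map_mxM IH -mulmxA raddf0 subr0.
  rewrite iterE.
  rewrite -[map_mx f v]mulmx1 -{1}(spectral_sum Hsp) mulmx_sumr mulmx_suml big_seq big1 // => l Hl.
  case: (ltgtP (Y l) 0) => HY.
  + by rewrite (half_bounded_orbit apM ap1 apfix th_int Hsp HP HQ PQ N_gt0 (HN1 _ cP1) (esym EF) K0 Hv Hl HY) mul0mx.
  + rewrite (half_bounded_orbit apM ap1 apfix th_int Hsp HQ HP QP N_gt0 (HN1 _ cQ1) EF' K0 Hv Hl) ?mul0mx //.
    by rewrite oppr_lt0.
  + have H := spectral_nil Hsp Hl; rewrite {2}(Y0 l Hl HY) in H.
    by rewrite -mulmxA H mulmx0.
- move=> M k0.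
  have [|e1 [He1 e1Q S1]] := half_splitting apM ap1 apfix th_int Hsp HP HQ PQ N_gt0 (HN1 _ cP1) (esym EF) (esym EFi) Eneg1 _ St1 M k0.
    by move=> R [->|->]; apply: HN2.
  have [|e2 [He2 e2P S2]] := half_splitting apM ap1 apfix th_int Hsp HQ HP QP N_gt0 (HN1 _ cQ1) EF' EFi' Eneg2 _ St2 M k0.
    by move=> R [->|->]; apply: HN3.
  have [u [w He]] := splitting_combine P1 Q1 PQ FP FiP FQ FiQ He1 He2 e1Q e2P.
  exists (u *: e1 + w *: e2); split=> // U HU v Hv.
  by rewrite mulmxDr -!scalemxAr memvD ?memvZ ?S1 ?S2.
Qed.

(** * Density of the orbits *)

(** Finite index is given through a finite invariant [rho] whose fibres lie in single cosets. A
    coset is encoded by the set of values of [rho] on it, and the trivial one is represented by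
    1. *)
Lemma coset_space (G : groupType) (H : G -> Prop) (T : finType) (rho : G -> T) :
  H 1%g -> (forall g h, H g -> H h -> H (g^-1 * h)%g) ->
  (forall g h, rho g = rho h -> H (g^-1 * h)%g) ->
  exists (A : finType) (idx : G -> A) (rep : A -> G),
  [/\ forall a, idx (rep a) = a, rep (idx 1%g) = 1%g
    & forall g h, idx g = idx h <-> H (g^-1 * h)%g].
Proof.
move=> H1 HV Hrho.
have Hinv g : H g -> H g^-1%g by move=> Hg; have := HV _ _ Hg H1; rewrite mulg1.
have HM g h : H g -> H h -> H (g * h)%g by move=> /Hinv Hg Hh; rewrite -[g]invgK; apply: HV.
pose cl g : {set T} := [set t | `[< exists h, rho h = t /\ H (g^-1 * h)%g >]].
have clP g h : cl g = cl h <-> H (g^-1 * h)%g.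
  split=> [E|Hgh].
    have : rho g \in cl g by rewrite inE; apply/asboolP; exists g; rewrite mulVg.
    rewrite E inE => /asboolP[k [Ek Hk]].
    have := HM _ _ Hk (Hrho _ _ Ek); rewrite mulgA mulgK => /Hinv.
    by rewrite invMg invgK.
  have Hhg : H (h^-1 * g)%g by have := Hinv _ Hgh; rewrite invMg invgK.
  apply/setP => t; rewrite !inE; apply: asbool_equiv_eq; split=> -[k [Ek Hk]]; exists k; split=> //.
    by have := HM _ _ Hhg Hk; rewrite mulgA mulgK.
  by have := HM _ _ Hgh Hk; rewrite mulgA mulgK.
pose A := {S : {set T} | `[< exists g, cl g = S >]}.
have clA g : `[< exists h, cl h = cl g >] by apply/asboolP; exists g.
pose idx g : A := exist _ (cl g) (clA g).
have ex (a : A) : exists g, idx g = a.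
  by case: a => S HS; have /asboolP[g Hg] := HS; exists g; apply: val_inj.
pose rep (a : A) := if a == idx 1%g then 1%g else sval (cid (ex a)).
exists A, idx, rep; split.
- by move=> a; rewrite /rep; case: eqP => [->//|_]; case: cid.
- by rewrite /rep eqxx.
- by move=> g h; rewrite -clP; split=> [/(congr1 val)//|E]; apply: val_inj.
Qed.

Lemma locZ_power_int P q k : locZ P q -> P%:R ^+ k * q \in Num.int -> q \in Num.int.
Proof.
move=> [b [Hb Hq]] HPq.
have /coprimezP[[u v] /= E] : coprimez b%:Z (P ^ k)%N%:Z.
  by rewrite /coprimez -[gcdz _ _]/(gcdn b (P ^ k))%:Z; apply/coprimeXr.
have -> : q = u%:~R * (b%:R * q) + v%:~R * (P%:R ^+ k * q).
  have : (u * b%:Z + v * (P ^ k)%N%:Z)%:~R = 1 :> rat by rewrite E.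
  rewrite !rmorphD !rmorphM /= -!pmulrn natrX => E2.
  by rewrite !mulrA -mulrDl E2 mul1r.
by rewrite rpredD // rpredM // intr_int.
Qed.

Lemma derivation_lcs d (c : 'I_d -> 'I_d -> 'rV[rat]_d) (D : 'M[rat]_d) j :
  is_lie (sc_bracket c) -> is_derivation c D -> forall u, u \in lcs (sc_bracket c) fullv j ->
  u *m D \in lcs (sc_bracket c) fullv j.
Proof.
move=> Lbr HD; elim: j => [|j IH] u; first by rewrite !memvf.
move: u; have /subvP H : (lcs (sc_bracket c) fullv j.+1 <=
    linfun (mulmxr D) @^-1: lcs (sc_bracket c) fullv j.+1)%VS.
  apply: commv_le => x y _ Hy; rewrite -memv_preim lfunE /= HD.
  by apply: memvD; apply: mem_commv; rewrite ?memvf //; apply: IH.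
by move=> u /H; rewrite -memv_preim lfunE.
Qed.

Lemma common_locZ (P n : nat) (d : nat) (X : nat -> 'rV[rat]_d) :
  (forall i, (i <= n)%N -> matZ P (X i)) ->
  exists2 B, coprime B P & forall i, (i <= n)%N -> latt 1 B (X i).
Proof.
move=> HX; have one (v : 'rV[rat]_d) : matZ P v -> exists2 B, coprime B P & latt 1 B v.
  move=> Hv; pose B j := sval (cid (Hv 0 j)).
  exists (\prod_j B j)%N.
    apply: (big_ind (fun b => coprime b P)) => //; first exact: coprime1n.
      by move=> a b Ha Hb; rewrite coprimeMl Ha.
    by move=> j _; rewrite /B; case: cid => b [].
  move=> j; rewrite divr1 (bigD1 j) //= mulnC natrM -mulrA rpredM ?rpred_nat //.
  by rewrite /B; case: cid => b [].
elim: n HX => [|n IH] HX.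
  have [B HB1 HB2] := one _ (HX 0%N (leqnn _)); exists B => // i.
  by rewrite leqn0 => /eqP->.
have [|B1 H1 H1'] := IH; first by move=> i Hi; apply: HX; apply: leq_trans Hi _.
have [B2 H2 H2'] := one _ (HX n.+1 (leqnn _)).
exists (B1 * B2)%N; first by rewrite coprimeMl H1.
move=> i; rewrite leq_eqVlt => /orP[/eqP->|Hi]; [exact: lattMl | exact/lattMr/H1'].
Qed.

Section DerivationToAction.
Variables (G : groupType) (d : nat) (c : 'I_d -> 'I_d -> 'rV[rat]_d) (iota : G -> 'rV[rat]_d).
Hypothesis Hm : is_malcev_lie_algebra c iota.
Hypothesis Hfg : finitely_generated G.
Variable D : 'M[rat]_d.
Hypothesis HD : is_derivation c D.
Hypothesis Dinj : forall v, in_center c v -> v *m D = 0 -> v = 0.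
Notation br := (sc_bracket c).
Let Lbr := malcev_lie Hm.
Let Ubr (x y : 'rV[rat]_d) : x \in fullv -> y \in fullv -> br x y \in fullv := fun _ _ => memvf _.

Lemma derivation_dense : densely_self_similar G.
Proof.
have [T [T3 iotaM]] := malcev_bch Hm; have [n Hn] := malcev_lcs Hm.
have i1 := iota1 Hm T3 iotaM; have iV := iotaV Hm T3 iotaM.
have [n1 n1_gt0 Hn1] := malcev_lattice Hm T3 iotaM.
have [M0 M0_gt0 HM0] := malcev_bounded Hm T3 iotaM Hfg.
have [K1 K1_gt0 Hsolve] := bch_solve_latt Lbr T3 n M0_gt0.
have [K2 K2_gt0 Hcong] := bch_latt_cong Lbr T M0_gt0.
pose N1 := (n1 * K1)%N; have N1_gt0 : (0 < N1)%N by rewrite muln_gt0 n1_gt0.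
(* A vector congruent to [iota g] modulo a deep enough lattice is in the group: the missing factor,
   found by [bch_solve], falls in the lattice of [Hn1]. *)
have near g y : latt N1 M0 (y - iota g) -> exists g', iota g' = y.
  move=> Hy; have := Hsolve N1 (iota g) _ N1_gt0 (HM0 g) Hy; set w := bch_solve _ _ _ _ _ => Hw.
  have [|g' Eg'] := Hn1 (n1%:R^-1 *: w).
    move=> j; have := Hw j; rewrite !mxE /N1 natrM divr1 mul1r.
    have K10 : K1%:R != 0 :> rat by rewrite pnatr_eq0 -lt0n.
    have n10 : n1%:R != 0 :> rat by rewrite pnatr_eq0 -lt0n.
    by rewrite invfM mulrCA mulfV // mulr1.
  exists (g * g')%g; rewrite iotaM -Eg' scalerA mulfV ?pnatr_eq0 -?lt0n // scale1r.
  by rewrite (bch_solveP Lbr T3 Ubr (Hn fullv)) ?memvf // addrC subrK.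
pose N0 := (N1 * M0 * n1)%N; have N0_gt0 : (0 < N0)%N by rewrite !muln_gt0 n1_gt0 K1_gt0 M0_gt0.
have [F [Fi [P [k [[P_gt0 cop FFi FiF Fhom] Fcong Fbound Fsplit]]]]] := global_automorphism HD Dinj N0_gt0.
have [copN1 copM0 copn1] : [/\ coprime N1 P, coprime M0 P & coprime n1 P].
  by move: cop; rewrite /N0 !coprimeMl => /andP[/andP[]].
have Fihom x y : br x y *m Fi = br (x *m Fi) (y *m Fi).
  have E (z : 'rV[rat]_d) : z = z *m Fi *m F by rewrite -mulmxA FiF mulmx1.
  by rewrite {1}(E x) {1}(E y) -Fhom -mulmxA FFi mulmx1.
have bchF (B : 'M[rat]_d) x y : (forall x y, br x y *m B = br (x *m B) (y *m B)) ->
    bch_poly T br x y *m B = bch_poly T br (x *m B) (y *m B).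
  move=> HB; apply: (@bch_poly_morph _ _ T br br (mulmxr B)) => //= [u v|a u]; first exact: mulmxDl.
  by rewrite scalemxAl.
have iotaZ g : matZ P (iota g).
  move=> i j; exists M0; split=> //; rewrite ord1; have := HM0 g j; by rewrite divr1.
have PF : matZ P (P%:R ^+ k *: F).
  move=> i j; apply: locZ_int; rewrite mxE.
  have := Fcong i j; rewrite !mxE => H.
  have -> : P%:R ^+ k * F i j = N0%:R * (P%:R ^+ k * (F i j - (i == j)%:R) / N0%:R) + P%:R ^+ k * (i == j)%:R.
    by field; rewrite pnatr_eq0 -lt0n.
  by rewrite rpredD // rpredM ?rpredX ?rpred_nat.
(* Away from [P] the congruence of [F] to 1 keeps the image close to [iota g], so integrality at [P]
   alone decides membership. *)
have Fclosed g : matZ P (iota g *m F) -> exists g', iota g' = iota g *m F.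
  move=> HF; apply: (near g) => j; apply: (@locZ_power_int P _ k).
    apply: locZM; last by rewrite mxE; apply: locZD; [exact: HF | rewrite mxE; apply/locZN/iotaZ].
    by apply: locZM; [exact: locZ_nat | apply: locZV].
  have -> : P%:R ^+ k * (M0%:R / N1%:R * (iota g *m F - iota g) 0 j) =
      \sum_i (M0%:R * iota g 0 i) * ((M0 * n1)%:R * (P%:R ^+ k * (F - 1%:M) i j / N0%:R)).
    rewrite -[X in _ - X]mulmx1 -mulmxBr mxE !mulr_sumr; apply: eq_bigr => i _.
    have nz m : (0 < m)%N -> m%:R != 0 :> rat by move=> m0; rewrite pnatr_eq0 -lt0n.
    by rewrite /N0 !natrM; field; rewrite !nz.
  apply: rpred_sum => i _; rewrite rpredM //; first by have := HM0 g i; rewrite divr1.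
  by rewrite rpredM ?rpred_nat.
pose H g := exists g', iota g' = iota g *m F.
have H1 : H 1%g by exists 1%g; rewrite i1 mul0mx.
have HV g h : H g -> H h -> H (g^-1 * h)%g.
  move=> [g' Eg] [h' Eh]; exists (g'^-1 * h')%g.
  by rewrite !iotaM !iV (bchF F) // mulNmx Eg Eh.
(* Group elements congruent modulo [R] have a quotient divisible by P^k, enough to clear the
   denominators of [F]; [K2] pays for the loss in the product. *)
pose R := (K2 * P ^ k)%N; have R_gt0 : (0 < R)%N by rewrite muln_gt0 K2_gt0 expn_gt0 P_gt0.
pose rho g : {ffun 'I_d -> 'I_R} := [ffun j =>
  Ordinal (ltn_pmod `|(Num.floor (M0%:R * iota g 0 j)%R %% R)%Z|%N R_gt0)].
have Hrho g h : rho g = rho h -> H (g^-1 * h)%g.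
  move=> E; apply: Fclosed.
  have Ed : latt R M0 (iota h - iota g).
    move=> j; have := congr1 (fun r : {ffun _ -> _} => val (r j)) E; rewrite !ffunE /=.
    have fl g0 : (Num.floor (M0%:R * iota g0 0 j))%:~R = M0%:R * iota g0 0 j :> rat.
      by apply: floorK; have := HM0 g0 j; rewrite divr1.
    have R0 : (R%:Z != 0)%R by rewrite eqz_nat -lt0n.
    rewrite !modn_small; try by rewrite -ltz_nat gez0_abs ?modz_ge0 // ltz_pmod.
    move=> /(congr1 Posz); rewrite !gez0_abs ?modz_ge0 // => /esym/eqP.
    rewrite eqz_mod_dvd => /dvdzP[z Ez]; rewrite !mxE mulrAC mulrBr -(fl h) -(fl g) -rmorphB Ez rmorphM /=.
    by rewrite -pmulrn mulfK ?intr_int // pnatr_eq0 -lt0n.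
  have := Hcong R (- iota g) (- iota g) (iota h) (iota g) R_gt0.
  rewrite subrr (bchN Lbr T3) subr0 -iV -iotaM => Hlat i j.
  have {}Hlat : latt R K2 (iota (g^-1 * h)%g).
    by apply: Hlat => //; [exact: latt0 | rewrite iV].
  apply: locZ_int; rewrite mxE; apply: rpred_sum => l _; rewrite (ord1 i).
  have -> : iota (g^-1 * h)%g 0 l * F l j = (K2%:R / R%:R * iota (g^-1 * h)%g 0 l) * (P%:R ^+ k * F l j).
    rewrite /R natrM natrX; field.
    by rewrite expf_neq0 ?pnatr_eq0 -?lt0n ?K2_gt0.
  rewrite rpredM //.
  have := Fcong l j; rewrite !mxE => H'.
  have -> : P%:R ^+ k * F l j = N0%:R * (P%:R ^+ k * (F l j - (l == j)%:R) / N0%:R) + P%:R ^+ k * (l == j)%:R.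
    by field; rewrite pnatr_eq0 -lt0n.
  by rewrite rpredD // rpredM ?rpredX ?rpred_nat.
have [A [idx [rep [repK rep1 idxE]]]] := coset_space H1 HV Hrho.
have idx1 g : idx g = idx 1%g <-> H g.
  by split=> [/esym/idxE|Hg]; [|apply/esym/idxE]; rewrite invg1 mul1g.
pose f g := if pselect (H g) is left Hg then sval (cid Hg) else 1%g.
have Hf g : H g -> iota (f g) = iota g *m F.
  by move=> Hg; rewrite /f; case: pselect => // Hg'; case: cid.
have f_in g : H g -> forall g', iota g' = iota g *m F -> f g = g'.
  by move=> Hg g' E; apply: (malcev_inj Hm); rewrite Hf.
have fM g h : H g -> H h -> f (g * h)%g = (f g * f h)%g.
  move=> Hg Hh; apply: f_in; last by rewrite !iotaM (bchF F) // !Hf.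
  by exists (f g * f h)%g; rewrite !iotaM (bchF F) // !Hf.
apply: (virtual_endo_dense (f := f) repK rep1).
- by move=> g h; rewrite idxE idx1.
- by move=> g h /idx1 Hg /idx1 Hh; apply: fM.
(* Induction from the deep end of the series. The quotients of elements of [N] form a set [N2] of
   the same kind; it contains the commutators with [g], which lie deeper and are trivial. So [g] is
   central and [Fbound] applies. *)
- have core j : forall N : G -> Prop, (forall g h, N g -> N (h^-1 * g * h)%g) ->
      (forall g, N g -> idx g = idx 1%g /\ N (f g)) ->
      forall g, N g -> iota g \in lcs br fullv (n - j) -> g = 1%g.
    elim: j => [|j IH] N Nconj Nf g Ng.
      by rewrite subn0 Hn memv0 => /eqP E; apply: (malcev_inj Hm); rewrite E i1.
    have [Hj|Hj] := leqP n j; first by rewrite (_ : n - j.+1 = n - j)%N; [apply: IH Ng | lia].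
    move=> Hg; pose N2 a := exists x y, [/\ N x, N y & a = (x^-1 * y)%g].
    have comm h : (h^-1 * g^-1 * (h * g))%g = 1%g.
      apply: (IH N2).
      - move=> a h' [x [y [Nx Ny ->]]]; exists (h'^-1 * x * h')%g, (h'^-1 * y * h')%g.
        by split; [exact: Nconj | exact: Nconj | rewrite !invMg invgK !mulgA mulgK].
      - move=> a [x [y [Nx Ny ->]]]; have [/idx1 Hx Nfx] := Nf x Nx; have [/idx1 Hy Nfy] := Nf y Ny.
        split; first exact/idx1/HV.
        exists (f x), (f y); split=> //; apply: f_in; first exact: HV.
        by rewrite !iotaM (bchF F) // !iV !Hf // mulNmx.
      - exists (h^-1 * g * h)%g, g; split=> //; first exact: Nconj.
        by rewrite !invMg invgK !mulgA.
      - have -> : (n - j = (n - j.+1).+1)%N by lia.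
        have Hc := bch_comm Lbr T3 Ubr (memvf (iota h)) Hg.
        rewrite !iotaM !iV -[bch_poly _ _ _ _](subrK (br (iota h) (iota g))).
        apply: memvD; last by apply: br_lcsS => //; apply: memvf.
        by apply: subvP Hc; apply: (lcs_anti Lbr Ubr).
    have Cg : in_center c (iota g).
      move=> y; apply: (malcev_central Hm T3) => h; rewrite -!iotaM; congr iota.
      by have := comm h; rewrite -invMg => /(congr1 (mulg (g * h)%g)); rewrite mulKVg mulg1.
    have it i : N (iter i f g) /\ iota (iter i f g) = iter i (mulmxr F) (iota g).
      elim: i => [//|i [IH1 IH2]]; have [/idx1 H' H''] := Nf _ IH1.
      by split=> //=; rewrite Hf // IH2.
    apply: (malcev_inj Hm); rewrite i1; apply: (Fbound _ M0 Cg M0_gt0) => i.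
    by case: (it i) => _ <-.
  by move=> N Nconj Nf g Ng; apply: (core n N) => //; rewrite subnn; apply: memvf.
move=> k0 g; have [e [[Eback Eforth Eidem] Est]] := Fsplit k k0.
have elcs j u : u \in lcs br fullv j -> u *m e \in lcs br fullv j.
  by apply: Est; apply: derivation_lcs.
pose back h := exists hs : nat -> G, hs 0%N = h /\
  forall i, (i <= k0)%N -> iota (hs i) = iter i (mulmxr Fi) (iota h).
have iterFi i x y : iter i (mulmxr Fi) (bch_poly T br x y) =
    bch_poly T br (iter i (mulmxr Fi) x) (iter i (mulmxr Fi) y).
  by elim: i => //= i ->; rewrite (bchF Fi).
(* [h] absorbs the part of [g] seen by [e] one step of the lower central series
   at a time; [back h] says that [h] lies in the image of the [k0]-th iterate. *)
have approx j : exists h u w, [/\ back h, matZ P u, w \in lcs br fullv j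
    & iota (h^-1 * g)%g *m e = P%:R ^+ k *: u + w].
  elim: j => [|j [h [u [w [[hs [hs0 Hhs]] Hu Hw Er]]]]].
    exists 1%g, 0, (iota (1^-1 * g)%g *m e); split; last by rewrite scaler0 add0r.
    - exists (fun _ => 1%g); split=> // i _; rewrite i1; elim: i => //= i <-.
      by rewrite mul0mx.
    - by move=> i l; rewrite mxE; apply: (locZ_nat P 0).
    - exact: memvf.
  set r := iota (h^-1 * g)%g in Er; have Hr : matZ P r := iotaZ _.
  have He : matZ P e := Eback 0%N (leq0n _).
  have Pk : locZ P (P%:R ^+ k) by apply/locZX/locZ_nat.
  have Hw' : matZ P w.
    have -> : w = r *m e - P%:R ^+ k *: u by rewrite Er addrC addKr.
    by apply: matZB; [apply: matZM | apply: matZZ].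
  have [B HB HBw] : exists2 B, coprime B P & forall i, (i <= k0)%N -> latt 1 B (w *m iter i (mulmxr Fi) e).
    by apply: common_locZ => i Hi; apply: matZM => //; apply: Eback.
  (* A multiplier that is 1 modulo P^k and divisible by [n1 * B]: it puts [w *m e] and its images
     under [Fi] into the group while changing it only modulo P^k. *)
  have [m [z Em]] : exists m z : int, 1 + z * (P ^ k)%N%:Z = m * (n1 * B)%N%:Z.
    have : coprimez (n1 * B)%N%:Z (P ^ k)%N%:Z.
      rewrite /coprimez -[gcdz _ _]/(gcdn (n1 * B) (P ^ k))%:Z; apply/coprimeXr.
      by rewrite coprimeMl copn1.
    by case/coprimezP=> -[a b] /= E; exists a, (- b); rewrite -E; ring.
  pose mq : rat := m%:~R * (n1 * B)%:R.
  have Emq : mq = 1 + z%:~R * P%:R ^+ k.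
    by rewrite /mq -natrX 2!pmulrn -!rmorphM -Em rmorphD rmorph1.
  have iterw i : iter i (mulmxr Fi) (mq *: (w *m e)) = mq *: (w *m iter i (mulmxr Fi) e).
    by elim: i => //= i ->; rewrite -scalemxAl mulmxA.
  have ex i : (i <= k0)%N -> exists g', iota g' = iter i (mulmxr Fi) (mq *: (w *m e)).
    move=> Hi; have [|g' Eg'] := Hn1 (m%:~R *: (B%:R *: (w *m iter i (mulmxr Fi) e))).
      apply: latt_int => l; have := HBw i Hi l; rewrite !mxE !divr1 mul1r.
      by [].
    by exists g'; rewrite -Eg' iterw !scalerA /mq natrM; congr (_ *: _); ring.
  pose hs' i := if pselect (i <= k0)%N is left Hi then sval (cid (ex i Hi)) else 1%g.
  have Hhs' i : (i <= k0)%N -> iota (hs' i) = iter i (mulmxr Fi) (mq *: (w *m e)).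
    by move=> Hi; rewrite /hs'; case: pselect => // Hi'; case: cid.
  have Eh' : iota (hs' 0%N) = mq *: (w *m e) by rewrite Hhs'.
  (* [e] fixes [w] modulo P^k, because [w] is r e modulo P^k and [e] is idempotent to that
     precision; [a1] is the defect. *)
  pose a1 := u - u *m e + r *m (P%:R ^- k *: (e *m e - e)).
  have Ha1 : matZ P a1.
    by apply: matZD; [apply: matZB => //; apply: matZM | apply: matZM].
  have P0 : P%:R ^+ k != 0 :> rat by rewrite expf_neq0 // pnatr_eq0 -lt0n.
  have Ewe : w *m e = w + P%:R ^+ k *: a1.
    have Ew : w = r *m e - P%:R ^+ k *: u by rewrite Er addrC addKr.
    have -> : P%:R ^+ k *: a1 = P%:R ^+ k *: u - P%:R ^+ k *: (u *m e) + (r *m e *m e - r *m e).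
      rewrite /a1 scalerDr (scalerBr _ u); congr (_ + _).
      by rewrite -scalemxAr scalerA mulfV // scale1r mulmxBr mulmxA.
    rewrite {1}Ew mulmxBl -scalemxAl Er.
    move: ((P%:R ^+ k *: u + w) *m e) (P%:R ^+ k *: u) (P%:R ^+ k *: (u *m e)) => X1 X2 X3.
    by apply/matrixP => i l; rewrite !mxE; ring.
  (* The product differs from the sum by this error, which lies one step deeper in the series. *)
  pose w' := iota ((hs' 0%N)^-1 * (h^-1 * g))%g - (- iota (hs' 0%N) + r).
  have Hw'' : w' \in lcs br fullv j.+1.
    rewrite /w' iotaM iV; apply: (bch_lcs1 Lbr T3 Ubr); rewrite ?memvf //.
    by left; rewrite memvN Eh' memvZ // elcs.
  exists (h * hs' 0%N)%g, (u - a1 - a1 *m e - z%:~R *: (w *m e *m e)), (w' *m e); split.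
  - exists (fun i => hs i * hs' i)%g; split; first by rewrite hs0.
    by move=> i Hi; rewrite !iotaM iterFi Hhs // Hhs' // Eh'.
  - apply: matZB; last first.
      by apply: matZZ; [exact/locZ_int/intr_int | apply: matZM => //; apply: matZM].
    by apply: matZB; [exact: matZB | exact: matZM].
  - exact: elcs.
  - have -> : ((h * hs' 0%N)^-1 * g = (hs' 0%N)^-1 * (h^-1 * g))%g by rewrite invMg mulgA.
    have -> : iota ((hs' 0%N)^-1 * (h^-1 * g))%g = w' + (r - iota (hs' 0%N)).
      by rewrite /w' [r - _]addrC subrK.
    rewrite mulmxDl addrC; congr (_ + _); rewrite mulmxBl Er Eh' Emq -!scalemxAl.
    rewrite scalerDl scale1r -scalerA [X in _ - (X + _)](_ : _ = w + P%:R ^+ k *: (a1 + a1 *m e)).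
      move: (w *m e *m e) (a1 *m e) => X1 X2.
      by apply/matrixP => i l; rewrite !mxE; ring.
    by rewrite {1}Ewe mulmxDl -scalemxAl Ewe -addrA -scalerDr.
have [h [u [w [[hs [hs0 Hhs]] Hu Hw Er]]]] := approx n.
move: Hw; rewrite Hn memv0 => /eqP w0; rewrite w0 addr0 in Er.
(* The part of the quotient seen by [e] is P^k u, where P^k clears the denominators of [F]; the
   other part is integral by [Eforth]. *)
have Hgood : H (h^-1 * g)%g.
  apply: Fclosed; have -> : iota (h^-1 * g)%g *m F =
      iota (h^-1 * g)%g *m ((1%:M - e) *m F) + u *m (P%:R ^+ k *: F).
    rewrite -scalemxAr scalemxAl -Er mulmxA -mulmxDl -mulmxDr subrK mulmx1 //.
  by apply: matZD; apply: matZM.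
have FiK i : (i < k0)%N -> iota (hs i.+1) *m F = iota (hs i).
  by move=> Hi; rewrite !Hhs //= 1?ltnW // -mulmxA FiF mulmx1.
have it i : (i <= k0)%N -> iter i f (hs k0) = hs (k0 - i)%N.
  elim: i => [|i IH] Hi; first by rewrite subn0.
  have E : (k0 - i = (k0 - i.+1).+1)%N by lia.
  rewrite /= IH ?E; last exact: ltnW.
  have Hlt : (k0 - i.+1 < k0)%N by lia.
  by apply: f_in; [exists (hs (k0 - i.+1)%N)|]; rewrite FiK.
(* [f] carries it back to [h] in [k0] steps without leaving the domain, and [h] is in the coset of
   [g]. *)
exists (hs k0).
  move=> i Hi; apply/idx1; rewrite it; last exact: ltnW.
  have E : (k0 - i = (k0 - i.+1).+1)%N by lia.
  by rewrite E; exists (hs (k0 - i.+1)%N); rewrite FiK //; lia.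
by rewrite it // subnn hs0; apply/idxE.
Qed.

End DerivationToAction.

Theorem theorem2 (G : groupType) (d : nat) (c : 'I_d -> 'I_d -> 'rV[rat]_d)
    (iota : G -> 'rV[rat]_d) :
  finitely_generated G -> torsion_free G -> nilpotent_group G ->
  is_malcev_lie_algebra c iota ->
  (transitive_self_similar G <-> densely_self_similar G) /\
  (densely_self_similar G <-> has_special_grading (complexify c)).
Proof.
move=> Hfg _ _ Hm.
have i_iii := @transitive_special_grading _ _ _ _ Hm.
have iii_ii : has_special_grading (complexify c) -> densely_self_similar G.
  move=> /(@special_grading_derivation (complex Rdefinitions.R))[D [HD Dinj]].
  have [D' [HD' Dinj']] := @derivation_descent Cplx rat_to_C d c D HD Dinj.
  exact: (derivation_dense Hm Hfg HD' Dinj').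
by split; split; auto using dense_transitive.
Qed.
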